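(* The Hopf algebra $\mathbf{H}_o$ of ordered forests is isomorphic, as a graded Hopf algebra, to the graded dual $\mathbf{PQSym}^*$ of the Novelli–Thibon Hopf algebra $\mathbf{PQSym}$ of parking functions.
   Context: Let $\mathbb K$ be a field of characteristic $0$. An ordered forest on $n$ vertices ($n\ge 0$) is a rooted forest whose vertex set is $[n]=\{1,\dots,n\}$ with its natural total order (the labels need not be related to the tree structure); it is determined by its set of roots and the parent map $p$ on non-root vertices. A vertex $w$ is a descendant of $v$ if $v$ is obtained from $w$ by applying $p$ at least once. For $I\subseteq[n]$ with $|I|=k$, the restriction $\mathcal F_{|I}$ is the ordered forest on $[k]$ obtained by keeping the vertices in $I$ and the edges of $\mathcal F$ between two vertices of $I$ (a vertex of $I$ whose parent is not in $I$ becomes a root), relabelled via the unique increasing bijection $I\to[k]$. An admissible cut of $\mathcal F$ is a subset $V\subseteq[n]$ (possibly empty) containing no two distinct vertices one of which is a descendant of the other. For such $V$, let $L_V$ be the set of vertices lying in $V$ or descending from an element of $V$, and set $\mathrm{Lea}_V\mathcal F=\mathcal F_{|L_V}$, $\mathrm{Roo}_V\mathcal F=\mathcal F_{|[n]\setminus L_V}$. For ordered forests $\mathcal F$ on $[n]$ and $\mathcal G$ on $[m]$, $\mathcal F\mathcal G$ is the ordered forest on $[n+m]$ which is the disjoint union of $\mathcal F$ and of $\mathcal G$ with labels shifted by $n$. $\mathbf H_o$ is the $\mathbb K$-vector space with basis the ordered forests, graded by number of vertices, with product extending $(\mathcal F,\mathcal G)\mapsto\mathcal F\mathcal G$ (unit: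 the empty forest $1$) and coproduct $\Delta(\mathcal F)=\sum_{V}\mathrm{Roo}_V\mathcal F\otimes\mathrm{Lea}_V\mathcal F$, the sum over admissible cuts $V$ of $\mathcal F$. A parking function of length $n$ is a word $a_1\cdots a_n$ over positive integers whose nondecreasing rearrangement $b_1\le\dots\le b_n$ satisfies $b_i\le i$ for all $i$. For a word $w$ of length $n$ over positive integers, let $d(w)=\min\{i: \#\{j: w_j\le i\}<i\}$ (with $d(w)=n+1$ if $w$ is a parking function); the parkization $\mathrm{park}(w)$ is $w$ if $w$ is a parking function, and otherwise $\mathrm{park}(w')$ where $w'$ is obtained from $w$ by decrementing by $1$ every letter greater than $d(w)$. Over a totally ordered alphabet $X=\{x_1<x_2<\cdots\}$ (identifying $x_i$ with $i$), $\mathbf{PQSym}^*$ is the span of the series $\mathbf G_a=\sum_{\mathrm{park}(w)=a}w$ ($a$ a parking function) in $\mathbb K\langle\langle X\rangle\rangle$, with the ordinary product and the coproduct $\Delta\mathbf G_a=\mathbf G_a(X\oplus Y)$, where $X\oplus Y$ is the ordinal sum of $X$ and a copy $Y$ (all letters of $X$ smaller than all letters of $Y$), letters of $X$ commuting with letters of $Y$ and $P(X)Q(Y)$ identified with $P\otimes Q$. *)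

(* Defs.v *)
From HB Require Import structures.
From mathcomp Require Import all_boot all_order all_algebra.
Set Implicit Arguments. Unset Strict Implicit. Unset Printing Implicit Defensive.
Import Order.TTheory GRing.Theory Num.Theory.

(* Ordered forests on [n] (vertex i of 'I_n stands for vertex i+1).     *)
(* A forest is given by its parent map: p v = None iff v is a root.     *)
Definition rawforest (n : nat) := {ffun 'I_n -> option 'I_n}.
HB.instance Definition _ n := Finite.copy (rawforest n) {ffun 'I_n -> option 'I_n}.

Definition parent_rel n (p : rawforest n) : rel 'I_n := fun x y => p x == Some y.

Definition rdesc n (p : rawforest n) (w v : 'I_n) : bool :=
  [exists u, (p w == Some u) && connect (parent_rel p) u v].

Definition acyclic n (p : rawforest n) : bool := [forall v, ~~ rdesc p v v].

Definition oforest (n : nat) := {p : rawforest n | acyclic p}.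
HB.instance Definition _ n := Finite.copy (oforest n) {p : rawforest n | acyclic p}.

Definition desc n (F : oforest n) := rdesc (val F).

Lemma acyclic_roots n : acyclic ([ffun _ => None] : rawforest n).
Proof.
apply/forallP => v; apply/existsP => -[u]; by rewrite ffunE.
Qed.
Definition roots_forest n : oforest n := exist (fun p : rawforest n => acyclic p) _ (acyclic_roots n).

(* restriction F_{|I}, relabelled by the increasing bijection I -> [#|I|]
   (enum I lists I in increasing order) *)
Definition restrict_raw n (p : rawforest n) (I : {set 'I_n}) : rawforest #|I| :=
  [ffun i : 'I_#|I| =>
     obind (fun u => insub (index u (enum I))) (p (enum_val i))].
(* (insubd never falls back to the default: restrictions of forests are forests) *)
Definition restrict n (F : oforest n) (I : {set 'I_n}) : oforest #|I| :=
  insubd (roots_forest #|I|) (restrict_raw (val F) I).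

Definition concat_raw n m (p : rawforest n) (q : rawforest m) : rawforest (n + m) :=
  [ffun i => match split i with
             | inl j => omap (@lshift n m) (p j)
             | inr j => omap (@rshift n m) (q j) end].
Definition fconcat n m (F : oforest n) (G : oforest m) : oforest (n + m) :=
  insubd (roots_forest (n + m)) (concat_raw (val F) (val G)).

Definition admissible n (F : oforest n) (V : {set 'I_n}) : bool :=
  [forall u in V, forall v in V, (u != v) ==> ~~ desc F u v].
Definition LV n (F : oforest n) (V : {set 'I_n}) : {set 'I_n} :=
  [set w | (w \in V) || [exists v in V, desc F w v]].
Definition Lea n (F : oforest n) V := restrict F (LV F V).
Definition Roo n (F : oforest n) V := restrict F (~: LV F V).

Definition is_word (w : seq nat) : bool := all (fun x => 0 < x) w.

Definition is_parking (w : seq nat) : bool :=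
  is_word w && all (fun i => nth 0 (sort leq w) i <= i.+1) (iota 0 (size w)).

Definition dpark (w : seq nat) : nat :=
  (find (fun i => count (fun x => x <= i) w < i) (iota 1 (size w))).+1.

Definition decr (w : seq nat) : seq nat :=
  map (fun x => if dpark w < x then x.-1 else x) w.

Fixpoint park_iter (k : nat) (w : seq nat) : seq nat :=
  if k is k'.+1 then (if dpark w == (size w).+1 then w else park_iter k' (decr w))
  else w.
(* each non-trivial step decreases the sum of the letters, so sumn w steps suffice *)
Definition park (w : seq nat) : seq nat := park_iter (sumn w) w.

Definition pfun (n : nat) := {t : n.-tuple 'I_n.+1 | is_parking (map val t)}.
HB.instance Definition _ n := Finite.copy (pfun n) {t : n.-tuple 'I_n.+1 | is_parking (map val t)}.
Definition pword n (a : pfun n) : seq nat := map val (val a).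

Local Open Scope ring_scope.

(* G_a = sum_{park(w) = a} w *)
Definition Gser (K : fieldType) n (a : pfun n) : seq nat -> K :=
  fun w => (is_word w && (park w == pword a))%:R.

(* the element sum_a c_a G_a of the degree n component of PQSym^* *)
Definition ser (K : fieldType) n (c : {ffun pfun n -> K}) : seq nat -> K :=
  fun w => \sum_(a : pfun n) c a * Gser K a w.

Definition sprod (K : fieldType) (f g : seq nat -> K) : seq nat -> K :=
  fun w => \sum_(i < (size w).+1) f (take i w) * g (drop i w).

Definition sunit (K : fieldType) : seq nat -> K := fun w => (w == [::])%:R.

(* The word over X (+) Y obtained by shuffling u (letters of X, at the positions
   of S) and v (letters of Y elsewhere).  The ordinal sum X (+) Y is realized by
   sending y_j to N + j with N = max(u) + |u| + |v|: every y-letter then exceeds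
   every x-letter by more than the length of the word, which (for parkization)
   is the same as Y lying entirely above X. *)
Definition shuffle_word (u v : seq nat) (S : {set 'I_(size u + size v)}) : seq nat :=
  let N := (foldr maxn 0 u + size u + size v)%N in
  [seq (if i \in S then nth 0 u (index i (enum S))
        else (N + nth 0 v (index i (enum (~: S))))%N) | i <- enum 'I_(size u + size v)].

(* coefficient of u(X) v(Y) = u (x) v in G_a(X (+) Y), X and Y commuting *)
Definition DeltaG (K : fieldType) n (a : pfun n) (u v : seq nat) : K :=
  \sum_(S : {set 'I_(size u + size v)} | #|S| == size u) Gser K a (shuffle_word S).

Definition DeltaS (K : fieldType) n (c : {ffun pfun n -> K}) (u v : seq nat) : K :=
  \sum_(a : pfun n) c a * DeltaG K a u v.

Definition linext (K : fieldType) n (phi : oforest n -> {ffun pfun n -> K})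
  (x : {ffun oforest n -> K}) : {ffun pfun n -> K} :=
  [ffun a => \sum_(F : oforest n) x F * phi F a].

(* Main.v *)
Require Import Defs.
From HB Require Import structures.
From mathcomp Require Import all_boot all_order all_algebra.
From mathcomp Require Import zify.
From Stdlib Require Import IndefiniteDescription.
Set Implicit Arguments. Unset Strict Implicit. Unset Printing Implicit Defensive.
Import Order.TTheory GRing.Theory.

(* Linear maps from H_o to PQSym^* preserving the degree are pairings M(F, w)
   between ordered forests and words, invariant under parkization of w.

   Besides the product FG, forests carry the graft of G below the last vertex of F;
   on words it corresponds to [w = uv] with every letter of v at least the last
   letter of u.  Both coproducts split in two: on forests according to the side of
   the last vertex, on words according to the alphabet of the last letter.  On the
   dual spaces this gives two half products "left" and "right" satisfying the
   dendriform relations.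

   M is built by induction on the degree.  On a forest decomposable for one of the
   two products its values are forced by lower degrees, and they are automatically
   compatible with the split coproducts.  On the indecomposable forests the
   compatibility is a system of linear equations.  By the dendriform relations it
   suffices to test it on the elements (x right p) left y of the dual with p
   indecomposable and x, y not both empty.  These elements are linearly independent
   already on the decomposable forests, and as many as them; hence the system is
   solvable, and its solutions can be chosen so that the square matrix of M stays
   invertible.  The matrix is square because ordered forests and parking functions
   obey the same recursion: detach the children of one root, resp. remove all the
   letters 1. *)

(** * Cuts of forests *)

(** The equations on an indecomposable forest, one for each side and each pair [(u, v)] of nonempty
    parking functions, are in general linearly dependent, so the question is their consistency. Both
    members are expanded on triple products: for words in the basis dual to the lower part of [M],
    for forests in the delta basis. On decomposable forests the members agree, since compatibility
    with cuts is inherited from the factors; triple products being independent there, the two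
    families of coefficients coincide. The matrix of triple products against decomposable forests
    counts cuts into three pieces: it does not depend on [M], and its invertibility is settled
    before the induction.

    The graft and its word condition fit together because a cut putting the last vertex of [F] in
    the lower part takes all of [G] along, just as letters bounded below by a letter of the upper
    alphabet are all in that alphabet.

    A prefix or suffix of a parking function need not be one. Hence the pairing is carried by all
    words, and rests on this fact: a subword of a word and the same subword of its parkization have
    the same parkization. *)

Fixpoint splits (I : seq nat) : seq (seq nat * seq nat) :=
  if I is x :: I' then
    [seq (x :: s.1, s.2) | s <- splits I'] ++ [seq (s.1, x :: s.2) | s <- splits I']
  else [:: ([::], [::])].

Section SplitSums.
Variable K : nmodType.
Implicit Types (I J : seq nat).
Local Open Scope ring_scope.

Lemma big_splits_cons x I (f : seq nat * seq nat -> K) :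
  \sum_(s <- splits (x :: I)) f s =
  \sum_(s <- splits I) f (x :: s.1, s.2) + \sum_(s <- splits I) f (s.1, x :: s.2).
Proof. by rewrite /= big_cat !big_map. Qed.

Lemma big_splits_cat I J (f : seq nat -> seq nat -> K) :
  \sum_(s <- splits (I ++ J)) f s.1 s.2 =
  \sum_(s <- splits I) \sum_(t <- splits J) f (s.1 ++ t.1) (s.2 ++ t.2).
Proof.
elim: I f => [|x I IH] f; first by rewrite /= big_seq1.
rewrite cat_cons !big_splits_cons /=.
by rewrite (IH (fun a b => f (x :: a) b)) (IH (fun a b => f a (x :: b))).
Qed.

Lemma splits_map (g : nat -> nat) I :
  splits (map g I) = [seq (map g s.1, map g s.2) | s <- splits I].
Proof. by elim: I => //= x I ->; rewrite map_cat -!map_comp. Qed.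

(** Both sides run over the ordered partitions of [I] into three subsequences: each letter chooses
    its block independently. *)
Lemma big_splits_assoc I (f : seq nat -> seq nat -> seq nat -> K) :
  \sum_(s <- splits I) \sum_(t <- splits s.1) f t.1 t.2 s.2 =
  \sum_(s <- splits I) \sum_(t <- splits s.2) f s.1 t.1 t.2.
Proof.
elim: I f => [|x I IH] f; first by rewrite /= !big_seq1 /= ?big_seq1.
rewrite !big_splits_cons.
under eq_bigr do rewrite [splits _]/= -/splits big_splits_cons /=.
rewrite big_split /= -addrA; congr (_ + _).
  exact: (IH (fun a b c => f (x :: a) b c)).
under [in RHS]eq_bigr do rewrite [splits _]/= -/splits big_splits_cons /=.
rewrite big_split /=; congr (_ + _).
  exact: (IH (fun a b c => f a (x :: b) c)).
exact: (IH (fun a b c => f a b (x :: c))).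
Qed.

Lemma big_splits_nil2 I (f : seq nat -> seq nat -> K) :
  \sum_(s <- splits I | s.2 == [::]) f s.1 s.2 = f I [::].
Proof.
elim: I f => [|x I IH] f; first by rewrite /= big_mkcond big_seq1 eqxx.
rewrite /= big_cat !big_map /= (IH (fun a b => f (x :: a) b)).
by rewrite big_pred0 ?addr0.
Qed.

Lemma big_splits_nil1 I (f : seq nat -> seq nat -> K) :
  \sum_(s <- splits I | s.1 == [::]) f s.1 s.2 = f [::] I.
Proof.
elim: I f => [|x I IH] f; first by rewrite /= big_mkcond big_seq1 eqxx.
rewrite /= big_cat !big_map /= (IH (fun a b => f a (x :: b))).
by rewrite big_pred0 ?add0r.
Qed.
End SplitSums.

Lemma perm_splits I s : s \in splits I -> perm_eq (s.1 ++ s.2) I.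
Proof.
elim: I s => [|x I IH] s /=; first by rewrite inE => /eqP ->.
rewrite mem_cat => /orP [] /mapP [t /IH tI ->] /=; first by rewrite perm_cons.
by rewrite -cat1s perm_catCA /= perm_cons.
Qed.

Lemma mem_splits I s : s \in splits I -> forall x, (x \in I) = (x \in s.1) || (x \in s.2).
Proof. by move=> /perm_splits /perm_mem H x; rewrite -H mem_cat. Qed.

Lemma subseq_splits I s : s \in splits I -> subseq s.1 I && subseq s.2 I.
Proof.
elim: I s => [|x I IH] s /=; first by rewrite inE => /eqP ->.
rewrite mem_cat => /orP [] /mapP [t /IH /andP [t1 t2] ->] /=.
  by rewrite eqxx t1; apply: subseq_trans t2 (subseq_cons I x).
by rewrite eqxx t2 andbT; apply: subseq_trans t1 (subseq_cons I x).
Qed.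

Lemma subseq_splits1 I s : s \in splits I -> subseq s.1 I.
Proof. by move=> /subseq_splits /andP []. Qed.
Lemma subseq_splits2 I s : s \in splits I -> subseq s.2 I.
Proof. by move=> /subseq_splits /andP []. Qed.

Lemma size_splits I s : s \in splits I -> size s.1 + size s.2 = size I.
Proof. by move=> /perm_splits /perm_size <-; rewrite size_cat. Qed.

Lemma last_subseq (I A : seq nat) :
  uniq I -> subseq A I -> last 0 I \in A -> last 0 A = last 0 I.
Proof.
case: (lastP I) => [|J x]; first by case: A.
rewrite last_rcons rcons_uniq => /andP [xJ _] sA xA.
case: (lastP A) sA xA => // B y sB; rewrite mem_rcons inE last_rcons => /orP [/eqP //|xB].
case/subseqP: sB => m; rewrite size_rcons => sm.
case: (lastP m) sm => // m' b; rewrite size_rcons => -[sm].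
rewrite -!cats1 mask_cat //; case: b => /=; rewrite ?cats0 cats1.
  by rewrite cats1 => /rcons_inj [_].
move=> E; have: x \in rcons B y by rewrite mem_rcons inE xB orbT.
by rewrite E => /mem_mask; rewrite (negbTE xJ).
Qed.

(* A forest on [n] is coded by its word of parents, 0 standing for the absent
   parent of a root. *)
Definition par (F : seq nat) v := nth 0 (0 :: F) v.

(** Acyclicity is expressed as nilpotency of the parent map, with a bound on the number of steps
    that keeps the predicate decidable; [forestP] removes the bound. *)
Definition forest (F : seq nat) :=
  all (fun p => p <= size F) F &&
  all (fun v => iter (size F) (par F) v == 0) (iota 1 (size F)).

Definition reindex_in (I : seq nat) q := if q \in I then (index q I).+1 else 0.
Definition restr F I := [seq reindex_in I (par F v) | v <- I].
(** For complementary [A] (the [Roo] part) and [B] (the [Lea] part), [B] is closed under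
    descendants. Such sets [B] are the [LV F V] for [V] admissible, see [big_admissible]. *)
Definition uncut (F A B : seq nat) := all (fun v => par F v \notin B) A.

(* The Boolean records whether the last vertex belongs to the Roo part. *)
Definition cutb (b : bool) (F : seq nat) : seq (seq nat * seq nat) :=
  [seq (restr F s.1, restr F s.2) | s <- splits (iota 1 (size F)) &
    uncut F s.1 s.2 && ((size F \in s.1) == b)].
Definition cuts F := cutb true F ++ cutb false F.

Definition dot (F G : seq nat) :=
  F ++ [seq (if x == 0 then 0 else size F + x) | x <- G].
(* all the roots of [G] become children of the last vertex of [F] *)
Definition graft (F G : seq nat) := F ++ [seq size F + x | x <- G].

Lemma size_restr F I : size (restr F I) = size I.
Proof. by rewrite size_map. Qed.

Lemma size_dot F G : size (dot F G) = size F + size G.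
Proof. by rewrite size_cat size_map. Qed.
Lemma size_graft F G : size (graft F G) = size F + size G.
Proof. by rewrite size_cat size_map. Qed.

Lemma index_map_in (g : nat -> nat) (s : seq nat) x (P : pred nat) :
  {in P &, injective g} -> {subset s <= P} -> x \in P -> index (g x) (map g s) = index x s.
Proof.
move=> gi; elim: s => //= y s IH sP xP.
have yP : y \in P by apply: sP; rewrite mem_head.
have -> : (g y == g x) = (y == x) by apply/eqP/eqP => [/(gi _ _ yP xP)|->].
by case: eqP => // _; rewrite IH // => z zs; apply: sP; rewrite inE zs orbT.
Qed.

Lemma mem_map_in (g : nat -> nat) (s : seq nat) x (P : pred nat) :
  {in P &, injective g} -> {subset s <= P} -> x \in P -> (g x \in map g s) = (x \in s).
Proof.
by move=> gi sP xP; rewrite -!index_mem size_map (index_map_in gi).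
Qed.

Section CutRestr.
Variables (F I : seq nat).
Hypotheses (uI : uniq I).

(** Inverse of the relabelling: new labels start at 1, and the absent parent 0 is sent to itself. *)
Let g := nth 0 (0 :: I).

Lemma map_nth_iota1 : map g (iota 1 (size I)) = I.
Proof.
rewrite (iotaDl 1 0) -map_comp.
by apply: (@eq_from_nth _ 0); rewrite size_map size_iota // => i iI; rewrite (nth_map 0) ?size_iota // nth_iota.
Qed.

Let P := [pred x | x \in iota 1 (size I)].

Let g_inj : {in P &, injective g}.
Proof.
move=> x y; rewrite !inE !mem_iota !add1n => /andP [x0 xI] /andP [y0 yI].
case: x x0 xI => // x _ xI; case: y y0 yI => // y _ yI; rewrite /g /= => /eqP.
by rewrite nth_uniq // => /eqP ->.
Qed.

Lemma par_restr v : par (restr F I) v = if v \in iota 1 (size I) then reindex_in I (par F (g v)) else 0.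
Proof.
rewrite mem_iota; case: v => [//|v]; rewrite /= /par /= add1n ltnS.
by case: ltnP => vI; [rewrite (nth_map 0) | rewrite nth_default // size_map].
Qed.

Lemma restr_restr A : {subset A <= iota 1 (size I)} -> restr (restr F I) A = restr F (map g A).
Proof.
move=> sA; rewrite /restr -map_comp; apply/eq_in_map => v vA /=.
rewrite -/(restr F I) par_restr sA //.
set q := par F _; rewrite /reindex_in; case qI: (q \in I).
  have ip : (index q I).+1 \in P by rewrite inE mem_iota /= add1n ltnS index_mem.
  have gq : g (index q I).+1 = q by rewrite /g /= nth_index.
  rewrite -[in RHS]gq (mem_map_in g_inj) //; case: ifP => // H.
  by rewrite (index_map_in g_inj).
rewrite ifF; last by apply/negP => /sA; rewrite mem_iota.
rewrite ifF //; apply/negP => /mapP [x /sA]; rewrite mem_iota add1n => /andP [x0 xI] Eq.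
by move/negP: qI; apply; rewrite Eq /g; case: x x0 xI {Eq} => //= x _; rewrite ltnS => /(mem_nth 0).
Qed.

Lemma uncut_restr A B : {subset A <= iota 1 (size I)} -> {subset B <= iota 1 (size I)} ->
  uncut (restr F I) A B = uncut F (map g A) (map g B).
Proof.
move=> sA sB; rewrite /uncut all_map; apply: eq_in_all => v vA /=.
rewrite par_restr sA // /reindex_in; set q := par F _; case qI: (q \in I).
  have ip : (index q I).+1 \in P by rewrite inE mem_iota /= add1n ltnS index_mem.
  have gq : g (index q I).+1 = q by rewrite /g /= nth_index.
  by rewrite -[in RHS]gq (mem_map_in g_inj).
have -> : 0 \notin B by apply/negP => /sB; rewrite mem_iota.
apply/esym/negP => /mapP [x /sB]; rewrite mem_iota add1n => /andP [x0 xI] Eq.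
by move/negP: qI; apply; rewrite Eq /g; case: x x0 xI {Eq} => //= x _; rewrite ltnS => /(mem_nth 0).
Qed.

(** Cutting a restriction amounts to splitting its set of old labels inside [F]. Iterated cuts thus
    become sums over splittings of the labels of a single forest. *)
Lemma big_cutb_restr (K : nmodType) b (f : seq nat -> seq nat -> K) :
  (\sum_(c <- cutb b (restr F I)) f c.1 c.2 =
   \sum_(s <- splits I | uncut F s.1 s.2 && ((last 0 I \in s.1) == b))
      f (restr F s.1) (restr F s.2))%R.
Proof.
rewrite /cutb big_map big_filter /= size_restr.
have -> : splits I = [seq (map g s.1, map g s.2) | s <- splits (iota 1 (size I))].
  by rewrite -splits_map map_nth_iota1.
rewrite big_map /=.
rewrite big_seq_cond [RHS]big_seq_cond; apply: eq_big => [s|s /andP [sI _]] /=; last first.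
  have s1 := mem_subseq (subseq_splits1 sI); have s2 := mem_subseq (subseq_splits2 sI).
  by rewrite (restr_restr s1) (restr_restr s2).
case sI : (s \in _) => //=.
have s1 := mem_subseq (subseq_splits1 sI); have s2 := mem_subseq (subseq_splits2 sI).
rewrite uncut_restr //; congr (_ && (_ == _)).
case: (posnP (size I)) s1 => [->|I0] s1 /=.
  by case: (s.1) s1 => // x r; rewrite /= => /(_ x); rewrite mem_head => /(_ isT).
have -> : last 0 I = g (size I).
  by rewrite /g -nth_last; case: (size I) I0.
by rewrite (mem_map_in g_inj) // inE mem_iota I0 add1n /=.
Qed.
End CutRestr.

Lemma splits_last_in n s : s \in splits (iota 1 n) -> n \in s.1 -> last 0 s.1 = n.
Proof.
move=> sI ns.
have lI : last 0 (iota 1 n) = n by rewrite -nth_last size_iota; case: n {sI ns} => // n; rewrite nth_iota.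
by rewrite (@last_subseq (iota 1 n)) ?lI ?iota_uniq ?subseq_splits1.
Qed.

Lemma splits_last_notin n s : s \in splits (iota 1 n) -> n \notin s.1 -> last 0 s.2 = n.
Proof.
move=> sI ns.
have lI : last 0 (iota 1 n) = n by rewrite -nth_last size_iota; case: n {sI ns} => // n; rewrite nth_iota.
case: n sI ns lI => [|n] sI ns lI.
  by move: sI; rewrite /= inE => /eqP ->.
have: n.+1 \in iota 1 n.+1 by rewrite mem_iota; lia.
rewrite (mem_splits sI) (negbTE ns) /= => ns2.
by rewrite (@last_subseq (iota 1 n.+1)) ?lI ?iota_uniq ?subseq_splits2.
Qed.

Lemma splits_uniq I s : uniq I -> s \in splits I -> uniq s.1 /\ uniq s.2.
Proof.
by move=> uI sI; split; apply: subseq_uniq uI; rewrite ?subseq_splits1 ?subseq_splits2.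
Qed.

(** * Coassociativity of the split coproduct of forests *)

Section ForestCoassoc.
Variables (K : nmodType) (F : seq nat).
Implicit Type f : seq nat -> seq nat -> seq nat -> K.
Local Open Scope ring_scope.
Let n := size F.

Lemma big_cutb b (h : seq nat -> seq nat -> K) :
  \sum_(c <- cutb b F) h c.1 c.2 =
  \sum_(s <- splits (iota 1 n) | uncut F s.1 s.2 && ((n \in s.1) == b))
     h (restr F s.1) (restr F s.2).
Proof. by rewrite /cutb big_map big_filter. Qed.

Lemma big_cuts_restr I (h : seq nat -> seq nat -> K) : uniq I ->
  \sum_(c <- cuts (restr F I)) h c.1 c.2 =
  \sum_(s <- splits I | uncut F s.1 s.2) h (restr F s.1) (restr F s.2).
Proof.
move=> uI; rewrite /cuts big_cat /= !big_cutb_restr //.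
rewrite [RHS](bigID (fun s => last 0%N I \in s.1)) /=; congr (_ + _).
  by apply: eq_bigl => s; rewrite eqb_id.
by apply: eq_bigl => s; rewrite eqbF_neg.
Qed.

(** No vertex has its parent in a later block. By [uncut_l] and [uncut_r], both ways of iterating a
    cut lead to this condition. *)
Let uncut3 (t1 t2 t3 : seq nat) := [&& uncut F t1 t2, uncut F t1 t3 & uncut F t2 t3].

(** Normal form of an iterated cut; [P] will say which of the three blocks holds the last vertex.
    The two normal forms agree by [big_splits_assoc]. *)
Let cut3_left (P : seq nat -> seq nat -> seq nat -> bool) f :=
  \sum_(s <- splits (iota 1 n)) \sum_(t <- splits s.1 | uncut3 t.1 t.2 s.2 && P t.1 t.2 s.2)
    f (restr F t.1) (restr F t.2) (restr F s.2).
Let cut3_right (P : seq nat -> seq nat -> seq nat -> bool) f :=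
  \sum_(s <- splits (iota 1 n)) \sum_(t <- splits s.2 | uncut3 s.1 t.1 t.2 && P s.1 t.1 t.2)
    f (restr F s.1) (restr F t.1) (restr F t.2).

Let cut3_lr P f : cut3_left P f = cut3_right P f.
Proof.
rewrite /cut3_left /cut3_right.
under eq_bigr do rewrite big_mkcond /=.
under [RHS]eq_bigr do rewrite big_mkcond /=.
by rewrite (big_splits_assoc (iota 1 n) (fun a b c => if uncut3 a b c && P a b c then f (restr F a) (restr F b) (restr F c) else 0)).
Qed.

Let uncut_l s t : t \in splits s.1 ->
  uncut F s.1 s.2 && uncut F t.1 t.2 = uncut3 t.1 t.2 s.2.
Proof.
move=> tI; rewrite /uncut3.
have -> : uncut F s.1 s.2 = uncut F t.1 s.2 && uncut F t.2 s.2.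
  rewrite -all_cat; apply: eq_all_r; apply: perm_mem; rewrite perm_sym; exact: perm_splits.
by case: (uncut F t.1 t.2) (uncut F t.1 s.2) (uncut F t.2 s.2) => [] [] [].
Qed.

Let uncut_r s t : t \in splits s.2 ->
  uncut F s.1 s.2 && uncut F t.1 t.2 = uncut3 s.1 t.1 t.2.
Proof.
move=> tI; rewrite /uncut3.
have -> : uncut F s.1 s.2 = uncut F s.1 t.1 && uncut F s.1 t.2.
  rewrite /uncut -all_predI; apply: eq_all => v /=.
  by rewrite (mem_splits tI) negb_or.
by case: (uncut F t.1 t.2) (uncut F s.1 t.1) (uncut F s.1 t.2) => [] [] [].
Qed.

Let left_bb b b' (P : seq nat -> seq nat -> seq nat -> bool) f :
  (forall s t, s \in splits (iota 1 n) -> t \in splits s.1 ->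
     ((n \in s.1) == b) && ((last 0%N s.1 \in t.1) == b') = P t.1 t.2 s.2) ->
  \sum_(c <- cutb b F) \sum_(d <- cutb b' c.1) f d.1 d.2 c.2 = cut3_left P f.
Proof.
move=> HP; rewrite (big_cutb b (fun c1 c2 => \sum_(d <- cutb b' c1) f d.1 d.2 c2)) /cut3_left big_mkcond.
apply: eq_big_seq => s sI.
have [u1 _] := splits_uniq (iota_uniq 1 n) sI.
rewrite (big_cutb_restr F u1 b' (fun d1 d2 => f d1 d2 (restr F s.2))).
case: ifP => H.
  rewrite big_seq_cond [RHS]big_seq_cond; apply: eq_bigl => t.
  case tI: (t \in _) => //=; rewrite -HP // -uncut_l //.
  by case/andP: H => -> ->.
rewrite big_seq_cond big_pred0 // => t; case tI: (t \in _) => //=.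
rewrite -HP // -uncut_l //; move: H.
by case: (uncut F s.1 _); case: ((n \in _) == _); rewrite ?andbF.
Qed.

Let left_b b (P : seq nat -> seq nat -> seq nat -> bool) f :
  (forall s t, s \in splits (iota 1 n) -> t \in splits s.1 -> ((n \in s.1) == b) = P t.1 t.2 s.2) ->
  \sum_(c <- cutb b F) \sum_(d <- cuts c.1) f d.1 d.2 c.2 = cut3_left P f.
Proof.
move=> HP; rewrite (big_cutb b (fun c1 c2 => \sum_(d <- cuts c1) f d.1 d.2 c2)) /cut3_left big_mkcond.
apply: eq_big_seq => s sI.
have [u1 _] := splits_uniq (iota_uniq 1 n) sI.
rewrite (big_cuts_restr (fun d1 d2 => f d1 d2 (restr F s.2)) u1).
case: ifP => H.
  rewrite big_seq_cond [RHS]big_seq_cond; apply: eq_bigl => t.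
  case tI: (t \in _) => //=; rewrite -(HP s t) // -uncut_l //.
  by case/andP: H => -> ->; rewrite andbT.
rewrite big_seq_cond big_pred0 // => t; case tI: (t \in _) => //=.
rewrite -(HP s t) // -uncut_l //; move: H.
by case: (uncut F s.1 _); case: ((n \in _) == _); rewrite ?andbF.
Qed.

Let right_bb b b' (P : seq nat -> seq nat -> seq nat -> bool) f :
  (forall s t, s \in splits (iota 1 n) -> t \in splits s.2 ->
     ((n \in s.1) == b) && ((last 0%N s.2 \in t.1) == b') = P s.1 t.1 t.2) ->
  \sum_(c <- cutb b F) \sum_(d <- cutb b' c.2) f c.1 d.1 d.2 = cut3_right P f.
Proof.
move=> HP; rewrite (big_cutb b (fun c1 c2 => \sum_(d <- cutb b' c2) f c1 d.1 d.2)) /cut3_right big_mkcond.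
apply: eq_big_seq => s sI.
have [_ u1] := splits_uniq (iota_uniq 1 n) sI.
rewrite (big_cutb_restr F u1 b' (fun d1 d2 => f (restr F s.1) d1 d2)).
case: ifP => H.
  rewrite big_seq_cond [RHS]big_seq_cond; apply: eq_bigl => t.
  case tI: (t \in _) => //=; rewrite -HP // -uncut_r //.
  by case/andP: H => -> ->.
rewrite big_seq_cond big_pred0 // => t; case tI: (t \in _) => //=.
rewrite -HP // -uncut_r //; move: H.
by case: (uncut F s.1 _); case: ((n \in _) == _); rewrite ?andbF.
Qed.

Let right_b b (P : seq nat -> seq nat -> seq nat -> bool) f :
  (forall s t, s \in splits (iota 1 n) -> t \in splits s.2 -> ((n \in s.1) == b) = P s.1 t.1 t.2) ->
  \sum_(c <- cutb b F) \sum_(d <- cuts c.2) f c.1 d.1 d.2 = cut3_right P f.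
Proof.
move=> HP; rewrite (big_cutb b (fun c1 c2 => \sum_(d <- cuts c2) f c1 d.1 d.2)) /cut3_right big_mkcond.
apply: eq_big_seq => s sI.
have [_ u1] := splits_uniq (iota_uniq 1 n) sI.
rewrite (big_cuts_restr (fun d1 d2 => f (restr F s.1) d1 d2) u1).
case: ifP => H.
  rewrite big_seq_cond [RHS]big_seq_cond; apply: eq_bigl => t.
  case tI: (t \in _) => //=; rewrite -(HP s t) // -uncut_r //.
  by case/andP: H => -> ->; rewrite andbT.
rewrite big_seq_cond big_pred0 // => t; case tI: (t \in _) => //=.
rewrite -(HP s t) // -uncut_r //; move: H.
by case: (uncut F s.1 _); case: ((n \in _) == _); rewrite ?andbF.
Qed.

(** Both sides sum over the cuts into three blocks with the last vertex in the first one. In the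
    next two lemmas it is in the second, then in the third; these three cases are the dendriform
    relations. *)
Lemma cutb_assoc_tt f :
  \sum_(c <- cutb true F) \sum_(d <- cutb true c.1) f d.1 d.2 c.2 =
  \sum_(c <- cutb true F) \sum_(d <- cuts c.2) f c.1 d.1 d.2.
Proof.
rewrite (left_bb (P := fun a b c => n \in a)) ?cut3_lr => [|s t sI tI].
  rewrite (right_b (P := fun a b c => n \in a)) // => s t _ _; exact: eqb_id.
rewrite !eqb_id; case ns : (n \in s.1); first by rewrite (splits_last_in sI ns).
by apply/esym; apply: contraFF ns; rewrite (mem_splits tI) => ->.
Qed.

Lemma cutb_assoc_tf f :
  \sum_(c <- cutb true F) \sum_(d <- cutb false c.1) f d.1 d.2 c.2 =
  \sum_(c <- cutb false F) \sum_(d <- cutb true c.2) f c.1 d.1 d.2.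
Proof.
have un : uniq (iota 1 n) := iota_uniq 1 n.
have ds I s x : uniq I -> s \in splits I -> x \in s.1 -> x \in s.2 -> False.
  move=> uI sI x1 x2; move: uI; rewrite -(perm_uniq (perm_splits sI)) cat_uniq.
  by case/and3P => _ /hasPn /(_ _ x2) /negP.
rewrite (left_bb (P := fun a b c => n \in b)) ?cut3_lr => [|s t sI tI].
  rewrite (right_bb (P := fun a b c => n \in b)) // => s t sI tI.
  rewrite eqb_id eqbF_neg; case ns : (n \in s.1) => /=.
    by apply/esym/negP => nt; apply: (ds _ _ _ un sI ns); rewrite (mem_splits tI) nt.
  by rewrite (splits_last_notin sI) ?ns.
have [u1 _] := splits_uniq un sI.
rewrite eqb_id eqbF_neg; case ns : (n \in s.1) => /=; last first.
  by apply/esym; apply: contraFF ns; rewrite (mem_splits tI) orbC => ->.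
rewrite (splits_last_in sI ns); have := ns; rewrite (mem_splits tI).
by case: (boolP (n \in t.1)) => //= n1 _; apply/esym/negP => n2; apply: (ds _ _ _ u1 tI n1).
Qed.

Lemma cutb_assoc_ff f :
  \sum_(c <- cutb false F) \sum_(d <- cuts c.1) f d.1 d.2 c.2 =
  \sum_(c <- cutb false F) \sum_(d <- cutb false c.2) f c.1 d.1 d.2.
Proof.
rewrite (left_b (P := fun a b c => (n \notin a) && (n \notin b))) ?cut3_lr => [|s t sI tI]; last first.
  by rewrite eqbF_neg (mem_splits tI) negb_or.
rewrite (right_bb (P := fun a b c => (n \notin a) && (n \notin b))) // => s t sI tI.
by rewrite !eqbF_neg; case ns : (n \in s.1) => //=; rewrite (splits_last_notin sI) ?ns.
Qed.
End ForestCoassoc.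

Lemma par0 F : par F 0 = 0. Proof. by []. Qed.
Lemma iter_par0 F k : iter k (par F) 0 = 0.
Proof. by elim: k => //= k ->. Qed.

Lemma par_leP (F : seq nat) : reflect (forall v, par F v <= size F) (all (fun p => p <= size F) F).
Proof.
apply: (iffP allP) => H.
  case=> [//|v]; rewrite /par /=; case: (ltnP v (size F)) => vF; first exact/H/mem_nth.
  by rewrite nth_default.
by move=> p /(nthP 0) [i iF <-]; apply: (H i.+1).
Qed.

Lemma par_default F v : size F < v -> par F v = 0.
Proof. by case: v => // v vF; rewrite /par /= nth_default. Qed.

(** If the orbit of [v] avoids 0 for [size F] steps, it has [size F + 1] points in a set of [size F]
    elements, so it loops and never reaches 0. The bound in [forest] therefore loses nothing. *)
Lemma forestP F : reflect ((forall v, par F v <= size F) /\ (forall v, exists k, iter k (par F) v = 0)) (forest F).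
Proof.
apply: (iffP andP) => [[/par_leP H /allP N]|[H N]]; split => //.
- move=> v; case: (ltnP (size F) v) => vF; first by exists 1; rewrite /= par_default.
  case: v vF => [|v] vF; first by exists 0.
  by exists (size F); apply/eqP/N; rewrite mem_iota.
- exact/par_leP.
apply/allP => v; rewrite mem_iota add1n => /andP [v0 vF]; apply/negPn/negP => nz.
have [k kv] := N v.
have nzj j : j <= size F -> iter j (par F) v != 0.
  move=> jF; apply: contra nz => /eqP jz.
  by rewrite -(subnK jF) iterD jz iter_par0.
have bd j : iter j (par F) v <= size F by case: j => [|j] /=; [rewrite -ltnS | apply: H].
have: ~~ uniq (traject (par F) v (size F).+1).
  apply/negP => u.
  have /(uniq_leq_size u) : {subset traject (par F) v (size F).+1 <= iota 1 (size F)}.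
    move=> x /trajectP [j jF ->].
    by rewrite mem_iota add1n ltnS bd lt0n nzj.
  by rewrite size_traject size_iota ltnn.
rewrite looping_uniq negbK => /loopingP /(_ k) /trajectP [j jF].
by rewrite kv => E; move: (nzj j); rewrite -E eqxx => /(_ (ltnW jF)).
Qed.

Lemma forest_par_le F v : forest F -> par F v <= size F.
Proof. by case/forestP. Qed.

Lemma forest_nil : forest [::]. Proof. by []. Qed.

Lemma forest_restr F I : forest F -> uniq I -> 0 \notin I -> forest (restr F I).
Proof.
case/forestP => H N uI I0; apply/forestP; rewrite size_restr; split=> v.
  rewrite par_restr //; case: ifP => // _; rewrite /reindex_in; case: ifP => //.
  by rewrite -index_mem.
(* A path of [F] towards its root is followed in the restriction until it leaves [I]; the last
   vertex before that is a root of the restriction. *)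
have key m w : iter m (par F) w = 0 -> exists k, iter k (par (restr F I)) (reindex_in I w) = 0.
  elim: m w => [|m IH] w; first by move=> /= ->; exists 0; rewrite /reindex_in (negbTE I0).
  rewrite iterSr => /IH [k kw]; rewrite /reindex_in; case wI: (w \in I); last by exists 0.
  exists k.+1; rewrite iterSr par_restr // mem_iota add1n !ltnS index_mem wI /=.
  by rewrite nth_index.
case vI: (v \in iota 1 (size I)); last by exists 1; rewrite /= par_restr // vI.
have [m /key [k]] := N (nth 0 (0 :: I) v).
move: vI; rewrite mem_iota; case: v => //= v; rewrite add1n ltnS => vI.
by rewrite /reindex_in mem_nth // index_uniq // => kv; exists k.
Qed.

Lemma par_catl F G v : v <= size F -> par (F ++ G) v = par F v.
Proof. by case: v => // v vF; rewrite /par /= nth_cat vF. Qed.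
Lemma par_catr F G v : 0 < v -> par (F ++ G) (size F + v) = par G v.
Proof. by case: v => // v _; rewrite addnS /par /= nth_cat ltnNge leq_addr /= addKn. Qed.

Lemma par_dotl F G v : v <= size F -> par (dot F G) v = par F v.
Proof. exact: par_catl. Qed.
Lemma par_graftl F G v : v <= size F -> par (graft F G) v = par F v.
Proof. exact: par_catl. Qed.
Lemma par_dotr F G v : 0 < v ->
  par (dot F G) (size F + v) = if par G v == 0 then 0 else size F + par G v.
Proof.
move=> v0; rewrite par_catr //; case: v v0 => // v _; rewrite /par /=.
case: (ltnP v (size G)) => vG; first by rewrite (nth_map 0).
by rewrite !nth_default ?size_map.
Qed.
Lemma par_graftr F G v : 0 < v <= size G -> par (graft F G) (size F + v) = size F + par G v.
Proof.
case/andP => v0 vG; rewrite par_catr //; case: v v0 vG => // v _ vG; rewrite /par /=.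
by rewrite (nth_map 0).
Qed.

Lemma forest_dot F G : forest F -> forest G -> forest (dot F G).
Proof.
case/forestP => HF NF /forestP [HG NG]; apply/forestP; rewrite size_dot.
have split_v v : v <= size F \/ exists2 w, 0 < w & v = size F + w.
  by case: (leqP v (size F)) => vF; [left | right; exists (v - size F); lia].
split=> v; case: (split_v v) => [vF|[w w0 ->]].
- by rewrite par_dotl // (leq_trans (HF v)) ?leq_addr.
- by rewrite par_dotr //; case: eqP => // _; rewrite leq_add2l.
- have [k kv] := NF v; exists k; elim: k v vF kv => // k IH v vF.
  by rewrite !iterSr par_dotl // => /IH; apply.
have [k kw] := NG w.
elim: k w w0 kw => [|k IH] w w0; first by move=> /= E; rewrite E in w0.
rewrite iterSr; have := par_dotr F G w0; case: (posnP (par G w)) => [-> /= E _|p0 E].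
  by exists 1.
by move=> /(IH _ p0) [j Ej]; exists j.+1; rewrite iterSr E.
Qed.

Lemma forest_graft F G : forest F -> forest G -> forest (graft F G).
Proof.
case/forestP => HF NF /forestP [HG NG]; apply/forestP; rewrite size_graft.
have split_v v : v <= size F \/ exists2 w, 0 < w & v = size F + w.
  by case: (leqP v (size F)) => vF; [left | right; exists (v - size F); lia].
have reachF v : v <= size F -> exists k, iter k (par (graft F G)) v = 0.
  move=> vF; have [k kv] := NF v; exists k; elim: k v vF kv => // k IH v vF.
  by rewrite !iterSr par_graftl // => /IH; apply.
split=> v; case: (split_v v) => [vF|[w w0 ->]].
- by rewrite par_graftl // (leq_trans (HF v)) ?leq_addr.
- case: (leqP w (size G)) => wG; first by rewrite par_graftr ?w0 // leq_add2l.
  by rewrite par_default // size_graft ltn_add2l.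
- exact: reachF.
case: (ltnP (size G) w) => wG; first by exists 1; rewrite /= par_default // size_graft ltn_add2l.
have [k kw] := NG w.
elim: k w w0 wG kw => [|k IH] w w0 wG; first by move=> /= E; rewrite E in w0.
rewrite iterSr; have := @par_graftr F G w; rewrite w0 => /(_ wG).
case: (posnP (par G w)) => [-> /= E _|p0 E].
  have [j Ej] := reachF _ (leqnn (size F)).
  by exists j.+1; rewrite iterSr E addn0.
by move=> /(IH _ p0 (HG w)) [j Ej]; exists j.+1; rewrite iterSr E.
Qed.

Lemma restr_iota F : forest F -> restr F (iota 1 (size F)) = F.
Proof.
move=> fF; apply: (@eq_from_nth _ 0); rewrite size_map size_iota // => i iF.
rewrite (nth_map 0) ?size_iota // nth_iota // /reindex_in mem_iota add1n.
have := forest_par_le i.+1 fF; rewrite -[nth 0 F i]/(par F i.+1).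
case: (par F i.+1) => // p pF; have -> : 0 < p.+1 < (size F).+1 by lia.
by rewrite -[p.+1](@nth_iota 0 1 (size F) p) // index_uniq ?size_iota ?iota_uniq // nth_iota.
Qed.

Lemma big_cuts (K : nmodType) F (h : seq nat -> seq nat -> K) : forest F ->
  (\sum_(c <- cuts F) h c.1 c.2 =
  \sum_(s <- splits (iota 1 (size F)) | uncut F s.1 s.2) h (restr F s.1) (restr F s.2))%R.
Proof. by move=> fF; rewrite -[in LHS](restr_iota fF) big_cuts_restr ?iota_uniq. Qed.

Lemma splits_full I : (I, [::]) \in splits I.
Proof. by elim: I => //= x I IH; rewrite mem_cat; apply/orP; left; apply/mapP; exists (I, [::]). Qed.

Lemma if_big (K : nmodType) I (r : seq I) b (P : pred I) (f : I -> K) :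
  ((if b then \sum_(i <- r | P i) f i else 0) =
   \sum_(i <- r) (if b && P i then f i else 0))%R.
Proof. by case: b => /=; [exact: big_mkcond | rewrite big1]. Qed.

Local Notation split2 := (seq nat * seq nat)%type.

(** * Cuts of the two products of forests *)

Section CutProducts.
Variables F G : seq nat.
Hypotheses (fF : forest F) (fG : forest G).
Let n := size F.
Let m := size G.

Let shift (s : seq nat) := map (addn n) s.

Let le_n (s : split2) v : s \in splits (iota 1 n) -> (v \in s.1) || (v \in s.2) -> 0 < v <= n.
Proof. by move=> sI; rewrite -(mem_splits sI) mem_iota add1n ltnS. Qed.

Let mem_shift v s : (n + v \in shift s) = (v \in s).
Proof. by rewrite mem_map // => x y /addnI. Qed.

Let mem_shift_le v s : v <= n -> 0 \notin s -> (v \in shift s) = false.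
Proof.
move=> vn s0; apply/negP => /mapP [x xs E]; move: s0; have -> : 0 = x by lia.
by rewrite xs.
Qed.

Let index_shift v s : index (n + v) (shift s) = index v s.
Proof. by rewrite index_map // => x y /addnI. Qed.

Let notin_le v (s : seq nat) : all (fun x => x <= n) s -> 0 < v -> (n + v \in s) = false.
Proof. by move=> /allP sn v0; apply/negP => /sn; lia. Qed.

Let reindex_l p A A' : p <= n -> 0 \notin A' -> reindex_in (A ++ shift A') p = reindex_in A p.
Proof.
move=> pn A0; rewrite /reindex_in mem_cat mem_shift_le // orbF index_cat.
by case: (p \in A).
Qed.

Let reindex_r p A A' : all (fun x => x <= n) A -> 0 < p -> reindex_in (A ++ shift A') (n + p) =
  if p \in A' then size A + reindex_in A' p else 0.
Proof.
move=> An p0; rewrite /reindex_in mem_cat notin_le // mem_shift index_cat notin_le //= index_shift.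
by case: (p \in A'); rewrite ?addnS.
Qed.

Lemma restr_dot A A' : all (fun x => x <= n) A -> 0 \notin A -> all (fun x => 0 < x) A' ->
  restr (dot F G) (A ++ shift A') = dot (restr F A) (restr G A').
Proof.
move=> An A0 A'0.
have A'z : 0 \notin A' by apply/negP => /(allP A'0).
rewrite /restr map_cat -map_comp /dot; congr (_ ++ _).
  apply/eq_in_map => v vA /=; rewrite par_dotl ?(allP An) // reindex_l //.
  exact: forest_par_le.
rewrite -map_comp; apply/eq_in_map => v vA /=; rewrite par_dotr ?(allP A'0) //.
case: (posnP (par G v)) => [->|p0].
  by rewrite reindex_l // /reindex_in (negbTE A0) (negbTE A'z).
by rewrite reindex_r // size_map /reindex_in; case: (par G v \in A').
Qed.

Let all1 (s : split2) : s \in splits (iota 1 n) -> all (fun x => x <= n) s.1.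
Proof. by move=> sI; apply/allP => v vs; have := @le_n s v sI; rewrite vs => /(_ isT) /andP []. Qed.
Let all2 (s : split2) : s \in splits (iota 1 n) -> all (fun x => x <= n) s.2.
Proof. by move=> sI; apply/allP => v vs; have := @le_n s v sI; rewrite vs orbT => /(_ isT) /andP []. Qed.
Let no1 k (s : split2) : s \in splits (iota 1 k) -> 0 \notin s.1.
Proof. by move=> sI; have := mem_splits sI 0; rewrite mem_iota /= => /esym/negbT; rewrite negb_or => /andP []. Qed.
Let no2 k (s : split2) : s \in splits (iota 1 k) -> 0 \notin s.2.
Proof. by move=> sI; have := mem_splits sI 0; rewrite mem_iota /= => /esym/negbT; rewrite negb_or => /andP []. Qed.
Let pos_notin (s : seq nat) : 0 \notin s -> all (fun x => 0 < x) s.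
Proof. by move=> s0; apply/allP => [[|x]] //; rewrite (negbTE s0). Qed.

Lemma iota_split : iota 1 (n + m) = iota 1 n ++ shift (iota 1 m).
Proof. by rewrite iotaD (addnC 1) iotaDl. Qed.

Let flagE (s t : split2) : 0 < m -> s \in splits (iota 1 n) -> (n + m \in s.1 ++ shift t.1) = (m \in t.1).
Proof. by move=> m0 sI; rewrite mem_cat mem_shift notin_le ?all1. Qed.

Lemma uncut_dot (s t : split2) : s \in splits (iota 1 n) -> t \in splits (iota 1 m) ->
  uncut (dot F G) (s.1 ++ shift t.1) (s.2 ++ shift t.2) = uncut F s.1 s.2 && uncut G t.1 t.2.
Proof.
move=> sI tI; rewrite /uncut all_cat all_map; congr (_ && _); apply: eq_in_all => v vs /=.
  rewrite par_dotl ?(allP (all1 sI)) // mem_cat mem_shift_le ?orbF ?(no2 tI) //.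
  exact: forest_par_le.
rewrite par_dotr ?(allP (pos_notin (no1 tI))) //.
case: (posnP (par G v)) => [->|p0].
  by rewrite mem_cat (negbTE (no2 sI)) mem_shift_le ?(no2 tI) // (negbTE (no2 tI)).
by rewrite mem_cat mem_shift notin_le ?all2.
Qed.


(** As [G] is nonempty, the last vertex of the product belongs to [G], which alone decides the side
    [b]; the cut of [F] is arbitrary. *)
Lemma big_cutb_dot (K : nmodType) b (f : seq nat -> seq nat -> K) : 0 < m ->
  (\sum_(c <- cutb b (dot F G)) f c.1 c.2 =
   \sum_(c <- cuts F) \sum_(d <- cutb b G) f (dot c.1 d.1) (dot c.2 d.2))%R.
Proof.
move=> m0; rewrite big_cutb size_dot iota_split big_mkcond.
rewrite (big_splits_cat _ _ (fun a c => if uncut (dot F G) a c && ((n + m \in a) == b) then f (restr (dot F G) a) (restr (dot F G) c) else 0%R)).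
rewrite (big_cuts (fun c1 c2 => \sum_(d <- cutb b G) f (dot c1 d.1) (dot c2 d.2))%R fF) [RHS]big_mkcond.
apply: eq_big_seq => s sI.
rewrite splits_map big_map /= (big_cutb _ _ (fun d1 d2 => f (dot (restr F s.1) d1) (dot (restr F s.2) d2))).
rewrite if_big.
apply: eq_big_seq => t tI.
rewrite uncut_dot // flagE // andbA.
by rewrite !restr_dot ?all1 ?all2 ?(no1 sI) ?(no2 sI) ?pos_notin ?(no1 tI) ?(no2 tI).
Qed.

(** The last vertex of [F], being kept, is the last letter of [A] and gets the label [size A], the
    place where [graft] attaches roots. By [uncut], a vertex of [A'] that is not a root of [G] keeps
    its parent. *)
Lemma restr_graft A A' B' : all (fun x => x <= n) A -> uniq A -> n \in A -> last 0 A = n ->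
  (A', B') \in splits (iota 1 m) -> uncut G A' B' ->
  restr (graft F G) (A ++ shift A') = graft (restr F A) (restr G A').
Proof.
move=> An uA nA lA tI /allP un.
have A'z := no1 tI; have A'0 := pos_notin A'z; rewrite /= in A'z A'0.
have A'm v : v \in A' -> v <= m.
  by move=> vA; have := mem_splits tI v; rewrite vA /= mem_iota add1n ltnS => /andP [].
rewrite /restr map_cat -map_comp /graft; congr (_ ++ _).
  apply/eq_in_map => v vA /=; rewrite par_graftl ?(allP An) // reindex_l //.
  exact: forest_par_le.
rewrite -map_comp; apply/eq_in_map => v vA /=.
rewrite par_graftr ?(allP A'0) ?A'm // size_map.
case: (posnP (par G v)) => [->|p0].
  rewrite addn0 reindex_l // /reindex_in nA (negbTE A'z) addn0.
  case: A An uA nA lA => // a A _ uA _; rewrite [last 0 _]/= => lA.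
  by rewrite -[X in index X _]lA index_last.
rewrite reindex_r //; have := un _ vA; have := mem_splits tI (par G v) => /=.
rewrite mem_iota add1n ltnS p0 (forest_par_le _ fG) /= => /esym.
by case: (par G v \in A') => //= ->.
Qed.

Lemma restr_graft_nil A : all (fun x => x <= n) A -> restr (graft F G) A = restr F A.
Proof.
move=> An; apply/eq_in_map => v vA /=; rewrite par_graftl //; exact: (allP An).
Qed.

(** The roots of [G] lose their common parent, and become roots. *)
Lemma restr_graft_dot A A' : all (fun x => x <= n) A -> 0 \notin A -> n \notin A ->
  all (fun x => 0 < x <= m) A' ->
  restr (graft F G) (A ++ shift A') = dot (restr F A) (restr G A').
Proof.
move=> An A0 nA A'm.
have A'z : 0 \notin A' by apply/negP => /(allP A'm).
rewrite /restr map_cat -map_comp /dot; congr (_ ++ _).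
  apply/eq_in_map => v vA /=; rewrite par_graftl ?(allP An) // reindex_l //.
  exact: forest_par_le.
rewrite -map_comp; apply/eq_in_map => v vA /=; rewrite par_graftr ?(allP A'm) //.
case: (posnP (par G v)) => [->|p0].
  by rewrite addn0 reindex_l // /reindex_in (negbTE nA) (negbTE A'z).
by rewrite reindex_r // size_map /reindex_in; case: (par G v \in A').
Qed.

Lemma forest_has_root (s : seq nat) : s != [::] -> {subset s <= iota 1 m} ->
  (forall v, v \in s -> par G v \in s \/ par G v = 0) -> exists2 v, v \in s & par G v = 0.
Proof.
case: s => // v s _ sm cl.
have [_ N] := forestP _ fG; have [k] := N v.
have: v \in v :: s by rewrite mem_head.
elim: k {1 3}v => [|k IH] w ws; first by move=> /= w0; move: (sm _ ws); rewrite w0 mem_iota.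
by rewrite iterSr; case: (cl _ ws) => [/IH|]; last by exists w.
Qed.

(** Suppose the last vertex of [F] is in the [Lea] part. A nonempty [t.1] would be stable under
    parents and, by [forest_has_root], contain a root of [G]; the parent of that root is the last
    vertex of [F], a contradiction. *)
Lemma uncut_graft (s t : split2) : s \in splits (iota 1 n) -> t \in splits (iota 1 m) ->
  0 < n ->
  uncut (graft F G) (s.1 ++ shift t.1) (s.2 ++ shift t.2) =
  uncut F s.1 s.2 && (if n \in s.1 then uncut G t.1 t.2 else t.1 == [::]).
Proof.
move=> sI tI n0; rewrite /uncut all_cat; congr (_ && _).
  apply: eq_in_all => v vs /=.
  rewrite par_graftl ?(allP (all1 sI)) // mem_cat mem_shift_le ?orbF ?(no2 tI) //.
  exact: forest_par_le.
have t1m v : v \in t.1 -> 0 < v <= size G.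
  by move=> vt; have := mem_splits tI v; rewrite vt mem_iota add1n ltnS.
have ds x : x \in s.1 -> x \in s.2 -> False.
  move=> x1 x2; have := iota_uniq 1 n; rewrite -(perm_uniq (perm_splits sI)) cat_uniq.
  by case/and3P => _ /hasPn /(_ _ x2) /negP.
case: ifP => ns.
  rewrite all_map; apply: eq_in_all => v vs /=.
  rewrite par_graftr ?t1m //.
  case: (posnP (par G v)) => [->|p0].
    rewrite addn0 mem_cat mem_shift_le ?(no2 tI) // orbF.
    by apply/negP => /(ds _ ns).
  by rewrite mem_cat mem_shift notin_le ?all2.
have ns2 : n \in s.2.
  have: n \in iota 1 n by rewrite mem_iota; lia.
  by rewrite (mem_splits sI) ns.
case: (altP (t.1 =P [::])) => [-> //|tn].
apply/negbTE/negP => /allP H.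
have {}H v : v \in t.1 -> par G v \in t.1 /\ par G v <> 0.
  move=> vt; have := H (n + v); rewrite mem_shift => /(_ vt).
  rewrite par_graftr ?t1m // mem_cat negb_or.
  case: (posnP (par G v)) => [->|p0]; first by rewrite addn0 ns2.
  rewrite mem_shift => /andP [_ p2]; split; last lia.
  have := mem_splits tI (par G v); rewrite mem_iota p0 add1n ltnS (forest_par_le _ fG).
  by rewrite (negbTE p2) orbF.
have [||v vt E] := @forest_has_root t.1 tn.
- exact/mem_subseq/subseq_splits1.
- by move=> v /H [pv _]; left.
by have [_] := H _ vt.
Qed.

Lemma big_cutt_graft (K : nmodType) (f : seq nat -> seq nat -> K) : 0 < n -> 0 < m ->
  (\sum_(c <- cutb true (graft F G)) f c.1 c.2 =
   \sum_(c <- cutb true F) \sum_(d <- cutb true G) f (graft c.1 d.1) (dot c.2 d.2))%R.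
Proof.
move=> n0 m0; rewrite big_cutb size_graft iota_split big_mkcond.
rewrite (big_splits_cat _ _ (fun a c => if uncut (graft F G) a c && ((n + m \in a) == true) then f (restr (graft F G) a) (restr (graft F G) c) else 0%R)).
rewrite (big_cutb _ _ (fun c1 c2 => \sum_(d <- cutb true G) f (graft c1 d.1) (dot c2 d.2))%R) [RHS]big_mkcond.
apply: eq_big_seq => s sI.
rewrite splits_map big_map /= (big_cutb _ _ (fun d1 d2 => f (graft (restr F s.1) d1) (dot (restr F s.2) d2))).
rewrite if_big.
apply: eq_big_seq => t tI.
rewrite uncut_graft // flagE // !eqb_id -/n -/m.
case ns : (n \in s.1); last first.
  by rewrite andbF /=; case: (t.1 =P [::]) => [->|]; rewrite ?andbF.
rewrite andbT.
case: (uncut F _ _) => //=; case ut: (uncut G _ _) => //=; case: ifP => // mt.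
have [u1 u2] := splits_uniq (iota_uniq 1 n) sI.
rewrite (@restr_graft _ _ t.2) ?all1 ?(splits_last_in sI) -?surjective_pairing //.
rewrite restr_graft_dot ?all2 ?(no2 sI) //.
  apply/negP => ns2; have := iota_uniq 1 n; rewrite -(perm_uniq (perm_splits sI)) cat_uniq.
  by case/and3P => _ /hasPn /(_ _ ns2) /negP.
by apply/allP => v vt; have := mem_splits tI v; rewrite vt orbT mem_iota add1n ltnS.
Qed.

(** Two cases for the last vertex of [F]: in the [Roo] part, where [G] is cut with its own last
    vertex below; or in the [Lea] part, where all of [G] follows it and stays grafted. *)
Lemma big_cutf_graft (K : nmodType) (f : seq nat -> seq nat -> K) : 0 < n -> 0 < m ->
  (\sum_(c <- cutb false (graft F G)) f c.1 c.2 =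
   \sum_(c <- cutb true F) \sum_(d <- cutb false G) f (graft c.1 d.1) (dot c.2 d.2) +
   \sum_(c <- cutb false F) f c.1 (graft c.2 G))%R.
Proof.
move=> n0 m0; rewrite big_cutb size_graft iota_split big_mkcond.
rewrite (big_splits_cat _ _ (fun a c => if uncut (graft F G) a c && ((n + m \in a) == false) then f (restr (graft F G) a) (restr (graft F G) c) else 0%R)).
rewrite (big_cutb _ _ (fun c1 c2 => \sum_(d <- cutb false G) f (graft c1 d.1) (dot c2 d.2))%R) [X in _ = (X + _)%R]big_mkcond.
rewrite (big_cutb _ _ (fun c1 c2 => f c1 (graft c2 G))) [X in _ = (_ + X)%R]big_mkcond -big_split /=.
apply: eq_big_seq => s sI.
rewrite splits_map big_map /= (big_cutb _ _ (fun d1 d2 => f (graft (restr F s.1) d1) (dot (restr F s.2) d2))).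
rewrite -/n -/m.
have [u1 u2] := splits_uniq (iota_uniq 1 n) sI.
case ns : (n \in s.1); rewrite ?andbT ?andbF ?addr0 /=; last first.
  have ns2 : n \in s.2.
    have: n \in iota 1 n by rewrite mem_iota; lia.
    by rewrite (mem_splits sI) ns.
  rewrite add0r; transitivity ((\sum_(t <- splits (iota 1 m) | t.1 == [::])
    (if uncut F s.1 s.2 then f (restr F s.1) (graft (restr F s.2) (restr G t.2)) else 0))%R).
    rewrite [RHS]big_mkcond; apply: eq_big_seq => t tI.
    rewrite uncut_graft // flagE // ns; case: (t.1 =P [::]) => [t1|]; last by rewrite andbF.
    rewrite t1 /= cats0 !andbT; case: ifP => // _.
    have t2 : t.2 = iota 1 m.
      apply/eqP; rewrite -(size_subseq_leqif (subseq_splits2 tI)).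
      by rewrite -(size_splits tI) t1.
    rewrite restr_graft_nil ?all1 // (@restr_graft _ _ [::]) ?all2 ?(splits_last_notin sI) ?ns //.
      by rewrite t2 splits_full.
    by apply/allP => v _; rewrite in_nil.
  rewrite (big_splits_nil1 _ (fun a c => if uncut F s.1 s.2 then f (restr F s.1) (graft (restr F s.2) (restr G c)) else 0%R)).
  by rewrite restr_iota.
rewrite if_big.
apply: eq_big_seq => t tI.
rewrite uncut_graft // flagE // ns.
case: (uncut F _ _) => //=; case ut: (uncut G _ _) => //=; case: ifP => // mt.
rewrite (@restr_graft _ _ t.2) ?all1 ?(splits_last_in sI) -?surjective_pairing //.
rewrite restr_graft_dot ?all2 ?(no2 sI) //.
  apply/negP => ns2; have := iota_uniq 1 n; rewrite -(perm_uniq (perm_splits sI)) cat_uniq.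
  by case/and3P => _ /hasPn /(_ _ ns2) /negP.
by apply/allP => v vt; have := mem_splits tI v; rewrite vt orbT mem_iota add1n ltnS.
Qed.
End CutProducts.

(** * Parkization *)

Definition cle (w : seq nat) y := count (fun x => x <= y) w.

(* Letter [x] of [w] is sent by parkization to min_{0 <= y < x} (cle w y + (x - y)). *)
Fixpoint pk (w : seq nat) x := if x is x'.+1 then (minn (pk w x') (cle w x')).+1 else 0.

Lemma cle_mono w y z : y <= z -> cle w y <= cle w z.
Proof. by move=> yz; apply: sub_count => x /=; lia. Qed.

Lemma cle0 w : is_word w -> cle w 0 = 0.
Proof.
move=> /allP ww; apply/eqP; rewrite eqn0Ngt -has_count; apply/hasPn => x /ww.
by rewrite -ltnNge.
Qed.

Lemma pk_leS w x : pk w x <= pk w x.+1.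
Proof.
case: x => //= x; rewrite ltnS leq_min leqnSn /=.
by have := cle_mono w (leqnSn x); lia.
Qed.

Lemma pk_mono w x y : x <= y -> pk w x <= pk w y.
Proof. by apply: (homo_leq leqnn leq_trans); apply: pk_leS. Qed.

(** An occurrence of [x] gives [cle w x > cle w x.-1], so the new candidate for the minimum is not
    smaller than the old one. Hence parkization is strictly increasing on the letters of [w]. *)
Lemma pk_letter w x : x \in w -> 0 < x -> pk w x.+1 = (pk w x).+1.
Proof.
case: x => // x xw _ /=; congr _.+1; apply/minn_idPl.
have cS : cle w x.+1 = cle w x + count_mem x.+1 w.
  by rewrite /cle; elim: (w) => //= z u ->; case: eqP => [->|]; lia.
have: 0 < count_mem x.+1 w by rewrite -has_count has_pred1.
lia.
Qed.

Lemma pk_leq w x y : is_word w -> x \in w -> y \in w -> (pk w x <= pk w y) = (x <= y).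
Proof.
move=> /allP ww xw yw; case: (leqP x y) => xy; first exact: pk_mono.
by apply/negbTE; rewrite -ltnNge -(pk_letter yw) ?ww // pk_mono.
Qed.

Lemma pk_ge w c x : c <= x -> (forall y, y < x -> c <= cle w y + (x - y)) -> c <= pk w x.
Proof.
elim: x c => [|x IH] [|c] // cx H.
rewrite /= ltnS leq_min; apply/andP; split.
  by apply: IH => // y yx; have := H y; lia.
by have := H x; lia.
Qed.

Definition dec d x := if d < x then x.-1 else x.

Section Dec.
Variables (w : seq nat) (d : nat).
Hypotheses (d0 : 0 < d) (dw : d \notin w) (dle : cle w d <= pk w d.-1).

Let cle_dec y : cle (map (dec d) w) y = if y < d then cle w y else cle w y.+1.
Proof.
rewrite /cle count_map; case: ltnP => yd; apply: eq_in_count => x xw /=;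
  have : x <> d by [move=> E; move: dw; rewrite -E xw]; rewrite /dec; case: ltnP; lia.
Qed.

Let pk_dec1 y : y <= d -> pk (map (dec d) w) y = pk w y.
Proof. by elim: y => //= y IH yd; rewrite IH ?cle_dec ?yd // ltnW. Qed.

Let cle_d : cle w d = cle w d.-1.
Proof.
apply: eq_in_count => x xw /=.
by have : x <> d by [move=> E; move: dw; rewrite -E xw]; lia.
Qed.

Let pk_dec2 y : d <= y -> pk (map (dec d) w) y = pk w y.+1.
Proof.
move=> dy; rewrite -(subnK dy); elim: (y - d) => [|k IH].
  rewrite add0n pk_dec1 //= -[in RHS](prednK d0) -[in LHS](prednK d0) /= (prednK d0); lia.
by rewrite addSn /= IH cle_dec ltnNge leq_addl /=.
Qed.

(** Since [d] is missing and [cle w d <= pk w d.-1], both [pk w d] and [pk w d.+1] equal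
    [(cle w d).+1]: deleting the value [d] from the alphabet leaves the images of the letters
    unchanged. *)
Lemma pk_dec x : x \in w -> pk (map (dec d) w) (dec d x) = pk w x.
Proof.
move=> xw; rewrite /dec; case: ltnP => dx; last exact: pk_dec1.
by case: x dx {xw} => // x dx; rewrite pk_dec2.
Qed.

Lemma map_pk_dec : map (pk (map (dec d) w)) (map (dec d) w) = map (pk w) w.
Proof. by rewrite -map_comp; apply/eq_in_map => x xw /=; rewrite pk_dec. Qed.
End Dec.

Definition parkcond (w : seq nat) := all (fun i => i <= cle w i) (iota 1 (size w)).

Lemma parkcondP w : reflect (forall y, y <= size w -> y <= cle w y) (parkcond w).
Proof.
apply: (iffP allP) => H; last by move=> y; rewrite mem_iota add1n ltnS => /andP [_ /H].
by case=> // y yw; apply: H; rewrite mem_iota.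
Qed.

Lemma is_parkingE w : is_parking w = is_word w && parkcond w.
Proof.
rewrite /is_parking; congr (_ && _).
set s := sort leq w.
have ss : sorted leq s by apply: sort_sorted; exact: leq_total.
have sz : size s = size w by rewrite size_sort.
have cs y : cle w y = cle s y by apply/permP; rewrite perm_sym perm_sort.
clearbody s; apply/allP/allP => H i; rewrite mem_iota; last first.
  rewrite add0n leq0n /= => iw; rewrite leqNgt; apply/negP => gt.
  have /H : i.+1 \in iota 1 (size w) by rewrite mem_iota; lia.
  rewrite cs -[in X in _ <= X](cat_take_drop i s) /cle count_cat.
  have -> : count (fun x => x <= i.+1) (drop i s) = 0.
    apply/eqP; rewrite eqn0Ngt -has_count; apply/hasPn => x.
    move=> /(nthP 0) [j]; rewrite size_drop sz => ji <-; rewrite nth_drop -ltnNge.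
    apply: leq_trans gt _; apply: (sorted_leq_nth leq_trans leqnn) => //; rewrite ?inE ?sz; lia.
  rewrite addn0; have := count_size (fun x => x <= i.+1) (take i s).
  by rewrite size_take_min sz; lia.
rewrite add1n ltnS => /andP [i0 iw].
rewrite cs -[in X in _ <= X](cat_take_drop i s) /cle count_cat.
have /eqP -> : count (fun x => x <= i) (take i s) == size (take i s).
  rewrite -all_count; apply/allP => x /(nthP 0) [j]; rewrite size_take_min sz => ji <-.
  rewrite nth_take; last lia.
  have := H i.-1; rewrite mem_iota add0n leq0n /= prednK // => /(_ iw) le.
  by apply: leq_trans le; apply: (sorted_leq_nth leq_trans leqnn) => //; rewrite ?inE ?sz; lia.
by rewrite size_take_min sz; lia.
Qed.

Lemma parking_word w : is_parking w -> is_word w.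
Proof. by rewrite is_parkingE => /andP []. Qed.

Lemma parking_cle w y : is_parking w -> y <= size w -> y <= cle w y.
Proof. by rewrite is_parkingE => /andP [_ /parkcondP]; apply. Qed.

Lemma parking_le w : is_parking w -> all (fun x => x <= size w) w.
Proof.
move=> pw; rewrite all_count eqn_leq count_size /=; exact: parking_cle.
Qed.

Lemma pk_parking w x : is_parking w -> x <= (size w).+1 -> pk w x = x.
Proof.
move=> pw; elim: x => //= x IH xw; rewrite IH; last exact: ltnW.
by congr _.+1; apply/minn_idPl/parking_cle.
Qed.

Lemma map_pk_parking w : is_parking w -> map (pk w) w = w.
Proof.
move=> pw; rewrite -[RHS]map_id; apply/eq_in_map => x /(allP (parking_le pw)) xw.
by rewrite pk_parking // leqW.
Qed.

Variant dpark_spec w : nat -> Prop :=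
  | DparkEnd of parkcond w : dpark_spec w (size w).+1
  | DparkDec d of 0 < d & d <= size w & cle w d < d & (forall i, i < d -> i <= cle w i) :
      dpark_spec w d.

Lemma dparkP w : dpark_spec w (dpark w).
Proof.
rewrite /dpark; set P := fun i => _.
case hP : (has P (iota 1 (size w))); last first.
  rewrite (hasNfind (negbT hP)) size_iota; constructor.
  apply/allP => i iw; rewrite leqNgt; apply/negP => lt.
  by move/hasP: hP; apply; exists i.
have := nth_find 0 hP; have := hP; rewrite has_find size_iota => lt.
rewrite nth_iota // add1n => Pd; constructor => // i; case: i => // i iP.
have := before_find 0 (iP : i < find P _); rewrite nth_iota; last exact: leq_trans (ltnW iP) lt.
by rewrite /P add1n -/(cle w i.+1); lia.
Qed.

Lemma decr_word w : is_word w -> is_word (decr w).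
Proof.
move=> /allP ww; apply/allP => _ /mapP [x /ww x0 ->].
by case: (dparkP w) => [_|d d0 _ _ _]; case: (ltnP _ x) => // lt; lia.
Qed.

Lemma sumn_dec d w : has (fun x => d < x) w -> sumn (map (dec d) w) < sumn w.
Proof.
have le u : sumn (map (dec d) u) <= sumn u.
  by elim: u => //= x u IH; rewrite leq_add // /dec; case: (ltnP d x); lia.
elim: w => //= x w IH; have lew := le w; rewrite {1}/dec; case: (ltnP d x) => /= dx; first lia.
by move/IH; lia.
Qed.

Lemma cle_diff (m : bitseq) w y z : y <= z ->
  cle (mask m w) z + cle w y <= cle w z + cle (mask m w) y.
Proof.
move=> yz; rewrite /cle; elim: w m => [|x w IH] [|b m] //=.
  by have := cle_mono w yz; rewrite /cle; lia.
by have := IH m; case: b => /=; lia.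
Qed.

Section MaskDecr.
Variables (w : seq nat) (m : bitseq).
Hypotheses (ww : is_word w) (dw : dpark w <= size w).

(** A parkization step of [w] is harmless to every subword, although the subword may call for
    another step itself. With [d = dpark w], exactly [d.-1] letters of [w] are at most [d], and at
    least [y] are at most [y] when [y < d]; so at most [d.-1 - y] letters lie between, a bound which
    subwords inherit and which is the hypothesis of [pk_dec]. *)
Lemma map_pk_mask_decr :
  map (pk (mask m (decr w))) (mask m (decr w)) = map (pk (mask m w)) (mask m w).
Proof.
have -> : mask m (decr w) = map (dec (dpark w)) (mask m w) by rewrite map_mask.
move: dw; case: dparkP => [_|d d0 _ dlt dmin _]; first by rewrite ltnn.
have cd : cle w d = d.-1.
  by have := cle_mono w (leq_pred d); have := dmin d.-1; lia.
have mw : is_word (mask m w).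
  by apply/allP => x /mem_mask xw; apply: (allP ww).
apply: map_pk_dec => //.
  apply/negP => /mem_mask dw'.
  have: cle w d.-1 < cle w d.
    rewrite /cle; elim: (w) dw' => //= x u IH; rewrite inE => /orP [/eqP <-|/IH].
      have := @sub_count _ (fun x => x <= d.-1) (fun x => x <= d) _ u.
      by move=> H; have := H (fun x => _); move: H => _ H; have {}H := H ltac:(move=> /=; lia); lia.
    lia.
  by rewrite cd; have := dmin d.-1; lia.
apply: pk_ge => [|y yd].
  have := @cle_diff m w 0 d isT; rewrite !cle0 //; lia.
have := @cle_diff m w y d; have := dmin y; lia.
Qed.
End MaskDecr.

(** The last clause treats all subwords at once, so that it passes through the iteration; it yields
    [park_mask]. *)
Lemma park_iterP k w : is_word w -> sumn w <= k ->
  [/\ is_parking (park_iter k w), park_iter k w = map (pk w) w &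
    forall m, map (pk (mask m (park_iter k w))) (mask m (park_iter k w)) = map (pk (mask m w)) (mask m w)].
Proof.
elim: k w => [|k IH] w ww sw.
  have -> : w = [::].
    case: w ww sw => // x w /= /andP [x0 _]; lia.
  by split=> // m; rewrite mask0.
rewrite /=; case: eqP => [e|ne].
  have piw : is_parking w.
    by rewrite is_parkingE ww; move: e; case: dparkP => // d _ dw _ _ e; rewrite e ltnn in dw.
  by split=> //; rewrite map_pk_parking.
have dw : dpark w <= size w by move: ne; case: dparkP.
have sd : sumn (decr w) < sumn w.
  apply: sumn_dec; move: dw; case: dparkP => [|d d0 _ dlt _ dw]; first by rewrite ltnn.
  rewrite has_count; have := count_predC (fun x => x <= d) w.
  rewrite -/(cle w d) (@eq_count _ (predC _) (fun x => d < x)); last by move=> x /=; rewrite ltnNge.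
  lia.
have [|p1 p2 p3] := IH (decr w) (decr_word ww); first lia.
split=> // [|m]; last by rewrite p3 map_pk_mask_decr.
by have := map_pk_mask_decr (nseq (size w) true) ww dw; rewrite p2 !mask_true ?size_map.
Qed.

Lemma parkE w : is_word w -> park w = map (pk w) w.
Proof. by move=> ww; have [] := park_iterP ww (leqnn _). Qed.

Lemma park_parking w : is_word w -> is_parking (park w).
Proof. by move=> ww; have [] := park_iterP ww (leqnn _). Qed.

Lemma park_id w : is_parking w -> park w = w.
Proof. by move=> pw; rewrite parkE ?map_pk_parking ?parking_word. Qed.

Lemma size_park w : is_word w -> size (park w) = size w.
Proof. by move=> ww; rewrite parkE // size_map. Qed.

Lemma mask_word m w : is_word w -> is_word (mask m w).
Proof. by move=> /allP ww; apply/allP => x /mem_mask /ww. Qed.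

(** Applied to prefixes and suffixes, this lets a product of parkization-invariant functions under
    concatenation be parkization-invariant again. *)
Lemma park_mask m w : is_word w -> park (mask m (park w)) = park (mask m w).
Proof.
move=> ww; have [p1 _ p3] := park_iterP ww (leqnn _).
by rewrite (parkE (mask_word m ww)) (parkE (mask_word m (parking_word p1))) -p3.
Qed.

Lemma take_mask i (w : seq nat) : take i w = mask (nseq i true) w.
Proof. by elim: i w => [|i IH] [|x w] //=; rewrite ?take0 ?IH. Qed.

Lemma drop_mask i (w : seq nat) : drop i w = mask (nseq i false ++ nseq (size w - i) true) w.
Proof.
elim: i w => [|i IH] w; first by rewrite drop0 subn0 mask_true.
by case: w => [|x w] /=; rewrite ?IH ?subSS ?mask0.
Qed.

Lemma park_take i w : is_word w -> park (take i (park w)) = park (take i w).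
Proof. by move=> ww; rewrite !take_mask park_mask. Qed.

Lemma park_drop i w : is_word w -> park (drop i (park w)) = park (drop i w).
Proof. by move=> ww; rewrite !drop_mask size_park // park_mask. Qed.

Lemma park_leq w i j : is_word w -> i < size w -> j < size w ->
  (nth 0 (park w) i <= nth 0 (park w) j) = (nth 0 w i <= nth 0 w j).
Proof. by move=> ww iw jw; rewrite parkE // !(nth_map 0) // pk_leq ?mem_nth. Qed.

(** * Shuffles of words and their parkization *)

Fixpoint mix (s : bitseq) (u v : seq nat) : seq nat :=
  if s is b :: s' then
    if b then head 0 u :: mix s' (behead u) v else head 0 v :: mix s' u (behead v)
  else [::].

Definition mixable (s : bitseq) (u v : seq nat) :=
  (count id s == size u) && (count negb s == size v).

Lemma mixable_size s u v : mixable s u v -> size s = size u + size v.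
Proof. by case/andP => /eqP <- /eqP <-; rewrite -(count_predC id s). Qed.

Lemma size_mix s u v : size (mix s u v) = size s.
Proof. by elim: s u v => //= -[] s IH u v /=; rewrite IH. Qed.

Lemma mixable_cons b s u v : mixable (b :: s) u v ->
  if b then exists x u', u = x :: u' /\ mixable s u' v else exists y v', v = y :: v' /\ mixable s u v'.
Proof.
by case: b; rewrite /mixable /= ?add0n ?add1n;
  [case: u => // x u; exists x, u | case: v => [|y v]; rewrite ?andbF // => H; exists y, v].
Qed.

Lemma perm_mix s u v : mixable s u v -> perm_eq (mix s u v) (u ++ v).
Proof.
elim: s u v => [|b s IH] u v; first by rewrite /mixable => /andP [/eqP/esym/size0nil -> /eqP/esym/size0nil ->].
case: b => /mixable_cons [x [u' [-> H]]] /=; first by rewrite perm_cons IH.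
by rewrite -[x :: u']cat1s perm_sym perm_catCA /= perm_cons perm_sym IH.
Qed.

Lemma map_mix h s u v : mixable s u v -> map h (mix s u v) = mix s (map h u) (map h v).
Proof.
elim: s u v => //= b s IH u v.
by case: b => /mixable_cons [x [u' [-> H]]] /=; rewrite IH.
Qed.

Lemma mix_cat s1 s2 u v :
  mix (s1 ++ s2) u v = mix s1 (take (count id s1) u) (take (count negb s1) v) ++
                       mix s2 (drop (count id s1) u) (drop (count negb s1) v).
Proof.
elim: s1 u v => [|b s1 IH] u v /=; first by rewrite !drop0.
case: b => /=; rewrite add1n add0n IH.
  by case: u => [|x u] /=; rewrite ?take0.
by case: v => [|x v] /=; rewrite ?take0.
Qed.

Lemma cle_cat u v y : cle (u ++ v) y = cle u y + cle v y.
Proof. exact: count_cat. Qed.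

Section ParkMix.
Variables (s : bitseq) (u v : seq nat) (N : nat).
Hypotheses (uw : is_word u) (vw : is_word v) (suv : mixable s u v).
Hypotheses (uN : all (fun x => x <= N) u)
  (gap : forall y, y <= N -> size u <= cle u y + (N - y)).

Let w := mix s u (map (addn N) v).

Let msw : mixable s u (map (addn N) v).
Proof. by rewrite /mixable size_map. Qed.

Lemma mix_word : is_word w.
Proof.
rewrite /is_word (perm_all _ (perm_mix msw)) all_cat all_map.
apply/andP; split; first exact: uw.
by apply: sub_all vw => x /=; lia.
Qed.

Let cle_w y : cle w y = cle u y + cle (map (addn N) v) y.
Proof. by rewrite -cle_cat; apply/permP/perm_mix. Qed.

Let cle_low y : y <= N -> cle w y = cle u y.
Proof.
move=> yN; rewrite cle_w -[RHS]addn0; congr (_ + _); rewrite /cle count_map.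
apply/eqP; rewrite eqn0Ngt -has_count; apply/hasPn => x /(allP vw) /=; lia.
Qed.

Let cle_high y : cle w (N + y) = size u + cle v y.
Proof.
rewrite cle_w; congr (_ + _); last by rewrite /cle count_map; apply: eq_count => x /=; rewrite leq_add2l.
by apply/eqP; rewrite /cle -all_count; apply: sub_all uN => x; lia.
Qed.

Let pk_low x : x <= N.+1 -> pk w x = pk u x.
Proof. by elim: x => //= x IH xN; rewrite IH ?cle_low // ltnW. Qed.

Let pk_high x : 0 < x -> pk w (N + x) = size u + pk v x.
Proof.
case: x => // x _; elim: x => [|x IH].
  rewrite addn1 /= pk_low // cle_low // cle0 // min0n addn1; congr _.+1.
  have -> : cle u N = size u by apply/eqP; rewrite /cle -all_count.
  apply/minn_idPr/pk_ge => [|y yN]; last by apply: gap; apply: ltnW.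
  by have := gap (leq0n N); rewrite cle0; lia.
rewrite addnS [LHS]/= IH cle_high -addn_minr -addnS.
by [].
Qed.

(** Up to [N] the shuffle has the counting function of [u]. The gap hypothesis makes [pk] reach
    [(size u).+1] exactly at [N.+1], and from there on it continues as that of [v]. The shift [N]
    disappears from the result. *)
Lemma park_mix : park w = mix s (park u) (map (addn (size u)) (park v)).
Proof.
rewrite !parkE ?mix_word // {2}/w map_mix //; congr mix.
  by apply/eq_in_map => x xu; rewrite pk_low // (leq_trans (allP uN x xu)).
by rewrite -!map_comp; apply/eq_in_map => x /(allP vw) x0 /=; rewrite pk_high.
Qed.
End ParkMix.

(** * Cuts of parking functions *)

Fixpoint masks n : seq bitseq :=
  if n is m.+1 then [seq true :: s | s <- masks m] ++ [seq false :: s | s <- masks m]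
  else [:: [::]].

Lemma mem_masks n s : (s \in masks n) = (size s == n).
Proof.
elim: n s => [|n IH] s /=; first by rewrite inE size_eq0.
rewrite mem_cat; case: s => [|b s].
  by apply/negbTE; rewrite negb_or; apply/andP; split; apply/mapP => -[].
rewrite /= eqSS -IH; have inj c : injective (cons c : bitseq -> bitseq) by move=> x y [].
have no c d : c != d -> (c :: s \in [seq d :: t | t <- masks n]) = false.
  by move=> cd; apply/negP => /mapP [t _ [E]]; rewrite E eqxx in cd.
by case: b; rewrite (mem_map (inj _)) no ?orbF.
Qed.

Lemma uniq_masks n : uniq (masks n).
Proof.
elim: n => //= n IH; have inj c : injective (cons c : bitseq -> bitseq) by move=> x y [].
rewrite cat_uniq !(map_inj_uniq (inj _)) IH andbT /=.
by apply/hasPn => _ /mapP [s _ ->]; apply/mapP => -[].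
Qed.

Lemma big_masks_add (K : nmodType) n m (f : bitseq -> K) :
  (\sum_(s <- masks (n + m)) f s = \sum_(s <- masks n) \sum_(t <- masks m) f (s ++ t))%R.
Proof.
elim: n f => [|n IH] f; first by rewrite /= big_seq1.
by rewrite addSn /= !big_cat !big_map /= (IH (fun s => f (true :: s))) (IH (fun s => f (false :: s))).
Qed.

(** A finite list large enough for both codes: parents lie in [0..n] and letters of parking
    functions in [1..n]. *)
Definition words n : seq (seq nat) := [seq map val (val t) | t : n.-tuple 'I_n.+1].

Lemma mem_words n w : (w \in words n) = (size w == n) && all (fun x => x <= n) w.
Proof.
apply/imageP/andP => [[t _ ->]|[/eqP sw wn]].
  by rewrite size_map size_tuple; split=> //; apply/allP => _ /mapP [i _ ->]; rewrite -ltnS; exact: ltn_ord.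
have st : size [seq (inord x : 'I_n.+1) | x <- w] == n by rewrite size_map sw.
exists (Tuple st) => //=; rewrite -map_comp -[LHS]map_id; apply/eq_in_map => x /(allP wn) xn /=.
by rewrite inordK.
Qed.

Lemma uniq_words n : uniq (words n).
Proof.
by rewrite map_inj_uniq ?enum_uniq // => s t /(inj_map val_inj) /val_inj.
Qed.

Definition forests n := filter forest (words n).
Definition parkings n := filter is_parking (words n).

Lemma mem_forests n F : (F \in forests n) = forest F && (size F == n).
Proof.
rewrite mem_filter mem_words; case fF: (forest F) => //=.
by case: eqP => // <-; move: fF => /andP [].
Qed.

Lemma mem_parkings n w : (w \in parkings n) = is_parking w && (size w == n).
Proof.
rewrite mem_filter mem_words; case pw: (is_parking w) => //=.
by case: eqP => // <-; exact: parking_le.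
Qed.

Lemma uniq_forests n : uniq (forests n). Proof. exact/filter_uniq/uniq_words. Qed.
Lemma uniq_parkings n : uniq (parkings n). Proof. exact/filter_uniq/uniq_words. Qed.

Definition low k (a : seq nat) := [seq x <- a | x <= k].
Definition high k (a : seq nat) := [seq x - k | x <- a & k < x].

(* The coproduct of the dual basis of parking functions: [a] is cut at the values
   [k] such that exactly [k] letters are at most [k]. *)
Definition zcut (p : pred nat) a :=
  [seq (low k a, high k a) | k <- iota 0 (size a).+1 & (cle a k == k) && p k].
(** The default value 1 of [last] puts the only cut of the empty word on the side [false], as [cutb]
    does for the empty forest. *)
Definition zcutb b a := zcut (fun k => (last 1 a <= k) == b) a.
Definition zcuts a := zcutb true a ++ zcutb false a.

Lemma size_low k a : size (low k a) = cle a k.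
Proof. by rewrite size_filter. Qed.

Lemma size_high k a : cle a k + size (high k a) = size a.
Proof.
rewrite size_map size_filter -(count_predC (fun x => x <= k) a); congr (_ + _).
by apply: eq_count => x /=; rewrite ltnNge.
Qed.

Lemma cle_low j k a : j <= k -> cle (low k a) j = cle a j.
Proof.
by move=> jk; rewrite /cle count_filter; apply: eq_count => x /=; lia.
Qed.

Lemma cle_high j k a : cle (high k a) j + cle a k = cle a (k + j).
Proof.
rewrite /cle count_map count_filter; elim: a => //= x a IH; lia.
Qed.

Lemma low_low j k a : j <= k -> low j (low k a) = low j a.
Proof. by move=> jk; rewrite /low -filter_predI; apply: eq_filter => x /=; lia. Qed.

Lemma high_low j k a : j <= k -> high j (low k a) = low (k - j) (high j a).
Proof.
move=> jk; rewrite /high /low filter_map -!filter_predI; congr map.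
by apply: eq_filter => x /=; lia.
Qed.

Lemma high_high j k a : high k (high j a) = high (j + k) a.
Proof.
rewrite /high filter_map -filter_predI -map_comp.
rewrite (@eq_filter _ _ (fun x => j + k < x)); last by move=> x /=; lia.
by apply: eq_map => x /=; lia.
Qed.

Lemma mem_iota0 j n : (j \in iota 0 n.+1) = (j <= n).
Proof. by rewrite mem_iota add0n ltnS. Qed.

Lemma big_triangle (K : nmodType) n (g : nat -> nat -> K) :
  (\sum_(k <- iota 0 n.+1) \sum_(j <- iota 0 k.+1) g j k =
   \sum_(j <- iota 0 n.+1) \sum_(i <- iota 0 (n - j).+1) g j (j + i)%N)%R.
Proof.
elim: n => [|n IH]; first by rewrite /= !big_seq1.
have S m : iota 0 m.+1 = iota 0 m ++ [:: m] by rewrite -addn1 iotaD.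
rewrite (S n.+1) !big_cat !big_seq1 IH (S n.+1) big_cat subnn [iota 0 1]/= !big_seq1 addn0.
rewrite [LHS]addrA; congr (_ + _)%R; rewrite -big_split; apply: eq_big_seq => j.
rewrite mem_iota0 => jn; by rewrite subSn // (S (n - j).+1) big_cat big_seq1 addnS subnKC.
Qed.

Lemma last_low k a : last 1 a <= k -> last 1 (low k a) = last 1 a.
Proof.
by case/lastP: a => // a x; rewrite /low filter_rcons last_rcons => ->; rewrite last_rcons.
Qed.

Lemma last_high k a : k <= size a -> k < last 1 a -> last 1 (high k a) = last 1 a - k.
Proof.
case/lastP: a => [|a x]; first by rewrite leqn0 => /eqP ->.
by rewrite /high filter_rcons last_rcons => _ ->; rewrite map_rcons last_rcons.
Qed.

(** * Coassociativity of the split coproduct of parking functions *)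

Section ZCoassoc.
Variables (K : nmodType) (a : seq nat).
Implicit Type f : seq nat -> seq nat -> seq nat -> K.
Local Open Scope ring_scope.
Let n := size a.

Lemma big_zcut p b (h : seq nat -> seq nat -> K) :
  \sum_(c <- zcut p b) h c.1 c.2 =
  \sum_(k <- iota 0 (size b).+1 | (cle b k == k) && p k) h (low k b) (high k b).
Proof. by rewrite /zcut big_map big_filter. Qed.

Lemma big_zcuts b (h : seq nat -> seq nat -> K) :
  \sum_(c <- zcuts b) h c.1 c.2 = \sum_(c <- zcut predT b) h c.1 c.2.
Proof.
rewrite /zcuts big_cat /= /zcutb !big_zcut [RHS](bigID (fun k => last 1%N b <= k)%N) /=.
by congr (_ + _); apply: eq_bigl => k; rewrite ?eqb_id ?eqbF_neg andbT.
Qed.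

(** Normal form of an iterated cut, at two values [j <= k]; [P] compares them with the last letter.
    Its three positions, up to [j], between [j] and [k], or above [k], give the dendriform
    relations. *)
Let T (P : nat -> nat -> bool) f :=
  \sum_(k <- iota 0 n.+1) \sum_(j <- iota 0 k.+1)
    (if [&& cle a k == k, cle a j == j & P j k]
     then f (low j a) (low (k - j)%N (high j a)) (high k a) else 0).

Lemma zcut_left p (q : seq nat -> pred nat) (P : nat -> nat -> bool) f :
  (forall j k, (j <= k <= n)%N -> cle a k = k -> p k && q (low k a) j = P j k) ->
  \sum_(c <- zcut p a) \sum_(d <- zcut (q c.1) c.1) f d.1 d.2 c.2 = T P f.
Proof.
move=> HP; rewrite (big_zcut _ _ (fun c1 c2 => \sum_(d <- zcut (q c1) c1) f d.1 d.2 c2)).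
rewrite big_mkcond; apply: eq_big_seq => k; rewrite mem_iota0 => kn.
rewrite (big_zcut _ _ (fun d1 d2 => f d1 d2 (high k a))) size_low.
case: eqP => [ck|_] /=; last by rewrite big1.
rewrite ck if_big; apply: eq_big_seq => j; rewrite mem_iota0 => jk.
rewrite cle_low // low_low // high_low // -HP ?jk //.
by case: (p k); rewrite ?andbF.
Qed.

Lemma zcut_right p (q : seq nat -> pred nat) (P : nat -> nat -> bool) f :
  (forall j k, (j <= k <= n)%N -> cle a j = j -> p j && q (high j a) (k - j)%N = P j k) ->
  \sum_(c <- zcut p a) \sum_(d <- zcut (q c.2) c.2) f c.1 d.1 d.2 = T P f.
Proof.
move=> HP; rewrite (big_zcut _ _ (fun c1 c2 => \sum_(d <- zcut (q c2) c2) f c1 d.1 d.2)).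
rewrite /T (big_triangle n (fun j k => (if [&& cle a k == k, cle a j == j & P j k]
     then f (low j a) (low (k - j)%N (high j a)) (high k a) else 0))).
rewrite big_mkcond; apply: eq_big_seq => j; rewrite mem_iota0 => jn.
rewrite (big_zcut _ _ (fun d1 d2 => f (low j a) d1 d2)).
case: eqP => [cj|_] /=; last by rewrite big1 // => i _; rewrite andbF.
have -> : size (high j a) = (n - j)%N by have := size_high j a; rewrite cj -/n; lia.
rewrite if_big; apply: eq_big_seq => i; rewrite mem_iota0 => ij.
rewrite high_high addKn -HP ?addKn ?leq_addr //=; last by lia.
have -> : (cle (high j a) i == i) = (cle a (j + i) == (j + i)%N).
  by rewrite -cle_high cj addnC eqn_add2l.
by case: (p j); rewrite ?andbF.
Qed.

Lemma zcutb_assoc_tt f :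
  \sum_(c <- zcutb true a) \sum_(d <- zcutb true c.1) f d.1 d.2 c.2 =
  \sum_(c <- zcutb true a) \sum_(d <- zcuts c.2) f c.1 d.1 d.2.
Proof.
under [RHS]eq_bigr => c _ do rewrite (big_zcuts _ (fun d1 d2 => f c.1 d1 d2)).
rewrite (zcut_left (q := fun b k => (last 1 b <= k)%N == true) (P := fun j k => (last 1 a <= j)%N)).
  rewrite (zcut_right (q := fun b => predT) (P := fun j k => (last 1 a <= j)%N)) // => j k _ _.
  by rewrite eqb_id andbT.
move=> j k /andP [jk kn] _; rewrite !eqb_id; case: (leqP (last 1 a) k) => lk /=; first by rewrite last_low.
by apply/esym/negbTE; rewrite -ltnNge; apply: leq_ltn_trans lk.
Qed.

Lemma zcutb_assoc_tf f :
  \sum_(c <- zcutb true a) \sum_(d <- zcutb false c.1) f d.1 d.2 c.2 =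
  \sum_(c <- zcutb false a) \sum_(d <- zcutb true c.2) f c.1 d.1 d.2.
Proof.
rewrite (zcut_left (q := fun b k => (last 1 b <= k)%N == false) (P := fun j k => (j < last 1 a <= k)%N)).
  rewrite (zcut_right (q := fun b k => (last 1 b <= k)%N == true) (P := fun j k => (j < last 1 a <= k)%N)) //.
  move=> j k /andP [jk kn] _; rewrite eqbF_neg eqb_id -ltnNge; case: (ltnP j (last 1 a)) => //= lk.
  by rewrite last_high ?(leq_trans jk) //; lia.
move=> j k /andP [jk kn] _; rewrite eqbF_neg eqb_id -ltnNge; case: (leqP (last 1 a) k) => lk /=; last by rewrite andbF.
by rewrite last_low // andbT.
Qed.

Lemma zcutb_assoc_ff f :
  \sum_(c <- zcutb false a) \sum_(d <- zcuts c.1) f d.1 d.2 c.2 =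
  \sum_(c <- zcutb false a) \sum_(d <- zcutb false c.2) f c.1 d.1 d.2.
Proof.
under [LHS]eq_bigr => c _ do rewrite (big_zcuts _ (fun d1 d2 => f d1 d2 c.2)).
rewrite (zcut_left (q := fun b => predT) (P := fun j k => (k < last 1 a)%N)) => [|j k _ _]; last first.
  by rewrite eqbF_neg andbT -ltnNge.
rewrite (zcut_right (q := fun b k => (last 1 b <= k)%N == false) (P := fun j k => (k < last 1 a)%N)) //.
move=> j k /andP [jk kn] _; rewrite !eqbF_neg -!ltnNge; case: (ltnP j (last 1 a)) => lj /=.
  by rewrite last_high ?(leq_trans jk) //; lia.
by apply/esym/negbTE; rewrite -leqNgt; apply: leq_trans jk.
Qed.
End ZCoassoc.

Lemma parking_mix s u v : is_parking u -> is_parking v -> mixable s u v ->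
  is_parking (mix s u (map (addn (size u)) v)).
Proof.
move=> pu pv suv; have uw := parking_word pu; have vw := parking_word pv.
have H := park_mix uw vw suv (parking_le pu).
rewrite -{1}(park_id pu) -(park_id pv) -H; first exact/park_parking/(mix_word uw vw suv (parking_le pu)).
by move=> y yu; have := parking_cle pu yu; lia.
Qed.

Section MixCut.
Variables (u v : seq nat).
Hypotheses (pu : is_parking u) (pv : is_parking v).
Let k := size u.
Let n := size u + size v.
Let mx s := mix s u (map (addn k) v).

Let cutcond b a := [&& cle a k == k, (last 1 a <= k) == b, low k a == u & high k a == v].

Lemma low_mix s : mixable s u v -> low k (mx s) = u.
Proof.
rewrite /mx /low; have := parking_le pu; rewrite -/k; have := parking_word pv.
elim: s u v => [|b s IH] u' v' vw uk; first by rewrite /mixable => /andP [/eqP/esym/size0nil ->].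
case: b => /mixable_cons [x [r [E H]]]; rewrite E in vw uk *; move: vw uk => /= vw uk.
  by case/andP: uk => -> uk; rewrite IH.
by case/andP: vw => x0 vw; rewrite leqNgt ifF ?IH //; lia.
Qed.

Lemma high_mix s : mixable s u v -> high k (mx s) = v.
Proof.
rewrite /mx /high; have := parking_le pu; rewrite -/k; have := parking_word pv.
elim: s u v => [|b s IH] u' v' vw uk; first by rewrite /mixable => /andP [_ /eqP/esym/size0nil ->].
case: b => /mixable_cons [x [r [E H]]]; rewrite E in vw uk *; move: vw uk => /= vw uk.
  by case/andP: uk => xk uk; rewrite ltnNge xk IH.
by case/andP: vw => x0 vw; rewrite ifT /= ?IH ?addKn //; lia.
Qed.

Lemma map_le_mix s : mixable s u v -> map (fun x => x <= k) (mx s) = s.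
Proof.
rewrite /mx; have := parking_le pu; rewrite -/k; have := parking_word pv.
elim: s u v => [|b s IH] u' v' vw uk; first by [].
case: b => /mixable_cons [x [r [E H]]]; rewrite E in vw uk *; move: vw uk => /= vw uk.
  by case/andP: uk => -> uk; rewrite IH.
by case/andP: vw => x0 vw; rewrite IH // leqNgt; congr (_ :: _); lia.
Qed.

Lemma last_map_le (a : seq nat) : size a = n ->
  (last 1 a <= k) = last false (map (fun x => x <= k) a).
Proof.
by case/lastP: a => [|a x]; [rewrite /n /k; case: (size u) | rewrite map_rcons !last_rcons].
Qed.

Lemma mix_low_high a : mix (map (fun x => x <= k) a) (low k a) (map (addn k) (high k a)) = a.
Proof.
rewrite /low /high; elim: a => //= x a IH; case: (leqP x k) => xk /=; first by rewrite IH.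
by rewrite IH subnKC // ltnW.
Qed.

Lemma mixable_low_high a : low k a = u -> high k a = v -> mixable (map (fun x => x <= k) a) u v.
Proof.
move=> <- <-; rewrite /mixable !count_map size_map !size_filter; apply/andP; split => //.
by apply/eqP/eq_count => x /=; rewrite ltnNge.
Qed.

(** Duality between cuts at a value and shifted shuffles: a parking function cut into [(u, v)] is
    the shuffle of [u] and of [v] shifted by [size u], for a unique mask, the one marking its
    letters at most [size u]. *)
Lemma big_parkings_cutb (K : nzRingType) b (f : seq nat -> K) :
  (\sum_(a <- parkings n) f a * \sum_(c <- zcutb b a) ((c.1 == u)%:R * (c.2 == v)%:R) =
   \sum_(s <- masks n | (count id s == size u) && (last false s == b)) f (mx s))%R.
Proof.
transitivity (\sum_(a <- [seq a <- parkings n | cutcond b a]) f a)%R.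
  rewrite [RHS]big_filter [RHS]big_mkcond; apply: eq_big_seq => a.
  rewrite mem_parkings => /andP [pa /eqP sa].
  rewrite (big_zcut _ _ (fun c1 c2 => (c1 == u)%:R * (c2 == v)%:R)%R) big_mkcond.
  rewrite (bigD1_seq k) ?iota_uniq ?mem_iota0 ?sa ?leq_addr // big1 => [|j jk]; last first.
    case: ifP => // /andP [/eqP cj _]; case: eqP => [E|]; rewrite ?mul0r //.
    by case/eqP: jk; rewrite /k -E size_low.
  rewrite [X in (_ * X)%R]addr0 /cutcond; case: (cle a k == k); case: (_ == b) => /=; rewrite ?mulr0 //.
  by case: (low k a == u); case: (high k a == v); rewrite ?(mulr0, mul0r, mulr1).
rewrite -[RHS]big_filter -[RHS](big_map mx xpredT f).
set l := filter _ (masks n); have ml s : s \in l -> mixable s u v.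
  rewrite mem_filter mem_masks => /andP [/andP [cs _] /eqP sz].
  by rewrite /mixable cs /= -(eqn_add2l (size u)) -{1}(eqP cs) count_predC sz.
apply/perm_big/uniq_perm; first exact/filter_uniq/uniq_parkings.
  rewrite map_inj_in_uniq ?filter_uniq ?uniq_masks // => s t sl tl E.
  by rewrite -(map_le_mix (ml s sl)) -(map_le_mix (ml t tl)) E.
move=> a; rewrite mem_filter mem_parkings; apply/andP/mapP => [[/and4P [_ la /eqP ua /eqP va] /andP [pa /eqP sa]]|[s sl ->]].
  exists (map (fun x => x <= k) a); last by rewrite /mx -{1}ua -va mix_low_high.
  have /andP [cs _] := mixable_low_high ua va.
  by rewrite mem_filter cs mem_masks size_map sa eqxx andbT -last_map_le.
have ms := ml s sl; have sz := mixable_size ms.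
have sm : size (mx s) = n by rewrite size_mix.
rewrite parking_mix // sm eqxx /cutcond low_mix // high_mix // !eqxx last_map_le // map_le_mix //.
rewrite -size_low low_mix // eqxx; move: sl; rewrite mem_filter => /andP [/andP [_ ->] _].
by [].
Qed.
End MixCut.

(** * Linear algebra and dendriform relations *)

Section ListMatrices.
Variable K : fieldType.
Local Open Scope ring_scope.

Section Vectors.
Variables (X : eqType) (l : seq X).
Hypothesis ul : uniq l.

Let el (i : 'I_(size l)) : X := tnth (in_tuple l) i.

Definition fun_of_row (v : 'rV[K]_(size l)) (x : X) : K :=
  if insub (index x l) is Some i then v 0 i else 0.

Lemma fun_of_rowE v i : fun_of_row v (el i) = v 0 i.
Proof.
rewrite /fun_of_row /el (tnth_nth (tnth (in_tuple l) i)) /= index_uniq //.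
by rewrite insubT //= => lt; congr (v 0 _); apply: val_inj.
Qed.

Lemma big_list_ord (f : X -> K) : \sum_(x <- l) f x = \sum_i f (el i).
Proof. exact: big_tnth. Qed.

Lemma el_onto x : x \in l -> exists i, x = el i.
Proof. by move=> /(tnthP (in_tuple l)) [i ->]; exists i. Qed.

Lemma index_el i : index (el i) l = i.
Proof. by rewrite /el {1}(tnth_nth (el i)) /= index_uniq. Qed.

Lemma el_inj : injective el.
Proof. by move=> i j /(congr1 (index^~ l)); rewrite !index_el => /val_inj. Qed.
End Vectors.

Variables (X Y : eqType).

Lemma row_free_ker m n (A : 'M[K]_(m, n)) :
  (forall v : 'rV_m, v *m A = 0 -> v = 0) -> row_free A.
Proof.
move=> H; rewrite -kermx_eq0; apply/eqP/row_matrixP => i; rewrite row0.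
by apply: H; rewrite -row_mul mulmx_ker row0.
Qed.

(** The matrix has independent columns, hence a left inverse; [beta t] is the row of index [t] of
    that inverse. *)
Lemma dual_family (lX : seq X) (lT : seq Y) (B : X -> Y -> K) :
  uniq lX -> uniq lT ->
  (forall psi : Y -> K, (forall x, x \in lX -> \sum_(t <- lT) B x t * psi t = 0) ->
     forall t, t \in lT -> psi t = 0) ->
  exists beta : Y -> X -> K, forall t t', t \in lT -> t' \in lT ->
    \sum_(x <- lX) beta t x * B x t' = (t == t')%:R.
Proof.
move=> uX uT inj.
pose A : 'M[K]_(size lT, size lX) := \matrix_(j, i) B (tnth (in_tuple lX) i) (tnth (in_tuple lT) j).
have fA : row_free A.
  apply: row_free_ker => v vA; apply/rowP => j; rewrite mxE -(fun_of_rowE uT).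
  apply: inj; last exact: mem_tnth.
  move=> _ /el_onto [i ->]; have := congr1 (fun M : 'rV_ _ => M 0 i) vA; rewrite !mxE => E; rewrite -[RHS]E.
  by rewrite big_list_ord; apply: eq_bigr => k _; rewrite fun_of_rowE // mxE mulrC.
have E := mulmxKp fA (1%:M); rewrite mul1mx in E.
exists (fun t => if insub (index t lT) is Some j then fun_of_row (row j (pinvmx A)^T) else fun=> 0).
move=> t t' tT /el_onto [j' ->]; have [j ->] := el_onto tT.
rewrite (index_el uT) valK big_list_ord (inj_eq (el_inj uT)) eq_sym.
have := congr1 (fun M : 'M_ _ => M j' j) E; rewrite !mxE => <-.
by apply: eq_bigr => i _; rewrite fun_of_rowE // !mxE mulrC.
Qed.

Lemma injective_family_size (lX : seq X) (lT : seq Y) (B : X -> Y -> K) :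
  uniq lX -> uniq lT ->
  (forall psi : Y -> K, (forall x, x \in lX -> \sum_(t <- lT) B x t * psi t = 0) ->
     forall t, t \in lT -> psi t = 0) ->
  (size lT <= size lX)%N.
Proof.
move=> uX uT inj.
pose A : 'M[K]_(size lT, size lX) := \matrix_(j, i) B (tnth (in_tuple lX) i) (tnth (in_tuple lT) j).
have /eqP <- : row_free A; last exact: rank_leq_col.
apply: row_free_ker => v vA; apply/rowP => j; rewrite mxE -(fun_of_rowE uT).
apply: inj; last exact: mem_tnth.
move=> _ /el_onto [i ->]; have := congr1 (fun M : 'rV_ _ => M 0 i) vA; rewrite !mxE => E; rewrite -[RHS]E.
by rewrite big_list_ord; apply: eq_bigr => k _; rewrite fun_of_rowE // mxE mulrC.
Qed.

Lemma span_family (lX : seq X) (lT : seq Y) (B : X -> Y -> K) :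
  uniq lX -> uniq lT -> size lX = size lT ->
  (forall psi : Y -> K, (forall x, x \in lX -> \sum_(t <- lT) B x t * psi t = 0) ->
     forall t, t \in lT -> psi t = 0) ->
  forall f : X -> K, exists psi : Y -> K,
    forall x, x \in lX -> f x = \sum_(t <- lT) psi t * B x t.
Proof.
move=> uX uT sz inj f.
pose A : 'M[K]_(size lT, size lX) := \matrix_(j, i) B (tnth (in_tuple lX) i) (tnth (in_tuple lT) j).
have fA : row_free A.
  apply: row_free_ker => v vA; apply/rowP => j; rewrite mxE -(fun_of_rowE uT).
  apply: inj; last exact: mem_tnth.
  move=> _ /el_onto [i ->]; have := congr1 (fun M : 'rV_ _ => M 0 i) vA; rewrite !mxE => E; rewrite -[RHS]E.
  by rewrite big_list_ord; apply: eq_bigr => k _; rewrite fun_of_rowE // mxE mulrC.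
have fullA : row_full A by move: fA; rewrite /row_free /row_full => /eqP ->; rewrite sz.
have /submxP [w Ew] : (\row_i f (tnth (in_tuple lX) i) <= A)%MS by exact: submx_full.
exists (fun_of_row w) => _ /el_onto [i ->].
have := congr1 (fun M : 'rV_ _ => M 0 i) Ew; rewrite !mxE => ->.
by rewrite [RHS]big_list_ord; apply: eq_bigr => k _; rewrite fun_of_rowE // mxE.
Qed.

(* The solutions of [G *m S = C] are directed by the left kernel of [S], which is a
   complement of the row space of [P] since [P *m S] is invertible. *)
Lemma mx_completion t u N (P : 'M[K]_(t, N)) (S : 'M[K]_(N, t)) (C : 'M[K]_(u, t)) :
  P *m S \in unitmx -> N = (t + u)%N ->
  exists G : 'M[K]_(u, N), G *m S = C /\ row_free (col_mx P G).
Proof.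
move=> uPS EN.
have rS : \rank S = t.
  apply/eqP; rewrite eqn_leq rank_leq_col /=.
  have := mulmx_max_rank P S; have := mxrankM_maxr P S; rewrite mxrank_unit //.
have rk : \rank (kermx S) = u by rewrite mxrank_ker rS EN addKn.
have [R [RS fR]] : exists R : 'M[K]_(u, N), R *m S = 0 /\ row_free R.
  case: _ / rk; exists (row_base (kermx S)); split; last exact: row_base_free.
  by apply/sub_kermxP; rewrite eq_row_base.
exists (C *m invmx (P *m S) *m P + R); split.
  by rewrite mulmxDl RS addr0 -mulmxA mulmxKV.
apply: row_free_ker => v; rewrite -[v]hsubmxK mul_row_col mulmxDr mulmxA addrA -mulmxDl => E.
have := congr1 (mulmx^~ S) E; rewrite /= mul0mx (mulmxDl _ (rsubmx v *m R)) -(mulmxA _ R) RS mulmx0 addr0 -(mulmxA _ P) => E1.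
have E2 : lsubmx v + rsubmx v *m (C *m invmx (P *m S)) = 0.
  by rewrite -[LHS](mulmxK uPS) E1 mul0mx.
have E3 : rsubmx v = 0.
  apply: (row_free_inj fR); rewrite mul0mx; move: E; rewrite E2.
  by rewrite mul0mx add0r.
by move: E2; rewrite E3 mul0mx addr0 => ->; rewrite row_mx0.
Qed.

Lemma mx_completion_ker t t' u N (P : 'M[K]_(t, N)) (S : 'M[K]_(N, t')) (C : 'M[K]_(u, t')) :
  t' = t -> (forall v : 'cV_t', P *m S *m v = 0 -> v = 0) -> N = (t + u)%N ->
  exists G : 'M[K]_(u, N), G *m S = C /\ row_free (col_mx P G).
Proof.
move=> E; case: t / E P => P inj EN; apply: mx_completion => //.
rewrite -unitmx_tr -row_free_unit; apply: row_free_ker => v.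
by move/(congr1 trmx); rewrite trmx_mul trmxK trmx0 => /inj/(congr1 trmx); rewrite trmxK trmx0.
Qed.

(** In [good_step], [D] and [U] are the decomposable and the indecomposable forests, [P] the parking
    functions and [T] the nontrivial triples. [Pi] holds the rows of the pairing already forced, [G]
    the rows sought, [S] the test elements and [C] the values they must take. *)
Lemma list_completion (D U P : seq X) (T : seq Y) (Pi : X -> X -> K) (S C : X -> Y -> K) :
  uniq D -> uniq U -> uniq P -> uniq T -> size T = size D -> size P = (size D + size U)%N ->
  (forall psi : Y -> K,
     (forall F, F \in D -> \sum_(t <- T) (\sum_(a <- P) Pi F a * S a t) * psi t = 0) ->
     forall t, t \in T -> psi t = 0) ->
  exists G : X -> X -> K,
    (forall F t, F \in U -> t \in T -> \sum_(a <- P) G F a * S a t = C F t) /\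
    (forall c d : X -> K,
       (forall a, a \in P -> \sum_(F <- D) c F * Pi F a + \sum_(F <- U) d F * G F a = 0) ->
       (forall F, F \in D -> c F = 0) /\ (forall F, F \in U -> d F = 0)).
Proof.
move=> uD uU uP uT sT sP inj.
pose mP : 'M[K]_(size D, size P) := \matrix_(i, j) Pi (tnth (in_tuple D) i) (tnth (in_tuple P) j).
pose mS : 'M[K]_(size P, size T) := \matrix_(i, j) S (tnth (in_tuple P) i) (tnth (in_tuple T) j).
pose mC : 'M[K]_(size U, size T) := \matrix_(i, j) C (tnth (in_tuple U) i) (tnth (in_tuple T) j).
have [v Ev|G [GS fG]] := @mx_completion_ker (size D) (size T) (size U) (size P) mP mS mC sT _ sP.
  apply/colP => j; rewrite mxE -[v]trmxK mxE -(fun_of_rowE uT).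
  apply: inj; last exact: mem_tnth.
  move=> _ /el_onto [i ->]; have := congr1 (fun M : 'cV_ _ => M i 0) Ev; rewrite !mxE => E; rewrite -[RHS]E.
  rewrite big_list_ord; apply: eq_bigr => k _; rewrite fun_of_rowE // !mxE; congr (_ * _).
  by rewrite big_list_ord; apply: eq_bigr => a _; rewrite !mxE.
exists (fun F a => if insub (index F U) is Some i then fun_of_row (row i G) a else 0).
have GE i j : (if insub (index (tnth (in_tuple U) i) U) is Some i then fun_of_row (row i G) (tnth (in_tuple P) j) else 0) = G i j.
  rewrite {1}(tnth_nth (tnth (in_tuple U) i)) /= index_uniq //.
  rewrite insubT //= => lt; rewrite fun_of_rowE // mxE; congr (G _ j); exact: val_inj.
split=> [_ _ /el_onto [i ->] /el_onto [j ->]|c d H].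
  have := congr1 (fun M : 'M_(_, _) => M i j) GS; rewrite !mxE => <-.
  by rewrite big_list_ord; apply: eq_bigr => a _; rewrite GE !mxE.
pose v : 'rV[K]_(size D + size U) := row_mx (\row_i c (tnth (in_tuple D) i)) (\row_i d (tnth (in_tuple U) i)).
have v0 : v = 0.
  apply: (row_free_inj fG); rewrite mul0mx mul_row_col; apply/rowP => j.
  rewrite !mxE -[RHS](H (tnth (in_tuple P) j)) ?mem_tnth // (big_list_ord D) (big_list_ord U).
  by congr (_ + _); apply: eq_bigr => i _; rewrite !mxE ?GE.
split=> _ /el_onto [i ->].
  by have := congr1 (fun M : 'rV_ _ => M 0 (lshift _ i)) v0; rewrite row_mxEl !mxE.
by have := congr1 (fun M : 'rV_ _ => M 0 (rshift _ i)) v0; rewrite row_mxEr !mxE.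
Qed.
End ListMatrices.

(* [hp true] (left) and [hp false] (right) are the half products of a dendriform
   algebra of functions, dual to a coproduct split according to the Boolean. *)
Section Dendriform.
Variables (K : fieldType) (cut : bool -> seq nat -> seq (seq nat * seq nat)) (X : pred (seq nat)).
Local Open Scope ring_scope.
Implicit Types f g h : seq nat -> K.

Definition hp b f g x := \sum_(c <- cut b x) f c.1 * g c.2.
Definition star f g x := hp true f g x + hp false f g x.
(** The product written [(f right g) left h]; by [hp_tf] the other bracketing gives the same
    function. *)
Definition mid f g h := hp true (hp false f g) h.

Hypothesis cutX : forall b x c, X x -> c \in cut b x ->
  [/\ X c.1, X c.2 & (size c.1 + size c.2 = size x)%N].
Hypothesis hp_tt : forall f g h x, hp true (hp true f g) h x = hp true f (star g h) x.
Hypothesis hp_tf : forall f g h x, hp true (hp false f g) h x = hp false f (hp true g h) x.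
Hypothesis hp_ff : forall f g h x, hp false f (hp false g h) x = hp false (star f g) h x.

(** Functions are defined on all words, but only their values on [X], forests or parking functions,
    have a meaning. *)
Definition eqX f g := forall x, X x -> f x = g x.
Definition homog n f := forall x, X x -> size x <> n -> f x = 0.

Lemma eq_hp b f f' g g' : eqX f f' -> eqX g g' -> eqX (hp b f g) (hp b f' g').
Proof.
by move=> Ef Eg x Xx; apply: eq_big_seq => c /(cutX Xx) [X1 X2 _]; rewrite Ef ?Eg.
Qed.

Lemma eq_mid f f' g h h' : eqX f f' -> eqX h h' -> eqX (mid f g h) (mid f' g h').
Proof. by move=> Ef Eh; do 2!apply: eq_hp => //. Qed.

Lemma hom_hp b i j f g : homog i f -> homog j g -> homog (i + j) (hp b f g).
Proof.
move=> hf hg x Xx sx; apply: big1_seq => c /andP [_ /(cutX Xx) [X1 X2 sz]].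
case: (eqVneq (size c.1) i) => [E1|/eqP n1]; last by rewrite hf ?mul0r.
by rewrite [g _]hg ?mulr0 // => E2; apply: sx; rewrite -sz E1 E2.
Qed.

Lemma hom_star i j f g : homog i f -> homog j g -> homog (i + j) (star f g).
Proof.
by move=> hf hg x Xx sx; rewrite /star !(hom_hp _ hf hg) ?addr0.
Qed.

Lemma hp_suml (I : Type) (r : seq I) b (a : I -> K) (F : I -> seq nat -> K) g x :
  hp b (fun y => \sum_(i <- r) a i * F i y) g x = \sum_(i <- r) a i * hp b (F i) g x.
Proof.
rewrite /hp; under eq_bigr do rewrite mulr_suml; rewrite exchange_big /=.
by apply: eq_bigr => i _; rewrite mulr_sumr; apply: eq_bigr => c _; rewrite mulrA.
Qed.

Lemma hp_sumr (I : Type) (r : seq I) b (a : I -> K) f (F : I -> seq nat -> K) x :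
  hp b f (fun y => \sum_(i <- r) a i * F i y) x = \sum_(i <- r) a i * hp b f (F i) x.
Proof.
rewrite /hp; under eq_bigr do rewrite mulr_sumr; rewrite exchange_big /=.
by apply: eq_bigr => i _; rewrite mulr_sumr; apply: eq_bigr => c _; rewrite mulrCA.
Qed.

Section Span.
Variables (T : eqType) (B : T -> seq nat -> K) (l : seq T) (n : nat).

Definition spanned f := exists psi : T -> K,
  forall x, X x -> size x = n -> f x = \sum_(t <- l) psi t * B t x.

Lemma eq_spanned f g : eqX f g -> spanned g -> spanned f.
Proof. by move=> E [psi H]; exists psi => x Xx sx; rewrite E ?H. Qed.

Lemma spanned_mem t : uniq l -> t \in l -> spanned (B t).
Proof.
move=> ul tl; exists (fun s => (s == t)%:R) => x _ _.
rewrite (bigD1_seq t) //= eqxx mul1r big1 ?addr0 // => s /negbTE ->.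
by rewrite mul0r.
Qed.

Lemma spanned_sum (I : eqType) (r : seq I) (a : I -> K) (F : I -> seq nat -> K) :
  (forall i, i \in r -> spanned (F i)) -> spanned (fun x => \sum_(i <- r) a i * F i x).
Proof.
elim: r => [|i r IH] H; first by exists (fun=> 0) => x _ _; rewrite big_nil big1 // => t _; rewrite mul0r.
have [psi1 H1] := H i (mem_head _ _).
have [|psi2 H2] := IH; first by move=> j jr; apply: H; rewrite inE jr orbT.
exists (fun t => a i * psi1 t + psi2 t) => x Xx sx.
rewrite big_cons H1 // H2 // mulr_sumr -big_split /=.
by apply: eq_bigr => t _; rewrite mulrDl mulrA.
Qed.
End Span.
End Dendriform.

(** * Decomposable forests *)

(** Truncated subtraction inverts both products: a root is coded by 0 under [dot] and by [i] under
    [graft], and both are sent to 0. *)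
Definition down i (F : seq nat) := [seq x - i | x <- drop i F].
Definition dotsplit i F :=
  [&& forest (take i F), forest (down i F) & F == dot (take i F) (down i F)].
Definition graftsplit i F :=
  [&& forest (take i F), forest (down i F) & F == graft (take i F) (down i F)].
Definition fdec (F : seq nat) :=
  has (fun i => dotsplit i F || graftsplit i F) (iota 1 (size F).-1).
Definition indec F := [&& forest F, F != [::] & ~~ fdec F].

Lemma take_dot F G : take (size F) (dot F G) = F.
Proof. exact: take_size_cat. Qed.
Lemma take_graft F G : take (size F) (graft F G) = F.
Proof. exact: take_size_cat. Qed.
Lemma down_dot F G : down (size F) (dot F G) = G.
Proof.
rewrite /down drop_size_cat // -map_comp -[RHS]map_id; apply: eq_map => x /=.
by case: eqP => [->|_]; rewrite ?sub0n ?addKn.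
Qed.
Lemma down_graft F G : down (size F) (graft F G) = G.
Proof.
rewrite /down drop_size_cat // -map_comp -[RHS]map_id; apply: eq_map => x /=.
by rewrite addKn.
Qed.

Lemma size_gt0 (F : seq nat) : F != [::] -> 0 < size F.
Proof. by case: F. Qed.

Lemma size_neq0 (F : seq nat) : 0 < size F -> F != [::].
Proof. by case: F. Qed.

Lemma fdec_dot F G : forest F -> forest G -> F != [::] -> G != [::] -> fdec (dot F G).
Proof.
move=> fF fG F0 G0; apply/hasP; exists (size F).
  by rewrite mem_iota size_dot; move: (size_gt0 F0) (size_gt0 G0); lia.
by rewrite /dotsplit take_dot down_dot fF fG eqxx.
Qed.

Lemma fdec_graft F G : forest F -> forest G -> F != [::] -> G != [::] -> fdec (graft F G).
Proof.
move=> fF fG F0 G0; apply/hasP; exists (size F).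
  by rewrite mem_iota size_graft; move: (size_gt0 F0) (size_gt0 G0); lia.
by rewrite /graftsplit take_graft down_graft fF fG eqxx orbT.
Qed.

Lemma fdecP F : fdec F -> exists G H, [/\ forest G, forest H, G != [::], H != [::] &
  F = dot G H \/ F = graft G H].
Proof.
move=> /hasP [i]; rewrite mem_iota => iF.
have t0 : take i F != [::] by apply: size_neq0; rewrite size_take_min; lia.
have d0 : down i F != [::] by apply: size_neq0; rewrite size_map size_drop; lia.
by case/orP => /and3P [f1 f2 /eqP E]; exists (take i F), (down i F); split=> //; [left|right].
Qed.

Lemma dot0f F : dot [::] F = F.
Proof. by rewrite /dot /= -[RHS]map_id; apply: eq_map => x; case: eqP. Qed.
Lemma dotf0 F : dot F [::] = F. Proof. exact: cats0. Qed.
Lemma graftf0 F : graft F [::] = F. Proof. exact: cats0. Qed.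
Lemma dot_eq0 F G : (dot F G == [::]) = (F == [::]) && (G == [::]).
Proof. by rewrite -!size_eq0 size_dot addn_eq0. Qed.
Lemma graft_eq0 F G : (graft F G == [::]) = (F == [::]) && (G == [::]).
Proof. by rewrite -!size_eq0 size_graft addn_eq0. Qed.

Lemma indec_forest p : indec p -> forest p. Proof. by case/and3P. Qed.
Lemma indec_neq0 p : indec p -> p != [::]. Proof. by case/and3P. Qed.
Lemma indec_size p : indec p -> 0 < size p. Proof. by move=> /indec_neq0 /size_gt0. Qed.

Definition upto n := undup (flatten [seq forests i | i <- iota 0 n.+1]).

Lemma mem_upto n (F : seq nat) : (F \in upto n) = forest F && (size F <= n).
Proof.
rewrite mem_undup; apply/flattenP/andP => [[s /mapP [i]]|[fF sF]].
  by rewrite mem_iota0 => iN ->; rewrite mem_forests => /andP [-> /eqP ->].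
by exists (forests (size F)); rewrite ?map_f ?mem_iota0 // mem_forests fF eqxx.
Qed.

(** [(x, (p, y))] indexes the element [(x right p) left y] of the dual, see [mid3]. *)
Definition triple := (seq nat * (seq nat * seq nat))%type.
Definition tdeg (t : triple) := size t.1 + size t.2.1 + size t.2.2.

Definition triples n : seq triple :=
  [seq t <- [seq (x, pq) | x <- upto n, pq <- [seq (p, y) | p <- upto n, y <- upto n]] |
    indec t.2.1 && (tdeg t == n)].
Definition ntriples n := [seq t <- triples n | (t.1 != [::]) || (t.2.2 != [::])].

Lemma mem_triples n (t : triple) :
  (t \in triples n) = [&& forest t.1, indec t.2.1, forest t.2.2 & tdeg t == n].
Proof.
rewrite mem_filter; case: t => x [p y]; rewrite /tdeg /=.
case ip : (indec p) => //=; last by rewrite andbF.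
case: eqP => [E|]; rewrite ?andbF // !andbT.
apply/allpairsP/andP => [[[x' pq] /= [xu /allpairsP [[p1 y1] /= [pu yu ->]] [-> _ ->]]]|[fx fy]].
  by move: xu yu; rewrite !mem_upto => /andP [-> _] /andP [-> _].
exists (x, (p, y)); rewrite /= !mem_upto fx; split => //; first lia.
apply/allpairsP; exists (p, y); rewrite /= !mem_upto fy (indec_forest ip); split=> //; lia.
Qed.

Lemma uniq_triples n : uniq (triples n).
Proof.
apply: filter_uniq; apply: allpairs_uniq; rewrite ?undup_uniq //; last by move=> [? ?] [? ?].
by apply: allpairs_uniq; rewrite ?undup_uniq // => -[? ?] [? ?].
Qed.

Lemma mem_ntriples n (t : triple) :
  (t \in ntriples n) = ((t.1 != [::]) || (t.2.2 != [::])) && (t \in triples n).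
Proof. exact: mem_filter. Qed.

Lemma uniq_ntriples n : uniq (ntriples n).
Proof. exact/filter_uniq/uniq_triples. Qed.

Section SpanHalfProducts.
Variables (K : fieldType) (cut : bool -> seq nat -> seq (seq nat * seq nat)) (X : pred (seq nat)).
Local Open Scope ring_scope.
Local Notation hp := (hp cut).
Local Notation star := (star cut).
Local Notation mid := (mid cut).
Hypothesis cutX : forall b x c, X x -> c \in cut b x ->
  [/\ X c.1, X c.2 & (size c.1 + size c.2 = size x)%N].
Hypothesis hp_tt : forall (f g h : seq nat -> K) x, hp true (hp true f g) h x = hp true f (star g h) x.
Hypothesis hp_tf : forall (f g h : seq nat -> K) x, hp true (hp false f g) h x = hp false f (hp true g h) x.
Hypothesis hp_ff : forall (f g h : seq nat -> K) x, hp false f (hp false g h) x = hp false (star f g) h x.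

Variables (e : seq nat -> seq nat -> K) (n : nat).
Definition mid3 (t : triple) := mid (e t.1) (e t.2.1) (e t.2.2).
Hypothesis e_hom : forall F, forest F -> (size F <= n)%N -> homog X (size F) (e F).
Hypothesis e_span : forall k, (k < n)%N -> forall f,
  exists c, forall x, X x -> size x = k -> f x = \sum_(F <- forests k) c F * e F x.
Hypothesis e_mid : forall k, (0 < k < n)%N -> forall F, F \in forests k ->
  spanned X mid3 (triples k) k (e F).

Lemma hom_expand k f : (k < n)%N -> homog X k f ->
  exists c, eqX X f (fun x => \sum_(F <- forests k) c F * e F x).
Proof.
move=> kn hf; have [c Hc] := e_span kn f; exists c => x Xx.
case: (eqVneq (size x) k) => [/Hc -> //|/eqP sx].
rewrite hf // big1_seq // => F /andP [_]; rewrite mem_forests => /andP [fF /eqP sF].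
by rewrite e_hom ?mulr0 ?sF // ltnW.
Qed.

(** As [p] has positive degree, [f] and [g] have degree below [n] and expand on the [e F]; then
    everything is linear. The condition [0 < i + j] keeps the resulting triples in [ntriples]. *)
Lemma spanned_mid i k j p f g : indec p -> size p = k -> (i + k + j = n)%N -> (0 < i + j)%N ->
  homog X i f -> homog X j g -> spanned X mid3 (ntriples n) n (mid f (e p) g).
Proof.
move=> ip sp sn ij hf hg; have p0 := indec_size ip.
have [|c Ec] := hom_expand _ hf; first by lia.
have [|d Ed] := hom_expand _ hg; first by lia.
apply: (eq_spanned (g := (fun x => \sum_(F <- forests i) c F *
   (\sum_(G <- forests j) d G * mid (e F) (e p) (e G) x)))).
  move=> x Xx; rewrite (eq_mid cutX _ Ec Ed Xx) /mid.
  have E : eqX X (hp false (fun x => \sum_(F <- forests i) c F * e F x) (e p))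
     (fun x => \sum_(F <- forests i) c F * hp false (e F) (e p) x).
    by move=> y Xy; rewrite hp_suml.
  rewrite (eq_hp cutX _ E (fun y _ => erefl) Xx) hp_suml.
  by apply: eq_bigr => F _; rewrite hp_sumr.
apply: spanned_sum => F; rewrite mem_forests => /andP [fF /eqP sF].
apply: spanned_sum => G; rewrite mem_forests => /andP [fG /eqP sG].
apply: (@spanned_mem _ _ _ mid3 _ _ (F, (p, G)) (uniq_ntriples n)).
rewrite mem_ntriples mem_triples /tdeg /= fF ip fG sF sG sp sn eqxx !andbT /=.
by rewrite -!size_eq0 sF sG; lia.
Qed.

Lemma hom_expand_mid k f : (0 < k < n)%N -> homog X k f ->
  exists psi, eqX X f (fun x => \sum_(t <- triples k) psi t * mid3 t x).
Proof.
move=> /andP [k0 kn] hf; have [c Ec] := hom_expand kn hf.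
have [psi Hpsi] : spanned X mid3 (triples k) k (fun x => \sum_(F <- forests k) c F * e F x).
  by apply: spanned_sum => F Fk; apply: e_mid => //; rewrite k0.
exists psi => x Xx; case: (eqVneq (size x) k) => [/Hpsi <- //|/eqP sx]; first exact: Ec.
rewrite hf // big1_seq // => t /andP [_]; rewrite mem_triples => /and4P [f1 /indec_forest f2 f3 /eqP st].
have hm : homog X k (mid3 t).
  rewrite -st /tdeg; apply: (hom_hp cutX); first apply: (hom_hp cutX); apply: e_hom => //; rewrite /tdeg in st; lia.
by rewrite hm ?mulr0.
Qed.

(** One factor is expanded on triple products, and the other is absorbed by the dendriform
    relations: [((x right p) left y) left g = (x right p) left (star y g)] when [b] is true, and [f
    right ((x right p) left y) = (star f x right p) left y] otherwise. *)
Lemma spanned_hp b i j f g : (0 < i)%N -> (0 < j)%N -> (i + j = n)%N ->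
  homog X i f -> homog X j g -> spanned X mid3 (ntriples n) n (hp b f g).
Proof.
move=> i0 j0 ijn hf hg; case: b.
  have [|psi E] := hom_expand_mid _ hf; first by lia.
  apply: (eq_spanned (g := (fun x => \sum_(t <- triples i) psi t * hp true (mid3 t) g x))).
    by move=> x Xx; rewrite (eq_hp cutX _ E (fun y _ => erefl) Xx) hp_suml.
  suff key (t : triple) : t \in triples i -> spanned X mid3 (ntriples n) n (hp true (mid3 t) g).
    exact: spanned_sum.
  rewrite mem_triples => /and4P [f1 ip f3 /eqP st].
  have p0 := indec_size ip; rewrite /tdeg in st.
  apply: (eq_spanned (g := (mid (e t.1) (e t.2.1) (star (e t.2.2) g)))).
    by move=> x Xx; rewrite /mid3 hp_tt.
  apply: (@spanned_mid (size t.1) _ (size t.2.2 + j)) => //; try lia.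
    by apply: e_hom => //; lia.
  by apply: (hom_star cutX) => //; apply: e_hom => //; lia.
have [|psi E] := hom_expand_mid _ hg; first by lia.
apply: (eq_spanned (g := (fun x => \sum_(t <- triples j) psi t * hp false f (mid3 t) x))).
  by move=> x Xx; rewrite (eq_hp cutX _ (fun y _ => erefl) E Xx) hp_sumr.
suff key (t : triple) : t \in triples j -> spanned X mid3 (ntriples n) n (hp false f (mid3 t)).
  exact: spanned_sum.
rewrite mem_triples => /and4P [f1 ip f3 /eqP st].
have p0 := indec_size ip; rewrite /tdeg in st.
apply: (eq_spanned (g := (mid (star f (e t.1)) (e t.2.1) (e t.2.2)))).
  by move=> x Xx; rewrite /mid3 /mid -hp_tf; apply: (eq_hp cutX).
apply: (@spanned_mid (i + size t.1) _ (size t.2.2)) => //; try lia.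
  by apply: (hom_star cutX) => //; apply: e_hom => //; lia.
by apply: e_hom => //; lia.
Qed.
End SpanHalfProducts.

Lemma cutb_forest b (F : seq nat) c : forest F -> c \in cutb b F ->
  [/\ forest c.1, forest c.2 & (size c.1 + size c.2 = size F)%N].
Proof.
move=> fF /mapP [s]; rewrite mem_filter => /andP [_ sI] ->.
have [u1 u2] := splits_uniq (iota_uniq 1 (size F)) sI.
have := mem_splits sI 0; rewrite mem_iota /= => /esym/negbT; rewrite negb_or => /andP [z1 z2].
by rewrite /= !forest_restr // !size_restr (size_splits sI) size_iota.
Qed.

Lemma cutt_neq0 F c : c \in cutb true F -> c.1 != [::].
Proof.
move=> /mapP [s]; rewrite mem_filter => /andP [/andP [_ /eqP ns] sI] ->.
by apply: size_neq0; rewrite /= size_restr; case: (s.1) ns.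
Qed.

Lemma cutf_neq0 (F : seq nat) c : F != [::] -> c \in cutb false F -> c.2 != [::].
Proof.
move=> /size_gt0 F0 /mapP [s]; rewrite mem_filter => /andP [/andP [_ /eqP ns] sI] ->.
apply: size_neq0; rewrite /= size_restr.
have : size F \in iota 1 (size F) by rewrite mem_iota; lia.
by rewrite (mem_splits sI) ns; case: (s.2).
Qed.

Section HalfProductAssoc.
Variables (K : fieldType) (cut : bool -> seq nat -> seq (seq nat * seq nat)).
Local Open Scope ring_scope.
Implicit Types f g h : seq nat -> K.

Lemma hp_left b b' f g h x : hp cut b (hp cut b' f g) h x =
  \sum_(c <- cut b x) \sum_(d <- cut b' c.1) f d.1 * g d.2 * h c.2.
Proof. by apply: eq_bigr => c _; rewrite mulr_suml. Qed.

Lemma hp_right b b' f g h x : hp cut b f (hp cut b' g h) x =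
  \sum_(c <- cut b x) \sum_(d <- cut b' c.2) f c.1 * g d.1 * h d.2.
Proof. by apply: eq_bigr => c _; rewrite mulr_sumr; apply: eq_bigr => d _; rewrite mulrA. Qed.

Lemma star_left b f g h x : hp cut b (star cut f g) h x =
  \sum_(c <- cut b x) \sum_(d <- cut true c.1 ++ cut false c.1) f d.1 * g d.2 * h c.2.
Proof. by apply: eq_bigr => c _; rewrite big_cat mulrDl !mulr_suml. Qed.

Lemma star_right b f g h x : hp cut b f (star cut g h) x =
  \sum_(c <- cut b x) \sum_(d <- cut true c.2 ++ cut false c.2) f c.1 * g d.1 * h d.2.
Proof.
by apply: eq_bigr => c _; rewrite big_cat mulrDr !mulr_sumr; congr (_ + _);
  apply: eq_bigr => d _; rewrite mulrA.
Qed.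
End HalfProductAssoc.

Section ForestHalfProducts.
Variable K : fieldType.
Local Open Scope ring_scope.
Implicit Types f g h : seq nat -> K.

Lemma fhp_tt f g h x : hp cutb true (hp cutb true f g) h x = hp cutb true f (star cutb g h) x.
Proof. by rewrite hp_left star_right (cutb_assoc_tt x (fun a b c => f a * g b * h c)). Qed.
Lemma fhp_tf f g h x : hp cutb true (hp cutb false f g) h x = hp cutb false f (hp cutb true g h) x.
Proof. by rewrite hp_left hp_right (cutb_assoc_tf x (fun a b c => f a * g b * h c)). Qed.
Lemma fhp_ff f g h x : hp cutb false f (hp cutb false g h) x = hp cutb false (star cutb f g) h x.
Proof. by rewrite star_left hp_right (cutb_assoc_ff x (fun a b c => f a * g b * h c)). Qed.
Lemma zhp_tt f g h x : hp zcutb true (hp zcutb true f g) h x = hp zcutb true f (star zcutb g h) x.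
Proof. by rewrite hp_left star_right (zcutb_assoc_tt x (fun a b c => f a * g b * h c)). Qed.
Lemma zhp_tf f g h x : hp zcutb true (hp zcutb false f g) h x = hp zcutb false f (hp zcutb true g h) x.
Proof. by rewrite hp_left hp_right (zcutb_assoc_tf x (fun a b c => f a * g b * h c)). Qed.
Lemma zhp_ff f g h x : hp zcutb false f (hp zcutb false g h) x = hp zcutb false (star zcutb f g) h x.
Proof. by rewrite star_left hp_right (zcutb_assoc_ff x (fun a b c => f a * g b * h c)). Qed.
End ForestHalfProducts.

Lemma zcutb_parking b (a : seq nat) c : is_parking a -> c \in zcutb b a ->
  [/\ is_parking c.1, is_parking c.2 & (size c.1 + size c.2 = size a)%N].
Proof.
move=> pa /mapP [k]; rewrite mem_filter => /andP [/andP [/eqP ck _]]; rewrite mem_iota0 => ka ->.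
have sz := size_high k a; have wa := parking_word pa.
rewrite /= size_low sz !is_parkingE; split => //; apply/andP; split.
- by apply/allP => x; rewrite mem_filter => /andP [_ /(allP wa)].
- by apply/parkcondP => y; rewrite size_low ck => yk; rewrite cle_low ?parking_cle // (leq_trans yk).
- by apply/allP => y /mapP [x]; rewrite mem_filter => /andP [kx _] ->; rewrite subn_gt0.
apply/parkcondP => y yh; have := cle_high y k a; have := @parking_cle a (k + y) pa.
by lia.
Qed.

Section CutUnits.
Variables (K : nmodType) (F : seq nat).
Hypotheses (fF : forest F).
Local Open Scope ring_scope.
Implicit Type h : seq nat -> seq nat -> K.

Let restr_nil s : (restr F s == [::]) = (s == [::]).
Proof. by rewrite -!size_eq0 size_restr. Qed.

Let uncut_nilr A : uncut F A [::].
Proof. by apply/allP. Qed.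
Let sF : F != [::] -> size F \in iota 1 (size F).
Proof. by move=> /size_gt0 F0; rewrite mem_iota; lia. Qed.

Lemma big_cutt_nil2 h : F != [::] -> \sum_(c <- cutb true F | c.2 == [::]) h c.1 c.2 = h F [::].
Proof.
move=> F0; rewrite big_mkcond (big_cutb _ _ (fun a b => if b == [::] then h a b else 0)) big_mkcond.
rewrite -[in RHS](restr_iota fF) -(big_splits_nil2 (iota 1 (size F)) (fun a b => h (restr F a) (restr F b))).
rewrite [RHS]big_mkcond; apply: eq_big_seq => s sI; rewrite restr_nil.
case: (s.2 =P [::]) => s2; last by case: ifP.
rewrite s2 uncut_nilr; have := mem_splits sI (size F); rewrite sF // s2 orbF => <-.
by [].
Qed.

Lemma big_cutf_nil1 h : F != [::] -> \sum_(c <- cutb false F | c.1 == [::]) h c.1 c.2 = h [::] F.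
Proof.
move=> F0; rewrite big_mkcond (big_cutb _ _ (fun a b => if a == [::] then h a b else 0)) big_mkcond.
rewrite -[in RHS](restr_iota fF) -(big_splits_nil1 (iota 1 (size F)) (fun a b => h (restr F a) (restr F b))).
rewrite [RHS]big_mkcond; apply: eq_big_seq => s sI; rewrite restr_nil.
by case: (s.1 =P [::]) => s1; [rewrite s1 | case: ifP].
Qed.

Lemma big_cuts_nil2 h : \sum_(c <- cuts F | c.2 == [::]) h c.1 c.2 = h F [::].
Proof.
rewrite big_mkcond (big_cuts (fun a b => if b == [::] then h a b else 0) fF) big_mkcond.
rewrite -[in RHS](restr_iota fF) -(big_splits_nil2 (iota 1 (size F)) (fun a b => h (restr F a) (restr F b))).
rewrite [RHS]big_mkcond; apply: eq_big_seq => s sI; rewrite restr_nil.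
by case: (s.2 =P [::]) => s2; [rewrite s2 uncut_nilr | case: ifP].
Qed.

Lemma big_cuts_nil1 h : \sum_(c <- cuts F | c.1 == [::]) h c.1 c.2 = h [::] F.
Proof.
rewrite big_mkcond (big_cuts (fun a b => if a == [::] then h a b else 0) fF) big_mkcond.
rewrite -[in RHS](restr_iota fF) -(big_splits_nil1 (iota 1 (size F)) (fun a b => h (restr F a) (restr F b))).
rewrite [RHS]big_mkcond; apply: eq_big_seq => s sI; rewrite restr_nil.
by case: (s.1 =P [::]) => s1; [rewrite s1 | case: ifP].
Qed.
End CutUnits.

Lemma cuts_forest (F : seq nat) c : forest F -> c \in cuts F ->
  [/\ forest c.1, forest c.2 & (size c.1 + size c.2 = size F)%N].
Proof. by move=> fF; rewrite mem_cat => /orP []; apply: cutb_forest. Qed.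

Lemma dotA F G H : dot F (dot G H) = dot (dot F G) H.
Proof.
rewrite /dot map_cat catA -map_comp; congr (_ ++ _); apply: eq_map => x /=.
by case: x => //= x; rewrite size_cat size_map; case: eqP; lia.
Qed.

Lemma graftA F G H : graft F (graft G H) = graft (graft F G) H.
Proof.
rewrite /graft map_cat catA -map_comp; congr (_ ++ _); apply: eq_map => x /=.
by rewrite size_cat size_map addnA.
Qed.

Lemma dot_graft F G H : G != [::] -> dot F (graft G H) = graft (dot F G) H.
Proof.
move=> /size_gt0 G0; rewrite /dot /graft map_cat catA -map_comp; congr (_ ++ _).
by apply: eq_map => x /=; rewrite addn_eq0 eqn0Ngt G0 /= size_cat size_map addnA.
Qed.

(** Its surjectivity gives one half of [size_ntriples]; the other half comes from linear
    independence. *)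
Definition of_triple (t : triple) :=
  if t.1 == [::] then dot t.2.2 t.2.1 else graft t.1 (dot t.2.2 t.2.1).

(** A first factor [G] is split off and the rest is a triple by induction; the associativity
    relations [dotA], [dot_graft] and [graftA] push [G] into [y] or [x]. An indecomposable forest is
    its own middle entry. *)
Lemma of_triple_onto (F : seq nat) : forest F -> F != [::] ->
  exists2 t, t \in triples (size F) & F = of_triple t.
Proof.
move: {2}(size F) (leqnn (size F)) => n; elim: n F => [|n IH] F sF fF F0.
  by move: F0; rewrite -size_eq0 -leqn0 sF.
case dF : (fdec F); last first.
  exists ([::], (F, [::])); rewrite ?mem_triples /of_triple /tdeg /= ?dot0f //.
  by rewrite /indec fF F0 dF /= ?addn0 ?add0n eqxx.
have [G [H [fG fH G0 H0 E]]] := fdecP dF.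
have sGH : size F = size G + size H by case: E => ->; rewrite ?size_dot ?size_graft.
have sG := size_gt0 G0; have sH := size_gt0 H0.
have [|[k [p y]]] := IH H _ fH H0; first lia.
rewrite mem_triples /of_triple /tdeg /= => /and4P [fk ip fy /eqP st] EH.
have p0 := indec_size ip.
case: E => E; case: (eqVneq k [::]) EH => [k0|k0] EH.
- exists ([::], (p, dot G y)); last by rewrite /= E EH dotA.
  by rewrite mem_triples /tdeg /= ip forest_dot //= size_dot; move: st; rewrite k0 /=; lia.
- exists (dot G k, (p, y)); last by rewrite /= dot_eq0 (negbTE k0) andbF E EH dot_graft.
  by rewrite mem_triples /tdeg /= ip fy forest_dot //= size_dot; lia.
- exists (G, (p, y)); last by rewrite /= (negbTE G0) E EH.
  by rewrite mem_triples /tdeg /= ip fy fG //=; move: st; rewrite k0 /=; lia.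
exists (graft G k, (p, y)); last by rewrite /= graft_eq0 (negbTE k0) andbF E EH graftA.
by rewrite mem_triples /tdeg /= ip fy forest_graft //= size_graft; lia.
Qed.

(** * Independence on the decomposable forests *)

Section ForestTriples.
Variable K : fieldType.
Local Open Scope ring_scope.
Implicit Types (psi chi : triple -> K) (F G : seq nat).

Definition delta (x y : seq nat) : K := (y == x)%:R.

(** The double sum runs over the cuts of [F] into three pieces whose middle one contains the last
    vertex. *)
Definition sum3 (f : seq nat -> seq nat -> seq nat -> K) F :=
  \sum_(c <- cutb true F) \sum_(d <- cutb false c.1) f d.1 d.2 c.2.

Definition on_indec psi x p y := if indec p then psi (x, (p, y)) else 0.

(** Number of cuts of [F] into the three entries of [t], with the last vertex in the middle piece.
    No pairing is involved. *)
Definition beta (t : triple) := mid3 cutb delta t.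

Lemma betaE t F : beta t F = sum3 (fun x p y => (t == (x, (p, y)))%:R) F.
Proof.
rewrite /beta /mid3 /mid hp_left; apply: eq_bigr => c _; apply: eq_bigr => d _.
case: t => x [p y]; rewrite /delta /= -!natrM !mulnb !xpair_eqE ![_ == x]eq_sym.
by rewrite ![_ == p]eq_sym ![_ == y]eq_sym andbA.
Qed.

Lemma big_beta n psi F : forest F -> size F = n ->
  \sum_(t <- triples n) psi t * beta t F = sum3 (on_indec psi) F.
Proof.
move=> fF sF; under eq_bigr do rewrite betaE mulr_sumr.
rewrite exchange_big; apply: eq_big_seq => c /(cutb_forest fF) [f1 f2 sc].
under eq_bigr do rewrite mulr_sumr.
rewrite exchange_big; apply: eq_big_seq => d /(cutb_forest f1) [f3 f4 sd].
have mt : ((d.1, (d.2, c.2)) \in triples n) = indec d.2.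
  by rewrite mem_triples /tdeg /= f3 f2 sd sc sF eqxx /= andbT.
rewrite /on_indec -mt; case: ifP => tn.
  rewrite (bigD1_seq _ tn (uniq_triples n)) /= eqxx mulr1 big1 ?addr0 // => t /negbTE ->.
  by rewrite mulr0.
rewrite big1_seq // => t /andP [_ t1]; case: eqP => [E|]; rewrite ?mulr0 //.
by rewrite E tn in t1.
Qed.

(** The middle piece of a cut of [graft G F] is a product of a piece of [G] and a nonempty piece of
    [F]. If it is indecomposable, the piece of [G] is empty: [G] is cut into two pieces only, which
    enlarge the outer entries. *)
Lemma sum3_graft psi G F : forest G -> forest F -> G != [::] -> F != [::] ->
  sum3 (on_indec psi) (graft G F) =
  \sum_(c <- cutb true G)
     sum3 (on_indec (fun t => psi (graft c.1 t.1, (t.2.1, dot c.2 t.2.2)))) F.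
Proof.
move=> fG fF G0 F0; rewrite /sum3.
rewrite (big_cutt_graft fG fF (fun a b => \sum_(d <- cutb false a) on_indec psi d.1 d.2 b) (size_gt0 G0) (size_gt0 F0)).
apply: eq_big_seq => c cG; have [f1 f2 _] := cutb_forest fG cG; have c1 := cutt_neq0 cG.
apply: eq_big_seq => d dF; have [f3 f4 _] := cutb_forest fF dF; have d1 := cutt_neq0 dF.
rewrite (big_cutf_graft f1 f3 (fun a b => on_indec psi a b _) (size_gt0 c1) (size_gt0 d1)).
rewrite [X in _ + X]big1_seq ?addr0 => [|e /andP [_ eG]]; last first.
  have [_ f6 _] := cutb_forest f1 eG; have e0 := cutf_neq0 c1 eG.
  by rewrite /on_indec /indec fdec_graft ?andbF.
rewrite (bigID (fun e => e.2 == [::])) /= addrC big1_seq ?add0r => [|e /andP [e0 eG]]; last first.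
  have [_ f6 _] := cutb_forest f1 eG; rewrite big1_seq // => e' /andP [_ e'F].
  have [_ f7 _] := cutb_forest f3 e'F; have e'0 := cutf_neq0 d1 e'F.
  by rewrite /on_indec /indec fdec_dot ?andbF.
rewrite (big_cutt_nil2 f1 (fun a b => \sum_(e <- cutb false d.1) on_indec psi (graft a e.1) (dot b e.2) _) c1).
by apply: eq_bigr => e _; rewrite dot0f.
Qed.

Lemma sum3_dot psi G F : forest G -> forest F -> F != [::] ->
  sum3 (on_indec psi) (dot G F) =
  \sum_(c <- cuts G)
     sum3 (on_indec (fun t => psi (dot c.1 t.1, (t.2.1, dot c.2 t.2.2)))) F.
Proof.
move=> fG fF F0; rewrite /sum3.
rewrite (big_cutb_dot fG fF true (fun a b => \sum_(d <- cutb false a) on_indec psi d.1 d.2 b) (size_gt0 F0)).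
apply: eq_big_seq => c cG; have [f1 f2 _] := cuts_forest fG cG.
apply: eq_big_seq => d dF; have [f3 f4 _] := cutb_forest fF dF; have d1 := cutt_neq0 dF.
rewrite (big_cutb_dot f1 f3 false (fun a b => on_indec psi a b _) (size_gt0 d1)).
rewrite (bigID (fun e => e.2 == [::])) /= addrC big1_seq ?add0r => [|e /andP [e0 eG]]; last first.
  have [_ f6 _] := cuts_forest f1 eG; rewrite big1_seq // => e' /andP [_ e'F].
  have [_ f7 _] := cutb_forest f3 e'F; have e'0 := cutf_neq0 d1 e'F.
  by rewrite /on_indec /indec fdec_dot ?andbF.
rewrite (big_cuts_nil2 f1 (fun a b => \sum_(e <- cutb false d.1) on_indec psi (dot a e.1) (dot b e.2) _)).
by apply: eq_bigr => e _; rewrite dot0f.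
Qed.

Lemma beta_trivial p F : indec p -> forest F -> F != [::] ->
  beta ([::], (p, [::])) F = (F == p)%:R.
Proof.
move=> ip fF F0; rewrite betaE /sum3.
under eq_bigr => c _.
  under eq_bigr => d _ do rewrite !xpair_eqE.
  over.
rewrite (bigID (fun c => c.2 == [::])) /= addrC big1 ?add0r => [|c c0]; last first.
  by rewrite big1 // => d _; rewrite [_ == c.2]eq_sym (negbTE c0) !andbF.
rewrite (big_cutt_nil2 fF (fun a b => \sum_(d <- cutb false a) (([::] == d.1) && ((p == d.2) && ([::] == b)))%:R) F0).
rewrite (bigID (fun d => d.1 == [::])) /= addrC big1 ?add0r => [|d d0]; last first.
  by rewrite [_ == d.1]eq_sym (negbTE d0).
rewrite (big_cutf_nil1 fF (fun a b => (([::] == a) && ((p == b) && ([::] == [::])))%:R) F0).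
by rewrite eqxx andbT eq_sym.
Qed.

Definition triples_free n := forall psi,
  (forall F, F \in forests n -> \sum_(t <- triples n) beta t F * psi t = 0) ->
  forall t, t \in triples n -> psi t = 0.

Definition ntriples_free n := forall psi,
  (forall F, F \in forests n -> fdec F -> \sum_(t <- ntriples n) beta t F * psi t = 0) ->
  forall t, t \in ntriples n -> psi t = 0.

(** A combination of forests that isolates the value at [t], by [dual_family]. It will be applied to
    the second factor of a product. *)
Lemma triples_eval n t : triples_free n -> t \in triples n ->
  exists c : seq nat -> K, forall psi,
    \sum_(F <- forests n) c F * sum3 (on_indec psi) F = psi t.
Proof.
move=> fr tn.
have [c' Hc] := dual_family (uniq_forests n) (uniq_triples n) (B := fun F t => beta t F) fr.
exists (c' t) => psi; set c := c' t.
have {}Hc s : s \in triples n -> \sum_(F <- forests n) c F * beta s F = (t == s)%:R by exact: Hc.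
transitivity (\sum_(F <- forests n) \sum_(s <- triples n) psi s * (c F * beta s F)).
  apply: eq_big_seq => F; rewrite mem_forests => /andP [fF /eqP sF].
  by rewrite -(big_beta _ fF sF) mulr_sumr; apply: eq_bigr => s _; rewrite mulrCA.
rewrite exchange_big /= (bigD1_seq t tn (uniq_triples n)) /= -mulr_sumr Hc // eqxx mulr1.
rewrite big1_seq ?addr0 // => s /andP [st sn]; rewrite -mulr_sumr Hc //.
by rewrite eq_sym (negbTE st) mulr0.
Qed.

Lemma ntriples_free_step n : (forall m, (m < n)%N -> triples_free m) -> ntriples_free n.
Proof.
move=> IH psi0 H0.
(* Extension by zero to the trivial triples, so that the formulas for [sum3], which see all triples,
   apply. *)
pose psi (t : triple) := if (t.1 != [::]) || (t.2.2 != [::]) then psi0 t else 0.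
have H F : F \in forests n -> fdec F -> sum3 (on_indec psi) F = 0.
  move=> Fn dF; have := Fn; rewrite mem_forests => /andP [fF /eqP sF].
  rewrite -(big_beta _ fF sF) -[RHS](H0 F Fn dF) [RHS]big_filter [RHS]big_mkcond.
  by apply: eq_bigr => t _; rewrite /psi mulrC; case: ifP => _; rewrite ?mulr0.
suff key (t : triple) : t \in triples n -> (t.1 != [::]) || (t.2.2 != [::]) -> psi t = 0.
  by move=> t; rewrite mem_ntriples => /andP [nt /key /(_ nt)]; rewrite /psi nt.
(* For [k] nonempty, the relation is tested on the forests [graft k F] and [triples_eval] isolates
   [([::], (p, y))] in [F]. What remains is the sum of [psi (c.1, (p, dot c.2 y))] over the cuts of
   [k] with last vertex above; the terms with [c.2] nonempty have a smaller first entry and vanish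
   by induction. *)
have claim1 m (k p y : seq nat) : (size k <= m)%N -> k != [::] -> (k, (p, y)) \in triples n -> psi (k, (p, y)) = 0.
  elim: m k y => [|m IHm] k y; first by rewrite leqn0 size_eq0 => /eqP ->.
  move=> km k0; rewrite mem_triples /tdeg /= => /and4P [fk ip fy /eqP sn].
  have p0 := indec_size ip; have sk := size_gt0 k0.
  have t0 : ([::], (p, y)) \in triples (size p + size y) by rewrite mem_triples /tdeg /= ip fy eqxx.
  have [|c Hc] := triples_eval (IH _ _) t0; first lia.
  have E : \sum_(F <- forests (size p + size y)) c F * sum3 (on_indec psi) (graft k F) = 0.
    rewrite big1_seq // => F /andP [_]; rewrite mem_forests => /andP [fF /eqP sF].
    have F0 : F != [::] by apply: size_neq0; rewrite sF; lia.
    rewrite H ?mulr0 ?fdec_graft // mem_forests forest_graft //= size_graft sF; lia.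
  have {}E : \sum_(cc <- cutb true k) psi (cc.1, (p, dot cc.2 y)) = 0.
    rewrite -[RHS]E.
    transitivity (\sum_(cc <- cutb true k) \sum_(F <- forests (size p + size y)) c F *
      sum3 (on_indec (fun t => psi (graft cc.1 t.1, (t.2.1, dot cc.2 t.2.2)))) F).
      by apply: eq_bigr => cc _; rewrite Hc /= graftf0.
    rewrite exchange_big; apply: eq_big_seq => F; rewrite mem_forests => /andP [fF /eqP sF].
    have F0 : F != [::] by apply: size_neq0; rewrite sF; lia.
    by rewrite sum3_graft // mulr_sumr.
  rewrite -[RHS]E (bigID (fun cc => cc.2 == [::])) /= (big_cutt_nil2 fk (fun a b => psi (a, (p, dot b y))) k0).
  rewrite dot0f big1_seq ?addr0 // => cc /andP [cc0 ck].
  have [f1 f2 sc] := cutb_forest fk ck; have c1 := cutt_neq0 ck.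
  have IH' (a b : seq nat) : (size a + size b = size k)%N -> forest a -> forest b -> a != [::] ->
      b != [::] -> psi (a, (p, dot b y)) = 0.
    move=> sab fa fb a0 /size_gt0 b0; apply: IHm => //.
      by rewrite -ltnS (leq_trans _ km) // -sab -addn1 leq_add2l.
    by rewrite mem_triples /tdeg /= fa ip forest_dot //= size_dot addnACA addnA sab sn.
  exact: IH'.
(* For an empty first entry the test forests are [dot y F], with [([::], (p, [::]))] isolated in
   [F]. Among the cuts of [y], those with nonempty first part vanish by [claim1]. *)
case: t => k [p y] tn; case: (eqVneq k [::]) tn => [->|k0] tn nt; last exact: (claim1 (size k)).
move: nt => /= y0; have := tn; rewrite mem_triples /tdeg /= => /and3P [ip fy /eqP sn].
have p0 := indec_size ip; have sy := size_gt0 y0.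
have t0 : ([::], (p, [::])) \in triples (size p) by rewrite mem_triples /tdeg /= ip addn0 eqxx.
have [|c Hc] := triples_eval (IH _ _) t0; first lia.
have E : \sum_(F <- forests (size p)) c F * sum3 (on_indec psi) (dot y F) = 0.
  rewrite big1_seq // => F /andP [_]; rewrite mem_forests => /andP [fF /eqP sF].
  have F0 : F != [::] by apply: size_neq0; rewrite sF; lia.
  rewrite H ?mulr0 ?fdec_dot // mem_forests forest_dot //= size_dot sF; lia.
have {}E : \sum_(cc <- cuts y) psi (cc.1, (p, cc.2)) = 0.
  rewrite -[RHS]E.
  transitivity (\sum_(cc <- cuts y) \sum_(F <- forests (size p)) c F *
    sum3 (on_indec (fun t => psi (dot cc.1 t.1, (t.2.1, dot cc.2 t.2.2)))) F).
    by apply: eq_bigr => cc _; rewrite Hc /= !dotf0.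
  rewrite exchange_big; apply: eq_big_seq => F; rewrite mem_forests => /andP [fF /eqP sF].
  have F0 : F != [::] by apply: size_neq0; rewrite sF; lia.
  by rewrite sum3_dot // mulr_sumr.
rewrite -[RHS]E (bigID (fun cc => cc.1 == [::])) /= (big_cuts_nil1 fy (fun a b => psi (a, (p, b)))).
rewrite big1_seq ?addr0 // => cc /andP [cc0 cy].
have [f1 f2 sc] := cuts_forest fy cy.
have sp : (size cc.1 + size p + size cc.2 = n)%N by rewrite -sn -sc addnAC addnC.
by apply: (claim1 (size cc.1)) => //; rewrite mem_triples /tdeg /= f1 ip f2 /=; apply/eqP.
Qed.

(** A trivial triple [([::], (p, [::]))] gives the indicator of [p], which vanishes on decomposable
    forests. So the nontrivial coefficients are killed first, and evaluation at [p] kills the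
    others. *)
Lemma triples_free_step n : (0 < n)%N -> ntriples_free n -> triples_free n.
Proof.
move=> n0 fr psi H.
have nt : forall t, t \in ntriples n -> psi t = 0.
  apply: fr => F Fn dF; have := Fn; rewrite mem_forests => /andP [fF /eqP sF].
  have F0 : F != [::] by apply: size_neq0; rewrite sF; lia.
  rewrite -[RHS](H F Fn) big_filter big_mkcond; apply: eq_big_seq => -[x [p y]].
  rewrite mem_triples /= => /and4P [_ ip _ _].
  case: eqP => [->|] //; case: eqP => [->|] //=; rewrite beta_trivial //.
  by case: eqP ip => [<-|]; rewrite ?mul0r // /indec dF !andbF.
case=> x [p y] tn; case nt0 : ((x != [::]) || (y != [::])).
  by apply: nt; rewrite mem_ntriples tn /= nt0.
move: nt0 tn => /negbT; rewrite negb_or !negbK => /andP [/eqP -> /eqP ->].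
move=> tn; have := tn; rewrite mem_triples /tdeg /= addn0 add0n => /andP [ip /eqP sp].
have pn : p \in forests n by rewrite mem_forests indec_forest //= sp.
rewrite -[RHS](H p pn) (bigD1_seq _ tn (uniq_triples n)) /=.
rewrite beta_trivial ?indec_forest ?indec_neq0 // eqxx mul1r big1_seq ?addr0 //.
case=> x' [p' y'] /andP [ne t'n]; case nt0 : ((x' != [::]) || (y' != [::])).
  by rewrite nt ?mulr0 // mem_ntriples t'n /= nt0.
move: nt0 ne t'n => /negbT; rewrite negb_or !negbK => /andP [/eqP -> /eqP ->] ne.
rewrite mem_triples /= => /andP [ip' _].
rewrite beta_trivial ?indec_forest ?indec_neq0 //; move: ne.
by rewrite !xpair_eqE /= andbT eq_sym => /negbTE ->; rewrite mul0r.
Qed.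

Lemma triples_free_all n : triples_free n.
Proof.
move: {2}n (leqnn n) => m; elim: m n => [|m IH] n.
  rewrite leqn0 => /eqP -> psi _ [x [p y]]; rewrite mem_triples /tdeg /= => /and4P [_ /indec_size p0 _ /eqP]; lia.
move=> nm; case: (posnP n) => [->|n0]; last first.
  by apply: triples_free_step => //; apply: ntriples_free_step => k kn; apply: IH; lia.
by apply: IH.
Qed.

Lemma ntriples_free_all n : ntriples_free n.
Proof. by apply: ntriples_free_step => m _; apply: triples_free_all. Qed.
End ForestTriples.

Definition decs n := [seq F <- forests n | fdec F].
Definition indecs n := [seq F <- forests n | ~~ fdec F].

Lemma uniq_decs n : uniq (decs n). Proof. exact/filter_uniq/uniq_forests. Qed.
Lemma uniq_indecs n : uniq (indecs n). Proof. exact/filter_uniq/uniq_forests. Qed.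
Lemma mem_decs n (F : seq nat) : (F \in decs n) = [&& fdec F, forest F & size F == n].
Proof. by rewrite mem_filter mem_forests. Qed.
Lemma mem_indecs n (F : seq nat) : (F \in indecs n) = [&& ~~ fdec F, forest F & size F == n].
Proof. by rewrite mem_filter mem_forests. Qed.

Lemma size_decs_indecs n : size (decs n) + size (indecs n) = size (forests n).
Proof. by rewrite (size_filter fdec) (size_filter (predC fdec)) count_predC. Qed.

Lemma indec_not_dec F : indec F -> ~~ fdec F. Proof. by case/and3P. Qed.

(** Independence of the [beta t] on decomposable forests, over some field such as [rat], gives one
    inequality, and surjectivity of [of_triple] the other. *)
Lemma size_ntriples n : size (ntriples n) = size (decs n).
Proof.
apply/eqP; rewrite eqn_leq; apply/andP; split.
  apply: (@injective_family_size rat _ _ _ _ (fun F t => beta rat t F) (uniq_decs n) (uniq_ntriples n)).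
  move=> psi H; apply: ntriples_free_all => F; rewrite mem_forests => /andP [fF sF] dF.
  by apply: H; rewrite mem_decs dF fF.
rewrite -(size_map of_triple); apply: (uniq_leq_size (uniq_decs n)) => F.
rewrite mem_decs => /and3P [dF fF /eqP sF].
have F0 : F != [::] by case: (F) dF.
have [t tn E] := of_triple_onto fF F0; apply/mapP; exists t => //.
rewrite mem_ntriples -sF tn andbT; case: t tn E => x [p y] /=; rewrite mem_triples => /and4P [_ ip _ _] E.
rewrite -negb_and; apply/negP => /andP [/eqP x0 /eqP y0].
by move: (indec_not_dec ip); rewrite E /of_triple x0 y0 /= dot0f in dF; rewrite dF.
Qed.

Lemma size_triples n : 0 < n -> size (triples n) = size (forests n).
Proof.
move=> n0; rewrite -size_decs_indecs -size_ntriples.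
rewrite -(count_predC (fun t : triple => (t.1 != [::]) || (t.2.2 != [::])) (triples n)) size_filter.
congr (_ + _); rewrite -size_filter -(size_map (fun p => ([::], (p, [::])) : triple)).
apply/perm_size/uniq_perm; first exact/filter_uniq/uniq_triples.
  by rewrite map_inj_uniq ?uniq_indecs // => p q [].
case=> x [p y]; rewrite mem_filter /= negb_or !negbK mem_triples /tdeg /=; apply/idP/mapP => [|[q]].
  case/and5P => /andP [/eqP -> /eqP ->] _ ip _; rewrite addn0 => sp.
  by exists p => //; rewrite mem_indecs indec_not_dec ?indec_forest.
rewrite mem_indecs => /and3P [dq fq sq] [-> -> ->]; rewrite /indec fq dq !andbT addn0 /= add0n sq andbT.
by apply: size_neq0; rewrite (eqP sq).
Qed.

(** * Uniqueness of factorizations *)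

Lemma forest_dotr F J : forest (dot F J) -> forest J.
Proof.
case/forestP => H N; have sz := size_dot F J.
have Hle v : par J v <= size J.
  case: v => // v; have := H (size F + v.+1); rewrite par_dotr // sz.
  by case: eqP => [-> //|_]; rewrite leq_add2l.
apply/forestP; split => // -[|w]; first by exists 0.
have [k] := N (size F + w.+1); move: (ltn0Sn w); elim: k w.+1 => [|k IH] x x0.
  by move=> /= E; lia.
rewrite iterSr par_dotr //; case: (posnP (par J x)) => [px _|px].
  by exists 1.
by move=> /(IH _ px) [j jE]; exists j.+1; rewrite iterSr.
Qed.

Lemma forest_graftr F J : forest (graft F J) -> forest J.
Proof.
case/forestP => H N; have sz := size_graft F J.
have Hle v : par J v <= size J.
  case: (posnP v) => [-> //|v0]; case: (leqP v (size J)) => vJ; last by rewrite par_default.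
  by have := H (size F + v); rewrite par_graftr ?v0 // sz leq_add2l.
apply/forestP; split => // -[|w]; first by exists 0.
have [k] := N (size F + w.+1); move: (ltn0Sn w); elim: k w.+1 => [|k IH] x x0.
  by move=> /= E; lia.
case: (leqP x (size J)) => xJ; last by exists 1; rewrite /= par_default.
rewrite iterSr par_graftr ?x0 //; case: (posnP (par J x)) => [px _|px].
  by exists 1.
by move=> /(IH _ px) [j jE]; exists j.+1; rewrite iterSr.
Qed.

Lemma cat_eq_split (A B C D : seq nat) : A ++ B = C ++ D -> size C <= size A ->
  A = C ++ take (size A - size C) D /\ B = drop (size A - size C) D.
Proof.
move=> E sCA; have := congr1 (take (size A)) E; have := congr1 (drop (size A)) E.
rewrite drop_size_cat // take_size_cat // drop_cat take_cat ltnNge sCA /=.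
by [].
Qed.

Lemma map_shiftK k (H : seq nat) :
  map (subn^~ k) [seq (if x == 0 then 0 else k + x) | x <- H] = H.
Proof.
rewrite -map_comp -[RHS]map_id; apply: eq_map => x /=.
by case: eqP => [->|_]; rewrite ?sub0n ?addKn.
Qed.

Lemma map_addK k (H : seq nat) : map (subn^~ k) [seq k + x | x <- H] = H.
Proof. by rewrite -map_comp -[RHS]map_id; apply: eq_map => x /=; rewrite addKn. Qed.

Section Factorizations.
Variables G H G' H' : seq nat.
Hypotheses (fG : forest G) (lt : size G' < size G).
Let l := size G - size G'.

Let wit (J : seq nat) : J = take l H' -> size J = l -> J != [::].
Proof. by move=> _ sJ; apply: size_neq0; rewrite sJ subn_gt0. Qed.

(** The witness [J] is the part of the forest on the vertices after [G'] and within [G]. The same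
    choice refines the two other coincidences of products below. *)
Lemma dot_dot_factor : dot G H = dot G' H' ->
  exists J, [/\ forest J, J != [::], G = dot G' J & H' = dot J H].
Proof.
move=> E; have [E1 E2] := cat_eq_split E (ltnW lt); rewrite -map_take -map_drop -/l in E1 E2.
have sJ : size (take l H') = l.
  by move/(congr1 size): (E1); rewrite size_cat size_map => sG; rewrite -[LHS](addKn (size G')) -sG.
exists (take l H'); split; first by apply: (@forest_dotr G'); rewrite /dot -E1.
- exact: wit.
- exact: E1.
rewrite -[LHS](cat_take_drop l) /dot; congr (_ ++ _).
rewrite -(map_shiftK (size G') (drop l H')) -E2 -map_comp; apply: eq_map => x /=.
by case: eqP => // _; rewrite sJ -addnBAC // ltnW.
Qed.

Lemma graft_dot_factor : graft G H = dot G' H' ->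
  exists J, [/\ forest J, J != [::], G = dot G' J & H' = graft J H].
Proof.
move=> E; have [E1 E2] := cat_eq_split E (ltnW lt); rewrite -map_take -map_drop -/l in E1 E2.
have sJ : size (take l H') = l.
  by move/(congr1 size): (E1); rewrite size_cat size_map => sG; rewrite -[LHS](addKn (size G')) -sG.
exists (take l H'); split; first by apply: (@forest_dotr G'); rewrite /dot -E1.
- exact: wit.
- exact: E1.
rewrite -[LHS](cat_take_drop l) /graft; congr (_ ++ _).
rewrite -(map_shiftK (size G') (drop l H')) -E2 -map_comp; apply: eq_map => x /=.
by rewrite sJ -addnBAC // ltnW.
Qed.

Lemma graft_graft_factor : graft G H = graft G' H' ->
  exists J, [/\ forest J, J != [::], G = graft G' J & H' = graft J H].
Proof.
move=> E; have [E1 E2] := cat_eq_split E (ltnW lt); rewrite -map_take -map_drop -/l in E1 E2.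
have sJ : size (take l H') = l.
  by move/(congr1 size): (E1); rewrite size_cat size_map => sG; rewrite -[LHS](addKn (size G')) -sG.
exists (take l H'); split; first by apply: (@forest_graftr G'); rewrite /graft -E1.
- exact: wit.
- exact: E1.
rewrite -[LHS](cat_take_drop l) /graft; congr (_ ++ _).
rewrite -(map_addK (size G') (drop l H')) -E2 -map_comp; apply: eq_map => x /=.
by rewrite sJ -addnBAC // ltnW.
Qed.
End Factorizations.

(** If [G] were not longer than [G'], every root of [H'] would lie in the grafted part of
    [graft G H], where no vertex is a root because [G] is nonempty. *)
Lemma graft_dot_size (G H G' H' : seq nat) : forest H' -> H' != [::] -> G != [::] ->
  graft G H = dot G' H' -> size G' < size G.
Proof.
move=> fH' H'0 G0 E; rewrite ltnNge; apply/negP => le.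
have [|||r rH pr] := @forest_has_root _ fH' (iota 1 (size H')).
- by case: (H') H'0.
- by [].
- move=> v; rewrite mem_iota add1n ltnS => /andP [v0 vH].
  case: (posnP (par H' v)) => pv; [by right | left].
  by rewrite mem_iota add1n ltnS pv forest_par_le.
have sz := congr1 size E; rewrite size_graft size_dot in sz.
move: rH; rewrite mem_iota add1n ltnS => /andP [r0 rH].
have : par (dot G' H') (size G' + r) = 0 by rewrite par_dotr // pr.
rewrite -E; have -> : size G' + r = size G + (size G' - size G + r) by lia.
by rewrite par_graftr; have := size_gt0 G0; lia.
Qed.

(** * The word condition attached to the graft *)

Definition leftcond i (w : seq nat) := all (leq (last 0 (take i w))) (drop i w).

Lemma mixable_masks s (u v : seq nat) : size s = size u + size v -> count id s = size u -> mixable s u v.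
Proof.
by move=> sz cs; rewrite /mixable cs eqxx -(eqn_add2l (count id s)) count_predC sz cs eqxx.
Qed.

Lemma last_mix s (u v : seq nat) : mixable s u v -> s != [::] ->
  last 0 (mix s u v) = if last false s then last 0 u else last 0 v.
Proof.
case/lastP: s => // s b /andP []; rewrite -cats1 !count_cat /= !addn0 => /eqP su /eqP sv _.
rewrite mix_cat !last_cat /=; case: b su sv => /=; rewrite ?addn1 ?addn0 => su sv.
  by rewrite -nth0 nth_drop addn0 -nth_last -su.
by rewrite -nth0 nth_drop addn0 -nth_last -sv.
Qed.

Lemma all_mix (p : pred nat) s (u v : seq nat) : mixable s u v ->
  all p (mix s u v) = all p u && all p v.
Proof. by move=> m; rewrite (perm_all _ (perm_mix m)) all_cat. Qed.

Section LeftcondMix.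
Variables (s t : bitseq) (u v : seq nat) (N : nat).
Hypotheses (uw : is_word u) (vw : is_word v) (m : mixable (s ++ t) u v)
  (uN : all (fun x => x <= N) u).
Let i := size s.
Let w := mix (s ++ t) u (map (addn N) v).
Hypothesis s0 : s != [::].

Let c := count id s.
Let c' := count negb s.
Let cu : c <= size u.
Proof. by case/andP: m; rewrite count_cat => /eqP <- _; apply: leq_addr. Qed.
Let cv : c' <= size v.
Proof. by case/andP: m => _; rewrite count_cat => /eqP <-; apply: leq_addr. Qed.
Let ms : mixable s (take c u) (take c' (map (addn N) v)).
Proof. by rewrite /mixable !size_take_min size_map !(minn_idPl _) // !eqxx. Qed.
Let mt : mixable t (drop c u) (drop c' (map (addn N) v)).
Proof.
case/andP: m; rewrite !count_cat => /eqP su /eqP sv.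
by rewrite /mixable !size_drop size_map -su -sv !addKn !eqxx.
Qed.

Lemma take_mix : take i w = mix s (take c u) (take c' (map (addn N) v)).
Proof. by rewrite /w mix_cat take_size_cat ?size_mix. Qed.

Lemma drop_mix : drop i w = mix t (drop c u) (drop c' (map (addn N) v)).
Proof. by rewrite /w mix_cat drop_size_cat ?size_mix. Qed.

Let last_take_in (r : seq nat) k : 0 < k -> k <= size r -> last 0 (take k r) \in r.
Proof.
move=> k0 kr; suff: last 0 (take k r) \in take k r by exact: mem_take.
have : size (take k r) = k by rewrite size_take_min (minn_idPl kr).
by case: (take k r) => [E|x q _]; [rewrite -E in k0 | apply: mem_last].
Qed.

(** The last letter of the prefix comes from [u], and every letter of [v] is shifted above it: only
    the letters of [u] matter. *)
Lemma leftcond_mix_left : last false s -> leftcond i w = leftcond c u.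
Proof.
move=> ls; rewrite /leftcond take_mix drop_mix.
rewrite (last_mix ms) // ls all_mix // -[RHS]andbT; congr (_ && _).
rewrite -map_drop all_map; apply/allP => y yv /=.
have c0 : 0 < c.
  by rewrite -has_count; apply/hasP; exists true => //; move: ls; case: (s) s0 => //= b r _ <-; apply: mem_last.
have := allP uN _ (last_take_in c0 cu); lia.
Qed.

(** The last letter of the prefix exceeds [N], so no letter of [u] can follow. This is the word
    counterpart of [G] following the last vertex of [F] into the [Lea] part, see [uncut_graft]. *)
Lemma leftcond_mix_right : ~~ last false s -> leftcond i w = (count id t == 0) && leftcond c' v.
Proof.
move=> ls; rewrite /leftcond take_mix drop_mix.
rewrite (last_mix ms) // (negbTE ls) all_mix //.
have c0 : 0 < c'.
  by rewrite -has_count; apply/hasP; exists false => //; move: ls; case: (s) s0 => //= b r _ /negbTE <-; apply: mem_last.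
have -> : last 0 (take c' (map (addn N) v)) = N + last 0 (take c' v).
  rewrite -map_take; have : size (take c' v) = c' by rewrite size_take_min (minn_idPl cv).
  by case: (take c' v) => [E|x q _ /=]; [rewrite -E in c0 | apply: last_map].
have y0 := allP vw _ (last_take_in c0 cv).
congr (_ && _); last by rewrite -map_drop all_map; apply: eq_all => y /=; rewrite leq_add2l.
have -> : count id t = size (drop c u) by case/andP: mt => /eqP.
case E : (drop c u) => [|x r] //=; apply/negbTE/negP => /andP [le _].
have : x \in u.
  have: x \in drop c u by rewrite E mem_head.
  exact: mem_drop.
by move/(allP uN); lia.
Qed.
End LeftcondMix.

(** * Pairings of forests and words *)

Lemma big_partition_nat (K : nmodType) (I : eqType) (r : seq I) (P : pred I) (k : I -> nat) n (F : I -> K) :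
  (forall x, x \in r -> k x <= n) ->
  (\sum_(x <- r | P x) F x = \sum_(l <- iota 0 n.+1) \sum_(x <- r | P x && (k x == l)) F x)%R.
Proof.
move=> H; transitivity (\sum_(x <- r | P x) \sum_(l <- iota 0 n.+1) (if k x == l then F x else 0))%R.
  rewrite big_seq_cond [RHS]big_seq_cond; apply: eq_bigr => x /andP [xr _].
  rewrite (bigD1_seq (k x)) ?iota_uniq ?mem_iota0 ?H // eqxx big1 => [|l].
    by rewrite [RHS]addr0.
  by rewrite eq_sym => /negbTE ->.
by rewrite exchange_big; apply: eq_bigr => l _; rewrite big_mkcondr.
Qed.

(* Beyond such a gap parkization does not depend on the size of the shift: the
   letters [N + y] behave as those of a larger alphabet. *)
Definition far (u : seq nat) N := all (fun x => x + size u <= N) u.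

Lemma far_le u N : far u N -> all (fun x => x <= N) u.
Proof. by apply: sub_all => x; lia. Qed.

Lemma far_gap u N y : is_word u -> far u N -> y <= N -> size u <= cle u y + (N - y).
Proof.
move=> uw uN yN; case: (leqP (y + size u) N) => H; first lia.
have -> : cle u y = size u.
  by apply/eqP; rewrite /cle -all_count; apply: sub_all uN => x; lia.
lia.
Qed.

Lemma far_mask m u N : far u N -> far (mask m u) N.
Proof.
move=> /allP uN; apply/allP => x xm; apply: leq_trans (uN x (mem_mask xm)).
by rewrite leq_add2l; apply: size_subseq (mask_subseq m u).
Qed.

Lemma far_take l u N : far u N -> far (take l u) N.
Proof. by rewrite take_mask; apply: far_mask. Qed.
Lemma far_drop l u N : far u N -> far (drop l u) N.
Proof. by rewrite drop_mask; apply: far_mask. Qed.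

Lemma take_word l u : is_word u -> is_word (take l u).
Proof. by rewrite take_mask; apply: mask_word. Qed.
Lemma drop_word l u : is_word u -> is_word (drop l u).
Proof. by rewrite drop_mask; apply: mask_word. Qed.

Section Pairings.
Variables (K : fieldType) (M : seq nat -> seq nat -> K).
Local Open Scope ring_scope.

Definition graded n := forall F w, forest F -> (size F <= n)%N -> is_word w ->
  size w <> size F -> M F w = 0.
Definition park_invariant n := forall F w, forest F -> (size F <= n)%N -> is_word w ->
  M F (park w) = M F w.

Definition dot_at F G := forall w, is_word w ->
  M (dot F G) w = M F (take (size F) w) * M G (drop (size F) w).
Definition graft_at F G := forall w, is_word w ->
  M (graft F G) w = (leftcond (size F) w)%:R * (M F (take (size F) w) * M G (drop (size F) w)).

(** Compatibility with the split coproducts read on coefficients: on the right are the shifted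
    shuffles whose last letter comes from [u] exactly when [b] holds. *)
Definition cut_at F := forall b u v, is_parking u -> is_parking v -> (size u + size v = size F)%N ->
  \sum_(c <- cutb b F) M c.1 u * M c.2 v =
  \sum_(s <- masks (size F) | (count id s == size u) && (last false s == b))
     M F (mix s u (map (addn (size u)) v)).

(** Version for arbitrary words, with a shift unrelated to the sizes: products cut [u] and [v] into
    prefixes and suffixes, which need not be parking functions and must all be shifted by the same
    amount. The two versions are exchanged by [park_mix]. *)
Definition cutw_at b F N := forall u v, is_word u -> is_word v -> (size u + size v = size F)%N -> far u N ->
  \sum_(c <- cutb b F) M c.1 u * M c.2 v =
  \sum_(s <- masks (size F) | (count id s == size u) && (last false s == b))
     M F (mix s u (map (addn N) v)).

Lemma cut_at_words n F : park_invariant n -> forest F -> (size F <= n)%N -> cut_at F ->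
  forall b N, cutw_at b F N.
Proof.
move=> inv fF sF cF b N u v uw vw suv uN.
transitivity (\sum_(c <- cutb b F) M c.1 (park u) * M c.2 (park v)).
  apply: eq_big_seq => c cF'; have [f1 f2 sc] := cutb_forest fF cF'.
  by rewrite !inv //; apply: leq_trans sF; rewrite -sc ?leq_addr ?leq_addl.
rewrite cF ?park_parking ?size_park // big_seq_cond [RHS]big_seq_cond.
apply: eq_bigr => s /andP [sm /andP [/eqP cs _]].
have ms : mixable s u v by apply: mixable_masks => //; move: sm; rewrite mem_masks suv => /eqP.
have gap y : (y <= N)%N -> (size u <= cle u y + (N - y))%N by exact: far_gap.
by rewrite -(park_mix uw vw ms (far_le uN) gap) inv // mix_word ?far_le.
Qed.

Lemma words_cut_at n F : park_invariant n -> forest F -> (size F <= n)%N ->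
  (forall b N, cutw_at b F N) -> cut_at F.
Proof.
move=> inv fF sF cF b u v pu pv suv; have uw := parking_word pu; have vw := parking_word pv.
have uN : far u (size u + size u).
  by apply: sub_all (parking_le pu) => x; rewrite leq_add2r.
rewrite (cF b _ u v uw vw suv uN) big_seq_cond [RHS]big_seq_cond.
apply: eq_bigr => s /andP [sm /andP [/eqP cs _]].
have ms : mixable s u v by apply: mixable_masks => //; move: sm; rewrite mem_masks suv => /eqP.
have gap y : (y <= size u + size u)%N -> (size u <= cle u y + (size u + size u - y))%N by exact: far_gap.
have gap' y : (y <= size u)%N -> (size u <= cle u y + (size u - y))%N.
  by move=> yu; have := parking_cle pu yu; lia.
rewrite -inv ?mix_word ?far_le // (park_mix uw vw ms (far_le uN) gap).
by rewrite -(park_mix uw vw ms (parking_le pu) gap') inv // mix_word ?parking_le.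
Qed.

Section Convolution.
Variables (n i j : nat) (G H : seq nat) (cG cH : seq (seq nat * seq nat)) (p1 p2 : pred bitseq).
Variables (kappa : nat -> K) (u v : seq nat) (N : nat).
Hypotheses (gr : graded n) (ile : (i <= n)%N).
Hypothesis cGP : forall c, c \in cG -> [/\ forest c.1, forest c.2 & (size c.1 + size c.2 = i)%N].
Hypothesis hG : forall u' v', is_word u' -> is_word v' -> (size u' + size v' = i)%N -> far u' N ->
  \sum_(c <- cG) M c.1 u' * M c.2 v' =
  \sum_(s <- masks i | (count id s == size u') && p1 s) M G (mix s u' (map (addn N) v')).
Hypothesis hH : forall u' v', is_word u' -> is_word v' -> (size u' + size v' = j)%N -> far u' N ->
  \sum_(d <- cH) M d.1 u' * M d.2 v' =
  \sum_(t <- masks j | (count id t == size u') && p2 t) M H (mix t u' (map (addn N) v')).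
Hypotheses (uw : is_word u) (vw : is_word v) (suv : (size u + size v = i + j)%N) (uN : far u N).

(** Both sides are sorted by [l], the size of [c.1] and the number of letters of [u] in the first
    part of the shuffle: it fixes where [u] and [v] are cut, and the hypotheses on [G] and [H] then
    apply to the pieces. The weight [kappa] will carry the graft condition, which depends on [l]
    only. *)
Lemma convolution :
  \sum_(c <- cG) \sum_(d <- cH) kappa (size c.1) *
     ((M c.1 (take (size c.1) u) * M d.1 (drop (size c.1) u)) *
      (M c.2 (take (size c.2) v) * M d.2 (drop (size c.2) v))) =
  \sum_(s <- masks i | p1 s) \sum_(t <- masks j | (count id (s ++ t) == size u) && p2 t)
     kappa (count id s) * (M G (take i (mix (s ++ t) u (map (addn N) v))) *
                           M H (drop i (mix (s ++ t) u (map (addn N) v)))).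
Proof.
rewrite (@big_partition_nat _ _ cG xpredT (fun c => size c.1) i) => [|c /cGP [_ _ <-]]; last exact: leq_addr.
rewrite [RHS](@big_partition_nat _ _ _ _ (fun s => count id s) i) => [|s]; last first.
  by rewrite mem_masks => /eqP <-; apply: count_size.
apply: eq_big_seq => l; rewrite mem_iota0 => li.
transitivity (\sum_(c <- cG | size c.1 == l) kappa l *
   ((M c.1 (take l u) * M c.2 (take (i - l) v)) * \sum_(d <- cH) M d.1 (drop l u) * M d.2 (drop (i - l) v))).
  rewrite big_seq_cond [RHS]big_seq_cond; apply: eq_bigr => c /andP [/cGP [_ _ sc] /eqP sl].
  have s2 : size c.2 = (i - l)%N by rewrite -sc sl addKn.
  rewrite sl s2 -mulr_sumr; congr (_ * _); rewrite mulr_sumr; apply: eq_bigr => d _.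
  by rewrite mulrACA.
rewrite -mulr_sumr -mulr_suml.
(* If [u] or [v] is too short for this [l], the left side vanishes by the grading and no mask on the
   right has the required counts. *)
case: (boolP ((l <= size u) && (i - l <= size v))%N) => [/andP [lu lv]|nlu]; last first.
  rewrite big1_seq => [|c /andP [/eqP sl /cGP [f1 f2 sc]]]; last first.
    have s2 : size c.2 = (i - l)%N by rewrite -sc sl addKn.
    have c1n : (size c.1 <= n)%N by apply: leq_trans ile; rewrite -sc leq_addr.
    have c2n : (size c.2 <= n)%N by apply: leq_trans ile; rewrite -sc leq_addl.
    move: nlu; rewrite negb_and -!ltnNge => /orP [lt|lt].
      by rewrite (gr f1) ?mul0r ?take_word // sl size_take_min; lia.
    by rewrite (gr f2) ?mulr0 ?take_word // s2 size_take_min; lia.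
  rewrite mul0r mulr0 big1_seq // => s /andP [/andP [_ /eqP cs]]; rewrite mem_masks => /eqP ss.
  rewrite big1_seq // => t /andP [/andP [/eqP ct _]]; rewrite mem_masks => /eqP st.
  case/negP: nlu; rewrite -ct count_cat cs leq_addr /=.
  have := count_predC id (s ++ t); rewrite size_cat ss st -suv -ct => /addnI.
  rewrite count_cat => <-; have := count_predC id s; rewrite cs ss => <-.
  by rewrite addKn leq_addr.
have stu : size (take l u) = l by rewrite size_take_min (minn_idPl lu).
have stv : size (take (i - l) v) = (i - l)%N by rewrite size_take_min (minn_idPl lv).
have -> : \sum_(c <- cG | size c.1 == l) M c.1 (take l u) * M c.2 (take (i - l) v) =
          \sum_(c <- cG) M c.1 (take l u) * M c.2 (take (i - l) v).
  rewrite big_mkcond; apply: eq_big_seq => c /cGP [f1 f2 sc]; case: eqP => // sl.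
  have c1n : (size c.1 <= n)%N by apply: leq_trans ile; rewrite -sc leq_addr.
  by rewrite (gr f1) ?mul0r ?take_word // stu => E; apply: sl.
rewrite hG ?take_word ?far_take ?stu ?stv ?subnKC //.
rewrite hH ?drop_word ?far_drop ?size_drop //; last by lia.
rewrite big_distrlr mulr_sumr /= big_seq_cond [RHS]big_seq_cond.
have E s : s \in masks i -> (count id s == l) -> count negb s = (i - l)%N.
  by rewrite mem_masks => /eqP <- /eqP <-; rewrite -(count_predC id s) addKn.
apply: eq_big => [s|s /and3P [sm /eqP cs _]]; first by congr (_ && _); apply: andbC.
rewrite mulr_sumr; apply: eq_big => [t|t /andP [/eqP ct _]].
  by rewrite count_cat cs; congr (_ && _); apply/eqP/eqP; lia.
have cn := E s sm (introT eqP cs).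
have ss : size s = i by move: sm; rewrite mem_masks => /eqP.
rewrite cs mix_cat cs cn take_size_cat ?size_mix // drop_size_cat ?size_mix //.
by rewrite -map_take -map_drop.
Qed.
End Convolution.
End Pairings.

Lemma nseq_count0 (t : bitseq) : (count id t == 0) = (t == nseq (size t) false).
Proof. by elim: t => //= -[] t IH; rewrite ?add0n ?IH. Qed.

Lemma nseq_count_size (t : bitseq) : (count id t == size t) = (t == nseq (size t) true).
Proof.
elim: t => //= -[] t IH; first by rewrite add1n eqSS IH.
by rewrite add0n; apply/negbTE/negP => /eqP E; have := count_size id t; rewrite E ltnn.
Qed.

Lemma mix_nseq_false k (u v : seq nat) : size v = k -> mix (nseq k false) u v = v.
Proof. by elim: k v => [|k IH] [|x v] //= [/IH ->]. Qed.
Lemma mix_nseq_true k (u v : seq nat) : size u = k -> mix (nseq k true) u v = u.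
Proof. by elim: k u => [|k IH] [|x u] //= [/IH ->]. Qed.

Section MaskSums.
Variable K : nmodType.
Local Open Scope ring_scope.

Lemma big_masks_addP i j (C : pred bitseq) (f : bitseq -> K) :
  \sum_(s <- masks (i + j) | C s) f s =
  \sum_(s <- masks i) \sum_(t <- masks j | C (s ++ t)) f (s ++ t).
Proof.
rewrite big_mkcond big_masks_add; apply: eq_bigr => s _.
by rewrite [RHS]big_mkcond.
Qed.

Lemma big_masks_none j (P : pred bitseq) (f : bitseq -> K) :
  \sum_(t <- masks j | (count id t == 0%N) && P t) f t =
  if P (nseq j false) then f (nseq j false) else 0.
Proof.
rewrite big_mkcond (bigD1_seq (nseq j false)) ?uniq_masks ?mem_masks ?size_nseq //=.
rewrite nseq_count0 size_nseq eqxx /= big1_seq ?addr0 // => t /andP [tn].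
by rewrite mem_masks nseq_count0 => /eqP ->; rewrite (negbTE tn).
Qed.

Lemma big_masks_all j (P : pred bitseq) (f : bitseq -> K) :
  \sum_(t <- masks j | (count id t == j) && P t) f t =
  if P (nseq j true) then f (nseq j true) else 0.
Proof.
rewrite big_mkcond (bigD1_seq (nseq j true)) ?uniq_masks ?mem_masks ?size_nseq //=.
have := nseq_count_size (nseq j true); rewrite size_nseq eqxx => -> /=.
rewrite big1_seq ?addr0 // => t /andP [tn].
by rewrite mem_masks => /eqP E; have := nseq_count_size t; rewrite E (negbTE tn) => ->.
Qed.
End MaskSums.

Lemma last_cat_mask j (s t : bitseq) : 0 < j -> t \in masks j -> last false (s ++ t) = last false t.
Proof. by rewrite mem_masks last_cat; case: t => // j0 /eqP E; rewrite -E in j0. Qed.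

(** * Products inherit compatibility with cuts *)

Section ProductCuts.
Variables (K : fieldType) (M : seq nat -> seq nat -> K) (n : nat).
Local Open Scope ring_scope.
Hypotheses (gr : graded M n) (inv : park_invariant M n) (M1 : M [::] [::] = 1).
Variables (G H : seq nat).
Hypotheses (fG : forest G) (fH : forest H) (G0 : G != [::]) (H0 : H != [::]).
Let i := size G.
Let j := size H.
Hypothesis ijn : (i + j <= n)%N.
Hypothesis hdot : forall X Y, forest X -> forest Y -> (size X + size Y <= n)%N -> dot_at M X Y.
Hypothesis hgraft : forall X Y, forest X -> forest Y -> X != [::] -> (size X + size Y <= n)%N -> graft_at M X Y.
Hypotheses (cG : cut_at M G) (cH : cut_at M H).

Let iN : (i <= n)%N. Proof. exact: leq_trans (leq_addr _ _) ijn. Qed.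
Let jN : (j <= n)%N. Proof. exact: leq_trans (leq_addl _ _) ijn. Qed.
Let i0 : (0 < i)%N. Proof. exact: size_gt0. Qed.
Let j0 : (0 < j)%N. Proof. exact: size_gt0. Qed.

Let cGw b N : cutw_at M b G N. Proof. exact: cut_at_words inv fG iN cG b N. Qed.
Let cHw b N : cutw_at M b H N. Proof. exact: cut_at_words inv fH jN cH b N. Qed.

Section Words.
Variables (b : bool) (u v : seq nat) (N : nat).
Hypotheses (uw : is_word u) (vw : is_word v) (suv : (size u + size v = i + j)%N) (uN : far u N).

Let mixw s t : s \in masks i -> t \in masks j -> count id (s ++ t) = size u ->
  mixable (s ++ t) u v.
Proof.
rewrite !mem_masks => /eqP si /eqP tj cu; apply: mixable_masks => //.
by rewrite size_cat si tj suv.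
Qed.

Lemma cutw_dot_words :
  \sum_(c <- cutb b (dot G H)) M c.1 u * M c.2 v =
  \sum_(s <- masks (i + j) | (count id s == size u) && (last false s == b))
     M (dot G H) (mix s u (map (addn N) v)).
Proof.
rewrite (big_cutb_dot fG fH b (fun c1 c2 => M c1 u * M c2 v) j0).
have hG' u' v' : is_word u' -> is_word v' -> (size u' + size v' = i)%N -> far u' N ->
  \sum_(c <- cuts G) M c.1 u' * M c.2 v' =
  \sum_(s <- masks i | (count id s == size u') && predT s) M G (mix s u' (map (addn N) v')).
  move=> uw' vw' suv' uN'; rewrite /cuts big_cat /= !(cGw _ uw' vw' suv' uN').
  rewrite [RHS](bigID (fun s => last false s)) /=; congr (_ + _); apply: eq_bigl => s.
    by rewrite andbT eqb_id.
  by rewrite andbT eqbF_neg.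
have := @convolution _ M n i j G H (cuts G) (cutb b H) predT (fun t => last false t == b)
  (fun _ => 1) u v N gr iN (fun c => @cuts_forest G c fG) hG' (@cHw b N) uw vw suv uN.
move=> E; transitivity (\sum_(c <- cuts G) \sum_(d <- cutb b H) 1 *
     ((M c.1 (take (size c.1) u) * M d.1 (drop (size c.1) u)) *
      (M c.2 (take (size c.2) v) * M d.2 (drop (size c.2) v)))).
  apply: eq_big_seq => c /(cuts_forest fG) [f1 f2 sc].
  apply: eq_big_seq => d /(cutb_forest fH) [f3 f4 sd].
  by rewrite mul1r !hdot //; apply: leq_trans ijn; rewrite -[i]sc -[j]sd leq_add ?leq_addr ?leq_addl //.
rewrite {}E big_masks_addP; apply: eq_big_seq => s sm.
rewrite big_seq_cond [RHS]big_seq_cond; apply: eq_big => [t|t /andP [tm /andP [/eqP ct _]]].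
  by case tm: (t \in _) => //=; rewrite (last_cat_mask _ j0 tm).
rewrite mul1r hdot // mix_word ?far_le //; exact: mixw.
Qed.

Let hTrue u' v' : is_word u' -> is_word v' -> (size u' + size v' = i)%N -> far u' N ->
  \sum_(c <- cutb true G) M c.1 u' * M c.2 v' =
  \sum_(s <- masks i | (count id s == size u') && last false s) M G (mix s u' (map (addn N) v')).
Proof.
move=> uw' vw' suv' uN'; rewrite (cGw _ uw' vw' suv' uN').
by apply: eq_bigl => s; rewrite eqb_id.
Qed.

Let hFalse u' v' : is_word u' -> is_word v' -> (size u' + size v' = i)%N -> far u' N ->
  \sum_(c <- cutb false G) M c.1 u' * M c.2 v' =
  \sum_(s <- masks i | (count id s == size u') && ~~ last false s) M G (mix s u' (map (addn N) v')).
Proof.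
move=> uw' vw' suv' uN'; rewrite (cGw _ uw' vw' suv' uN').
by apply: eq_bigl => s; rewrite eqbF_neg.
Qed.

(** The single pair [([::], H)] stands for the cuts of [H] when all of it goes to the [Lea] part.
    Its masks have no letter of [u'], and the shift by [N] is undone by parkization. *)
Let hRight u' v' : is_word u' -> is_word v' -> (size u' + size v' = j)%N -> far u' N ->
  \sum_(d <- [:: ([::], H)]) M d.1 u' * M d.2 v' =
  \sum_(t <- masks j | (count id t == size u') && (count id t == 0%N)) M H (mix t u' (map (addn N) v')).
Proof.
move=> uw' vw' suv' uN'; rewrite big_seq1 /=.
case: (posnP (size u')) => [/size0nil u0|u0]; last first.
  rewrite gr // ?mul0r ?big_pred0 // => [t|E]; last by rewrite E in u0.
  by case: eqP => // ->; rewrite eqn0Ngt u0.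
rewrite u0 M1 mul1r; rewrite u0 /= add0n in suv'.
rewrite (eq_bigl (fun t => (count id t == 0%N) && predT t)) => [|t]; last by rewrite andbb andbT.
rewrite big_masks_none mix_nseq_false ?size_map //.
have m : mixable (nseq j false) [::] v'.
  by apply: mixable_masks; rewrite ?size_nseq -?suv' //; apply/eqP; rewrite nseq_count0 size_nseq.
have := park_mix (u := [::]) (N := N) isT vw' m isT (fun _ _ => isT).
rewrite !mix_nseq_false ?size_map ?size_park // => E.
have Nw : is_word (map (addn N) v').
  by rewrite /is_word all_map; apply: sub_all vw' => x /=; lia.
rewrite -[RHS](inv fH) // E; have -> : map (addn (size (Nil nat))) (park v') = park v'.
  by rewrite -[RHS]map_id; apply: eq_map.
by rewrite inv.
Qed.

Let graft_term s t : s \in masks i -> t \in masks j -> count id (s ++ t) = size u ->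
  M (graft G H) (mix (s ++ t) u (map (addn N) v)) =
  (leftcond i (mix (s ++ t) u (map (addn N) v)))%:R *
   (M G (take i (mix (s ++ t) u (map (addn N) v))) * M H (drop i (mix (s ++ t) u (map (addn N) v)))).
Proof.
move=> sm tm ct; rewrite hgraft // mix_word ?far_le //; exact: mixw.
Qed.

Let s_neq0 s : s \in masks i -> s != [::].
Proof. by rewrite mem_masks => /eqP si; apply/eqP => s0; move: i0; rewrite -si s0. Qed.

Let graft_left s t : s \in masks i -> t \in masks j -> count id (s ++ t) = size u -> last false s ->
  M (graft G H) (mix (s ++ t) u (map (addn N) v)) =
  (leftcond (count id s) u)%:R *
   (M G (take i (mix (s ++ t) u (map (addn N) v))) * M H (drop i (mix (s ++ t) u (map (addn N) v)))).
Proof.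
move=> sm tm ct ls; rewrite graft_term //; congr (_%:R * _).
have si : size s = i by move: sm; rewrite mem_masks => /eqP.
by rewrite -[in LHS]si leftcond_mix_left ?far_le ?s_neq0 //; apply: mixw.
Qed.

Let graft_right s t : s \in masks i -> t \in masks j -> count id (s ++ t) = size u -> ~~ last false s ->
  M (graft G H) (mix (s ++ t) u (map (addn N) v)) =
  ((count id t == 0%N) && leftcond (i - count id s) v)%:R *
   (M G (take i (mix (s ++ t) u (map (addn N) v))) * M H (drop i (mix (s ++ t) u (map (addn N) v)))).
Proof.
move=> sm tm ct ls; rewrite graft_term //; congr (_%:R * _).
have si : size s = i by move: sm; rewrite mem_masks => /eqP.
rewrite -[in LHS]si leftcond_mix_right ?far_le ?s_neq0 //; last exact: mixw.
by rewrite -si -(count_predC id s) addKn.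
Qed.

Lemma cutt_graft_words :
  \sum_(c <- cutb true (graft G H)) M c.1 u * M c.2 v =
  \sum_(s <- masks (i + j) | (count id s == size u) && (last false s == true))
     M (graft G H) (mix s u (map (addn N) v)).
Proof.
rewrite (big_cutt_graft fG fH (fun c1 c2 => M c1 u * M c2 v) i0 j0).
have := @convolution _ M n i j G H (cutb true G) (cutb true H) (last false) (fun t => last false t == true)
  (fun l => (leftcond l u)%:R) u v N gr iN (fun c => @cutb_forest true G c fG) hTrue (@cHw true N) uw vw suv uN.
move=> E; transitivity (\sum_(c <- cutb true G) \sum_(d <- cutb true H) (leftcond (size c.1) u)%:R *
     ((M c.1 (take (size c.1) u) * M d.1 (drop (size c.1) u)) *
      (M c.2 (take (size c.2) v) * M d.2 (drop (size c.2) v)))).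
  apply: eq_big_seq => c cc; have [f1 f2 sc] := cutb_forest fG cc; have c1 := cutt_neq0 cc.
  apply: eq_big_seq => d /(cutb_forest fH) [f3 f4 sd].
  by rewrite hgraft ?hdot ?mulrA //; apply: leq_trans ijn; rewrite -[i]sc -[j]sd leq_add ?leq_addr ?leq_addl //.
rewrite {}E big_masks_addP big_mkcond; apply: eq_big_seq => s sm.
case: ifP => ls.
  rewrite big_seq_cond [RHS]big_seq_cond; apply: eq_big => [t|t /andP [tm /andP [/eqP ct _]]].
    by case tm: (t \in _) => //=; rewrite (last_cat_mask _ j0 tm).
  by rewrite graft_left.
(* The prefix ends in the upper alphabet, so the graft condition excludes letters of [u] from [t];
   but [t] ends with one. *)
rewrite big1_seq // => t /andP [/andP [/eqP ct lt] tm]; rewrite graft_right ?ls //.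
rewrite (last_cat_mask _ j0 tm) in lt.
suff -> : (count id t == 0%N) = false by rewrite mul0r.
apply/negbTE/negP; rewrite nseq_count0 => /eqP t0; move: lt; rewrite t0.
by move: tm; rewrite mem_masks => /eqP ->; case: (j) => //= k; elim: k.
Qed.

Lemma cutf_graft_words :
  \sum_(c <- cutb false (graft G H)) M c.1 u * M c.2 v =
  \sum_(s <- masks (i + j) | (count id s == size u) && (last false s == false))
     M (graft G H) (mix s u (map (addn N) v)).
Proof.
rewrite (big_cutf_graft fG fH (fun c1 c2 => M c1 u * M c2 v) i0 j0).
have E1 := @convolution _ M n i j G H (cutb true G) (cutb false H) (last false) (fun t => last false t == false)
  (fun l => (leftcond l u)%:R) u v N gr iN (fun c => @cutb_forest true G c fG) hTrue (@cHw false N) uw vw suv uN.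
(* Second sum of [big_cutf_graft]: the graft survives in the [Lea] part, so its condition bears on
   [v], at the position [i - l]. *)
have E2 := @convolution _ M n i j G H (cutb false G) [:: ([::], H)] (fun s => ~~ last false s) (fun t => count id t == 0%N)
  (fun l => (leftcond (i - l) v)%:R) u v N gr iN (fun c => @cutb_forest false G c fG) hFalse hRight uw vw suv uN.
transitivity (\sum_(c <- cutb true G) \sum_(d <- cutb false H) (leftcond (size c.1) u)%:R *
     ((M c.1 (take (size c.1) u) * M d.1 (drop (size c.1) u)) *
      (M c.2 (take (size c.2) v) * M d.2 (drop (size c.2) v))) +
  \sum_(c <- cutb false G) \sum_(d <- [:: ([::], H)]) (leftcond (i - size c.1) v)%:R *
     ((M c.1 (take (size c.1) u) * M d.1 (drop (size c.1) u)) *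
      (M c.2 (take (size c.2) v) * M d.2 (drop (size c.2) v)))).
  congr (_ + _).
    apply: eq_big_seq => c cc; have [f1 f2 sc] := cutb_forest fG cc; have c1 := cutt_neq0 cc.
    apply: eq_big_seq => d /(cutb_forest fH) [f3 f4 sd].
    by rewrite hgraft ?hdot ?mulrA //; apply: leq_trans ijn; rewrite -[i]sc -[j]sd leq_add ?leq_addr ?leq_addl //.
  apply: eq_big_seq => c cc; have [f1 f2 sc] := cutb_forest fG cc; have c2 := cutf_neq0 G0 cc.
  rewrite big_seq1 /= -hdot //; last by rewrite addn0; apply: leq_trans iN; rewrite -[i]sc leq_addr.
  rewrite dotf0 hgraft //; last by apply: leq_trans ijn; rewrite -[i]sc leq_add2r leq_addl.
  have -> : (i - size c.1 = size c.2)%N by rewrite -[i]sc addKn.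
  by rewrite mulrCA.
rewrite {}E1 {}E2 big_masks_addP [RHS](bigID (last false)) /=; congr (_ + _).
  rewrite big_seq_cond [RHS]big_seq_cond; apply: eq_bigr => s /andP [sm ls].
  rewrite big_seq_cond [RHS]big_seq_cond; apply: eq_big => [t|t /andP [tm /andP [/eqP ct _]]].
    by case tm: (t \in _) => //=; rewrite (last_cat_mask _ j0 tm).
  by rewrite graft_left.
rewrite big_seq_cond [RHS]big_seq_cond; apply: eq_bigr => s /andP [sm ls].
rewrite big_mkcond [RHS]big_mkcond; apply: eq_big_seq => t tm.
rewrite (last_cat_mask _ j0 tm); case: eqP => //= ct.
have [t0|t0] := boolP (count id t == 0%N).
  have -> : last false t == false.
    have := tm; rewrite mem_masks => /eqP st; move: t0; rewrite nseq_count0 st => /eqP ->.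
    by case: (j) => //= k; elim: k.
  by rewrite graft_right // t0.
by case: ifP => // _; rewrite graft_right // (negbTE t0) mul0r.
Qed.
End Words.

Lemma cut_at_dot : cut_at M (dot G H).
Proof.
apply: (words_cut_at inv); rewrite ?forest_dot ?size_dot // => b N u v uw vw suv uN.
by rewrite size_dot in suv *; apply: cutw_dot_words.
Qed.

Lemma cut_at_graft : cut_at M (graft G H).
Proof.
apply: (words_cut_at inv); rewrite ?forest_graft ?size_graft // => b N u v uw vw suv uN.
by rewrite size_graft in suv *; case: b; [apply: cutt_graft_words | apply: cutf_graft_words].
Qed.
End ProductCuts.

(** * Extension of a pairing to the next degree *)

Section Transform.
Variables (K : fieldType) (M : seq nat -> seq nat -> K).
Local Open Scope ring_scope.
Implicit Types f g : seq nat -> K.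

(** Transpose of the map defined by [M]: it sends functions on parking functions to functions on
    forests. *)
Definition transform f F := \sum_(a <- parkings (size F)) M F a * f a.

Lemma big_delta (I : eqType) (r : seq I) (x : I) (F : I -> K) : uniq r -> x \in r ->
  \sum_(y <- r) F y * (x == y)%:R = F x.
Proof.
move=> ur xr; rewrite (bigD1_seq x) //= eqxx mulr1 big1 ?addr0 // => y.
by rewrite eq_sym => /negbTE ->; rewrite mulr0.
Qed.

Lemma big_delta0 (I : eqType) (r : seq I) (x : I) (F : I -> K) : x \notin r ->
  \sum_(y <- r) F y * (x == y)%:R = 0.
Proof.
move=> xr; rewrite big1_seq // => y /andP [_ yr]; case: eqP => [E|]; rewrite ?mulr0 //.
by rewrite E yr in xr.
Qed.

(** Summing [cut_at] against [f] and [g] makes the transpose compatible with the half products at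
    [F]; shuffles are turned back into cuts by [big_parkings_cutb]. *)
Lemma transform_hp n F : graded M n -> forest F -> (size F <= n)%N -> cut_at M F ->
  forall b f g, transform (hp zcutb b f g) F = hp cutb b (transform f) (transform g) F.
Proof.
move=> gr fF sF cF b f g; set N := size F.
transitivity (\sum_(i <- iota 0 N.+1) \sum_(u <- parkings i) \sum_(v <- parkings (N - i))
   f u * g v * \sum_(a <- parkings N) M F a * \sum_(c <- zcutb b a) ((c.1 == u)%:R * (c.2 == v)%:R)).
  rewrite /transform /hp -/N.
  under [RHS]eq_bigr => i _.
    under eq_bigr => u _.
      under eq_bigr => v _ do rewrite mulr_sumr.
      rewrite exchange_big /=; over.
    rewrite exchange_big /=; over.
  rewrite exchange_big /=; apply: eq_big_seq => a; rewrite mem_parkings => /andP [pa /eqP sa].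
  under [RHS]eq_bigr => i _.
    under eq_bigr => u _.
      under eq_bigr => v _ do rewrite mulrCA mulr_sumr.
      rewrite -mulr_sumr exchange_big /=; over.
    rewrite -mulr_sumr exchange_big /=; over.
  rewrite -mulr_sumr exchange_big /=; congr (_ * _).
  apply: eq_big_seq => c /(zcutb_parking pa) [p1 p2 sc].
  have EN : N = (size c.1 + size c.2)%N by rewrite sc sa.
  rewrite (bigD1_seq (size c.1) _ (iota_uniq 0 N.+1)) ?mem_iota0 ?EN ?leq_addr //.
  rewrite [X in _ = _ + X]big1_seq ?addr0 => [|i /andP [ic _]]; last first.
    rewrite big1_seq // => u /andP [_]; rewrite mem_parkings => /andP [_ /eqP su].
    rewrite big1 // => v _; case: eqP => [E|]; rewrite ?mul0r ?mulr0 //.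
    by rewrite -su -E eqxx in ic.
  rewrite addKn.
  under eq_bigr => u _.
    under eq_bigr => v _ do rewrite mulrA.
    rewrite (big_delta (fun v => f u * g v * (c.1 == u)%:R)) ?uniq_parkings ?mem_parkings ?p2 ?eqxx //.
    over.
  under eq_bigr do rewrite mulrAC.
  by rewrite -mulr_suml (big_delta f) ?uniq_parkings ?mem_parkings ?p1 ?eqxx.
transitivity (\sum_(i <- iota 0 N.+1) \sum_(u <- parkings i) \sum_(v <- parkings (N - i))
   f u * g v * \sum_(c <- cutb b F) M c.1 u * M c.2 v).
  apply: eq_big_seq => i; rewrite mem_iota0 => iN.
  apply: eq_big_seq => u; rewrite mem_parkings => /andP [pu /eqP su].
  apply: eq_big_seq => v; rewrite mem_parkings => /andP [pv /eqP sv].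
  have suv : (size u + size v = size F)%N by rewrite su sv subnKC.
  rewrite (cF b u v pu pv suv) -/N.
  have EN : N = (size u + size v)%N by rewrite suv.
  by rewrite EN (big_parkings_cutb pu pv).
under eq_bigr => i _.
  under eq_bigr => u _.
    under eq_bigr => v _ do rewrite mulr_sumr.
    rewrite exchange_big /=; over.
  rewrite exchange_big /=; over.
rewrite exchange_big /=; apply: eq_big_seq => c cc; have [f1 f2 sc] := cutb_forest fF cc.
have n1 : (size c.1 <= n)%N by apply: leq_trans sF; rewrite -sc leq_addr.
have EN : N = (size c.1 + size c.2)%N by rewrite sc.
rewrite (bigD1_seq (size c.1) _ (iota_uniq 0 N.+1)) ?mem_iota0 ?EN ?leq_addr //=.
rewrite [X in _ + X]big1_seq ?addr0 => [|i /andP [ic _]]; last first.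
  rewrite big1_seq // => u /andP [_]; rewrite mem_parkings => /andP [pu /eqP su].
  rewrite big1 // => v _; rewrite (gr c.1 u) ?parking_word ?mul0r ?mulr0 // su.
  by apply/eqP.
rewrite addKn.
rewrite /transform mulr_suml; apply: eq_bigr => u _.
by rewrite mulr_sumr; apply: eq_bigr => v _; rewrite mulrACA [f u * _]mulrC [g v * _]mulrC.
Qed.
End Transform.

Section Values.
Variables (K : fieldType) (M : seq nat -> seq nat -> K) (n : nat).
Local Open Scope ring_scope.

(** Induction hypothesis up to degree [n]. By [good_free] and the equality of cardinals, the matrix
    of [M] in each degree is square and invertible. *)
Record good : Prop := Good {
  good_unit : M [::] [::] = 1;
  good_graded : graded M n;
  good_park : park_invariant M n;
  good_dot : forall X Y, forest X -> forest Y -> (size X + size Y <= n)%N -> dot_at M X Y;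
  good_graft : forall X Y, forest X -> forest Y -> X != [::] -> (size X + size Y <= n)%N -> graft_at M X Y;
  good_cut : forall F, forest F -> (size F <= n)%N -> cut_at M F;
  good_free : forall k, (k <= n)%N -> forall c : seq nat -> K,
    (forall a, a \in parkings k -> \sum_(F <- forests k) M F a * c F = 0) ->
    forall F, F \in forests k -> c F = 0 }.

(* The value given by the first factorization; it does not depend on the
   factorization, by [dec_value_dot] and [dec_value_graft]. *)
Definition dec_value (F w : seq nat) : K :=
  let r := iota 1 (size F).-1 in
  if has (dotsplit^~ F) r then
    let i := nth 0%N r (find (dotsplit^~ F) r) in
    M (take i F) (take i w) * M (down i F) (drop i w)
  else
    let i := nth 0%N r (find (graftsplit^~ F) r) in
    (leftcond i w)%:R * (M (take i F) (take i w) * M (down i F) (drop i w)).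

Lemma find_min (p : pred nat) k : has p (iota 1 k) ->
  exists i, [/\ i = nth 0%N (iota 1 k) (find p (iota 1 k)), (0 < i <= k)%N, p i &
    forall j, (0 < j)%N -> (j < i)%N -> ~~ p j].
Proof.
move=> hp; have := hp; rewrite has_find size_iota => lt.
exists (nth 0%N (iota 1 k) (find p (iota 1 k))); split; rewrite ?nth_find // nth_iota //.
case=> // j _; rewrite add1n ltnS => lj.
by have := before_find 0%N lj; rewrite nth_iota ?add1n; [move=> -> | apply: ltn_trans lt].
Qed.
End Values.

Lemma drop_take_le (i g : nat) (w : seq nat) : i <= g -> drop i (take g w) = take (g - i) (drop i w).
Proof. by move=> ig; rewrite take_drop subnK. Qed.

Lemma drop_drop_le (i g : nat) (w : seq nat) : i <= g -> drop (g - i) (drop i w) = drop g w.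
Proof. by move=> ig; rewrite drop_drop subnK. Qed.

Section DecValues.
Variables (K : fieldType) (M : seq nat -> seq nat -> K) (n : nat).
Local Open Scope ring_scope.
Hypothesis gM : good M n.

Let sizes (X Y : seq nat) : (size X + size Y = n.+1)%N -> X != [::] -> Y != [::] ->
  (size X <= n)%N /\ (size Y <= n)%N.
Proof. by move=> s /size_gt0 x /size_gt0 y; split; lia. Qed.

Let split_mem (X Y : seq nat) : X != [::] -> Y != [::] -> size X \in iota 1 (size X + size Y).-1.
Proof. by move=> /size_gt0 x /size_gt0 y; rewrite mem_iota; lia. Qed.

(** The first splitting used by [dec_value] is not after [size X]. If it is before, [dot_dot_factor]
    refines both factorizations by a common middle factor, and multiplicativity of [M] in lower
    degree identifies the two values. *)
Lemma dec_value_dot X Y w : forest X -> forest Y -> X != [::] -> Y != [::] ->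
  (size X + size Y = n.+1)%N -> is_word w -> size w = n.+1 ->
  dec_value M (dot X Y) w = M X (take (size X) w) * M Y (drop (size X) w).
Proof.
move=> fX fY X0 Y0 sXY ww sw; have [sX sY] := sizes sXY X0 Y0.
have hs : has (dotsplit^~ (dot X Y)) (iota 1 (size (dot X Y)).-1).
  apply/hasP; exists (size X); first by rewrite size_dot split_mem.
  by rewrite /dotsplit take_dot down_dot fX fY eqxx.
rewrite /dec_value hs; have [i [<- iP /and3P [f1 f2 /eqP E] imin]] := find_min hs.
have iX : (i <= size X)%N.
  rewrite leqNgt; apply/negP => lt; have := imin _ (size_gt0 X0) lt.
  by rewrite /dotsplit take_dot down_dot fX fY eqxx.
move: iX; rewrite leq_eqVlt => /orP [/eqP ->|lt]; first by rewrite take_dot down_dot.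
have st : size (take i (dot X Y)) = i by rewrite size_take_min size_dot; move: iP; rewrite size_dot; lia.
move: f1 f2 E; set G' := take i _ in st *; set H' := down i _ => f1 f2 E.
have lt' : (size G' < size X)%N by rewrite st.
have [J [fJ J0 EX EH]] := dot_dot_factor fX lt' E.
have sJ : size J = (size X - i)%N by rewrite EX size_dot st addKn.
have iX := ltnW lt.
rewrite EH (good_dot gM fJ fY) ?drop_word //; last by move: sXY iP sJ; lia.
rewrite [X in _ = M X _ * _]EX (good_dot gM f1 fJ) ?take_word //; last by rewrite st sJ subnKC.
by rewrite st sJ take_takel // drop_take_le // drop_drop_le // mulrA.
Qed.

(** Word counterpart of [graftA]; the nontrivial point is transitivity of the order on letters. *)
Let leftcond_take i g (w : seq nat) : (0 < i)%N -> (i < g)%N -> (g <= size w)%N ->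
  leftcond i w && leftcond (g - i) (drop i w) = leftcond i (take g w) && leftcond g w.
Proof.
move=> i0 ig gw; rewrite /leftcond take_takel ?(ltnW ig) // drop_take_le ?(ltnW ig) //.
rewrite drop_drop_le ?(ltnW ig) //.
have -> : last 0%N (take g w) = last 0%N (take (g - i) (drop i w)).
  rewrite -[in LHS](subnKC (ltnW ig)) takeD last_cat.
  have : size (take (g - i) (drop i w)) = (g - i)%N by rewrite size_take_min size_drop; lia.
  by case: (take _ (drop i w)) => [E|//]; move: ig; rewrite -subn_gt0 -E.
rewrite -[in X in X && _](cat_take_drop (g - i) (drop i w)) all_cat drop_drop_le ?(ltnW ig) // -andbA.
set r := take (g - i) _; set x := last 0%N (take i w); case A : (all (leq x) r) => //=.
have xy : (x <= last 0%N r)%N.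
  apply: (allP A); have : size r = (g - i)%N by rewrite size_take_min size_drop; lia.
  by case: (r) => [E|y q _ /=]; [move: ig; rewrite -subn_gt0 -E | apply: mem_last].
case C : (all (leq (last 0%N r)) (drop g w)); last by rewrite andbF.
by rewrite andbT; apply: sub_all C => y; apply: leq_trans.
Qed.

(** Word counterpart of [dot_graft]: the graft condition sees only the last letter before the
    cut. *)
Let leftcond_drop i g (w : seq nat) : (i < g)%N -> (g <= size w)%N ->
  leftcond (g - i) (drop i w) = leftcond g w.
Proof.
move=> ig gw; rewrite /leftcond drop_drop_le ?(ltnW ig) //.
congr (all (leq _) _); rewrite -[in RHS](subnKC (ltnW ig)) takeD last_cat.
have : size (take (g - i) (drop i w)) = (g - i)%N by rewrite size_take_min size_drop; lia.
by case: (take _ (drop i w)) => [E|//]; move: ig; rewrite -subn_gt0 -E.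
Qed.

(** A splitting for [dot] takes precedence in [dec_value]; by [graft_dot_size] it falls strictly
    inside [X], and [graft_dot_factor] compares the values. Otherwise the first splitting for
    [graft] is refined as in [dec_value_dot]. *)
Lemma dec_value_graft X Y w : forest X -> forest Y -> X != [::] -> Y != [::] ->
  (size X + size Y = n.+1)%N -> is_word w -> size w = n.+1 ->
  dec_value M (graft X Y) w =
  (leftcond (size X) w)%:R * (M X (take (size X) w) * M Y (drop (size X) w)).
Proof.
move=> fX fY X0 Y0 sXY ww sw; have [sX sY] := sizes sXY X0 Y0.
have sXw : (size X <= size w)%N by rewrite sw ltnW.
rewrite /dec_value; case: ifP => hs.
  have [i [<- iP /and3P [f1 f2 /eqP E] imin]] := find_min hs.
  have st : size (take i (graft X Y)) = i by rewrite size_take_min size_graft; move: iP; rewrite size_graft; lia.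
  have d0 : down i (graft X Y) != [::].
    by apply: size_neq0; rewrite size_map size_drop size_graft; move: iP; rewrite size_graft; lia.
  move: f1 f2 d0 E; set G' := take i _ in st *; set H' := down i _ => f1 f2 d0 E.
  have lt := graft_dot_size f2 d0 X0 E; rewrite st in lt.
  have lt' : (size G' < size X)%N by rewrite st.
  have [J [fJ J0 EX EH]] := graft_dot_factor fX lt' E.
  have sJ : size J = (size X - i)%N by rewrite EX size_dot st addKn.
  have iX := ltnW lt.
  rewrite EH (good_graft gM fJ fY) ?drop_word //; last by move: sXY iP sJ; lia.
  rewrite [X in _ = _ * (M X _ * _)]EX (good_dot gM f1 fJ) ?take_word //; last by rewrite st sJ subnKC.
  rewrite st sJ leftcond_drop // take_takel // drop_take_le // drop_drop_le //.
  by rewrite mulrCA -!mulrA.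
have hg : has (graftsplit^~ (graft X Y)) (iota 1 (size (graft X Y)).-1).
  apply/hasP; exists (size X); first by rewrite size_graft split_mem.
  by rewrite /graftsplit take_graft down_graft fX fY eqxx.
have [i [<- iP /and3P [f1 f2 /eqP E] imin]] := find_min hg.
have iX : (i <= size X)%N.
  rewrite leqNgt; apply/negP => lt; have := imin _ (size_gt0 X0) lt.
  by rewrite /graftsplit take_graft down_graft fX fY eqxx.
move: iX; rewrite leq_eqVlt => /orP [/eqP ->|lt]; first by rewrite take_graft down_graft.
have st : size (take i (graft X Y)) = i by rewrite size_take_min size_graft; move: iP; rewrite size_graft; lia.
move: f1 f2 E; set G' := take i _ in st *; set H' := down i _ => f1 f2 E.
have lt' : (size G' < size X)%N by rewrite st.
have i0 : (0 < i)%N by case/andP: iP.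
have G'0 : G' != [::] by apply: size_neq0; rewrite st.
have [J [fJ J0 EX EH]] := graft_graft_factor fX lt' E.
have sJ : size J = (size X - i)%N by rewrite EX size_graft st addKn.
have iX := ltnW lt.
rewrite EH (good_graft gM fJ fY) ?drop_word //; last by move: sXY iP sJ; lia.
rewrite [X in _ = _ * (M X _ * _)]EX (good_graft gM f1 fJ) ?take_word //; last by rewrite st sJ subnKC.
rewrite st sJ take_takel // drop_take_le // drop_drop_le //.
have := leftcond_take i0 lt sXw; set a := leftcond i w; set b := leftcond (_ - _) _.
set c := leftcond i _; set d := leftcond _ w => Eab.
have E2 : a%:R * b%:R = d%:R * c%:R :> K by rewrite -!natrM !mulnb Eab andbC.
rewrite [X in _ * X]mulrCA [LHS]mulrA E2 -!mulrA.
by [].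
Qed.
End DecValues.

Section DeltaBasis.
Variable K : fieldType.
Local Open Scope ring_scope.

Lemma delta_homog (F : seq nat) : homog forest (size F) (@delta K F).
Proof. by move=> x _ sx; rewrite /delta; case: eqP => // E; rewrite E in sx. Qed.

Lemma delta_span k (f : seq nat -> K) :
  exists c, forall x, forest x -> size x = k -> f x = \sum_(F <- forests k) c F * delta K F x.
Proof.
exists f => x fx sx; rewrite /delta (big_delta f) ?uniq_forests // mem_forests fx.
by apply/eqP.
Qed.

(** The [beta t] are independent and as numerous as the forests, so they span all functions on
    [forests k]. *)
Lemma delta_mid k F : (0 < k)%N -> F \in forests k ->
  spanned forest (mid3 cutb (@delta K)) (triples k) k (@delta K F).
Proof.
move=> k0 _; have [psi H] := span_family (uniq_forests k) (uniq_triples k) (esym (size_triples k0))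
  (B := fun F t => beta K t F) (@triples_free_all K k) (delta K F).
by exists psi => x fx sx; apply: H; rewrite mem_forests fx sx eqxx.
Qed.

Lemma spanned_forest_hp n b i j (f g : seq nat -> K) : (0 < i)%N -> (0 < j)%N -> (i + j = n)%N ->
  homog forest i f -> homog forest j g ->
  spanned forest (mid3 cutb (@delta K)) (ntriples n) n (hp cutb b f g).
Proof.
apply: spanned_hp.
- exact: cutb_forest.
- exact: fhp_tt.
- exact: fhp_tf.
- exact: fhp_ff.
- by move=> F fF _; apply: delta_homog.
- by move=> k _; apply: delta_span.
by move=> k /andP [k0 _] F; apply: delta_mid.
Qed.
End DeltaBasis.

Lemma cutb_full b (F : seq nat) c : forest F -> c \in cutb b F -> size c.1 = size F -> c.1 = F.
Proof.
move=> fF /mapP [s]; rewrite mem_filter => /andP [_ sI] -> /=; rewrite size_restr => sz.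
suff -> : s.1 = iota 1 (size F) by rewrite restr_iota.
by apply/eqP; rewrite -(size_subseq_leqif (subseq_splits1 sI)) sz size_iota.
Qed.

Section Step.
Variable K : fieldType.
Local Open Scope ring_scope.
Hypothesis size_parkings : forall k, size (parkings k) = size (forests k).
Variables (n : nat) (M : seq nat -> seq nat -> K).
Hypothesis gM : good M n.

(** [zeta F] is the preimage of [delta K F] under [transform]; it exists in degrees at most [n],
    where [M] is invertible. *)
Lemma dual_basis : exists zeta : seq nat -> seq nat -> K,
  (forall F a, size a <> size F -> zeta F a = 0) /\
  (forall k, (k <= n)%N -> forall F G, F \in forests k -> G \in forests k ->
     \sum_(a <- parkings k) zeta F a * M G a = (F == G)%:R).
Proof.
have ex (k : nat) : exists z : seq nat -> seq nat -> K, (k <= n)%N ->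
    forall F G, F \in forests k -> G \in forests k ->
     \sum_(a <- parkings k) z F a * M G a = (F == G)%:R.
  case: (leqP k n) => kn; last by exists (fun _ _ => 0).
  have [z Hz] := dual_family (uniq_parkings k) (uniq_forests k) (B := fun a F => M F a) (good_free gM kn).
  by exists z.
have [z Hz] := functional_choice _ ex.
exists (fun F a => if size a == size F then z (size F) F a else 0); split=> [F a|k kn F G Fk Gk].
  by case: eqP.
rewrite -(Hz k kn F G Fk Gk); apply: eq_big_seq => a; rewrite mem_parkings => /andP [_ /eqP ->].
by move: Fk; rewrite mem_forests => /andP [_ /eqP ->]; rewrite eqxx.
Qed.

Section Extension.
Variable gamma : seq nat -> seq nat -> K.

(** Degree [n.+1] is defined in two regimes; evaluating [gamma] at [park w] makes the indecomposable
    rows invariant under parkization for every choice of [gamma]. *)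
Definition extend (F w : seq nat) : K :=
  if (size F <= n)%N then M F w
  else if (size F == n.+1) && (size w == n.+1) then
    (if fdec F then dec_value M F w else gamma F (park w))
  else 0.

Lemma extend_small F w : (size F <= n)%N -> extend F w = M F w.
Proof. by rewrite /extend => ->. Qed.

Lemma extend_graded : graded extend n.+1.
Proof.
move=> F w fF sF ww sw; rewrite /extend; case: ifP => FN; first exact: (good_graded gM).
by case: ifP => // /andP [/eqP E1 /eqP E2]; case: sw; rewrite E1 E2.
Qed.

Let leftcond_park i w : is_word w -> (0 < i)%N -> (i <= size w)%N -> leftcond i (park w) = leftcond i w.
Proof.
move=> ww i0 iw; rewrite /leftcond.
have lastE u : size u = size w -> last 0%N (take i u) = nth 0%N u i.-1.
  move=> su; rewrite (last_nth 0%N) size_take_min su (minn_idPl iw) -[in LHS](prednK i0) /= nth_take ?prednK //.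
have sp := size_park ww; rewrite !lastE //.
have allE u x : all (leq x) (drop i u) = all (fun j => (x <= nth 0%N u (i + j))%N) (iota 0 (size u - i)).
  by rewrite -[drop i u](mkseq_nth 0%N) size_drop /mkseq all_map; apply: eq_all => j /=; rewrite nth_drop.
rewrite !allE sp; apply: eq_in_all => j; rewrite mem_iota add0n => /andP [_ lt].
by rewrite park_leq //; lia.
Qed.

Lemma extend_park : park_invariant extend n.+1.
Proof.
move=> F w fF sF ww; rewrite /extend size_park //; case: ifP => FN; first exact: (good_park gM).
case: ifP => // /andP [/eqP E1 /eqP E2].
case: ifP => dF; last by rewrite (park_id (park_parking ww)).
have [G [H [fG fH G0 H0 E]]] := fdecP dF.
have sz : (size G + size H = n.+1)%N by rewrite -E1; case: E => ->; rewrite ?size_dot ?size_graft.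
have wp := parking_word (park_parking ww).
have s1 := size_gt0 G0; have s2 := size_gt0 H0.
have MP X i : forest X -> (size X <= n)%N -> M X (take i (park w)) = M X (take i w).
  by move=> fX sX; rewrite -(good_park gM) ?take_word // park_take // (good_park gM) ?take_word.
have MP' X i : forest X -> (size X <= n)%N -> M X (drop i (park w)) = M X (drop i w).
  by move=> fX sX; rewrite -(good_park gM) ?drop_word // park_drop // (good_park gM) ?drop_word.
have sG : (size G <= n)%N by lia.
have sH : (size H <= n)%N by lia.
case: E => ->.
  by rewrite !(dec_value_dot gM) ?size_park // MP // MP'.
rewrite !(dec_value_graft gM) ?size_park // MP // MP' // leftcond_park //.
by rewrite E2; lia.
Qed.

Lemma extend_dot X Y : forest X -> forest Y -> (size X + size Y <= n.+1)%N -> dot_at extend X Y.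
Proof.
move=> fX fY sXY w ww; case: (leqP (size X + size Y) n) => le.
  rewrite !extend_small ?size_dot ?(leq_trans (leq_addr _ _) le) ?(leq_trans (leq_addl _ _) le) //.
  exact: (good_dot gM).
have {le sXY} sXY : (size X + size Y = n.+1)%N by apply/eqP; rewrite eqn_leq sXY.
have e1 := extend_graded; have E0 : extend [::] [::] = 1 by rewrite extend_small // (good_unit gM).
case: (eqVneq X [::]) => [->|X0]; first by rewrite dot0f take0 drop0 E0 mul1r.
case: (eqVneq Y [::]) sXY => [->|Y0] sXY.
  rewrite dotf0 addn0 in sXY *; case: (ltngtP (size w) (size X)) => sw.
  - by rewrite take_oversize ?(ltnW sw) // e1 ?mul0r ?sXY //; lia.
  - rewrite [extend X w]e1 ?sXY //; last by lia.
    by rewrite [extend [::] _]e1 ?mulr0 ?drop_word // size_drop /=; lia.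
  by rewrite take_oversize ?drop_oversize ?sw // E0 mulr1.
have s1 := size_gt0 X0; have s2 := size_gt0 Y0.
have sX : (size X <= n)%N by lia.
have sY : (size Y <= n)%N by lia.
rewrite [extend X _]extend_small // [extend Y _]extend_small //.
rewrite /extend size_dot sXY ltnn eqxx fdec_dot //=.
case: eqP => sw; first by rewrite (dec_value_dot gM).
case: (eqVneq (size (take (size X) w)) (size X)) => [st|/eqP st]; last first.
  by rewrite (good_graded gM) ?mul0r ?take_word.
rewrite [M Y _](good_graded gM) ?mulr0 ?drop_word // size_drop.
by move: st; rewrite size_take_min; lia.
Qed.

Lemma extend_graft X Y : forest X -> forest Y -> X != [::] -> (size X + size Y <= n.+1)%N ->
  graft_at extend X Y.
Proof.
move=> fX fY X0 sXY w ww; case: (leqP (size X + size Y) n) => le.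
  rewrite !extend_small ?size_graft ?(leq_trans (leq_addr _ _) le) ?(leq_trans (leq_addl _ _) le) //.
  exact: (good_graft gM).
have {le sXY} sXY : (size X + size Y = n.+1)%N by apply/eqP; rewrite eqn_leq sXY.
have e1 := extend_graded; have E0 : extend [::] [::] = 1 by rewrite extend_small // (good_unit gM).
case: (eqVneq Y [::]) sXY => [->|Y0] sXY.
  have := @extend_dot X [::] fX forest_nil; rewrite sXY leqnn => /(_ isT w ww).
  rewrite dotf0 graftf0 => <-; rewrite addn0 in sXY.
  case: (eqVneq (size w) (size X)) => [sw|/eqP sw]; last by rewrite e1 ?mulr0 ?sXY // -sXY.
  by rewrite /leftcond [drop _ w]drop_oversize ?sw // mul1r.
have s1 := size_gt0 X0; have s2 := size_gt0 Y0.
have sX : (size X <= n)%N by lia.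
have sY : (size Y <= n)%N by lia.
rewrite [extend X _]extend_small // [extend Y _]extend_small //.
rewrite /extend size_graft sXY ltnn eqxx fdec_graft //=.
case: eqP => sw; first by rewrite (dec_value_graft gM).
case: (eqVneq (size (take (size X) w)) (size X)) => [st|/eqP st]; last first.
  by rewrite (good_graded gM) ?mul0r ?mulr0 ?take_word.
rewrite [M Y _](good_graded gM) ?mulr0 ?drop_word // size_drop.
by move: st; rewrite size_take_min; lia.
Qed.

Lemma extend_cut_small F : forest F -> (size F <= n)%N -> cut_at extend F.
Proof.
move=> fF sF b u v pu pv suv; have := good_cut gM fF sF b pu pv suv.
under [X in _ = X -> _]eq_bigr do rewrite -(extend_small _ sF).
move=> <-; apply: eq_big_seq => c /(cutb_forest fF) [_ _ sc].
by rewrite !extend_small // (leq_trans _ sF) // -sc ?leq_addr ?leq_addl.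
Qed.

Lemma extend_cut_dec F : forest F -> size F = n.+1 -> fdec F -> cut_at extend F.
Proof.
move=> fF sF dF; have [G [H [fG fH G0 H0 E]]] := fdecP dF.
have sz : (size G + size H = n.+1)%N by rewrite -sF; case: E => ->; rewrite ?size_dot ?size_graft.
have s1 := size_gt0 G0; have s2 := size_gt0 H0.
have sG : (size G <= n)%N by lia.
have sH : (size H <= n)%N by lia.
have E0 : extend [::] [::] = 1 by rewrite extend_small // (good_unit gM).
have szl : (size G + size H <= n.+1)%N by rewrite sz.
case: E => ->.
  exact: (cut_at_dot extend_graded extend_park fG fH H0 szl extend_dot
    (extend_cut_small fG sG) (extend_cut_small fH sH)).
exact: (cut_at_graft extend_graded extend_park E0 fG fH G0 H0 szl extend_dot extend_graft
    (extend_cut_small fG sG) (extend_cut_small fH sH)).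
Qed.

Variable zeta : seq nat -> seq nat -> K.
Hypothesis zeta_size : forall F a, size a <> size F -> zeta F a = 0.
Hypothesis zetaM : forall k, (k <= n)%N -> forall F G, F \in forests k -> G \in forests k ->
     \sum_(a <- parkings k) zeta F a * M G a = (F == G)%:R.

Lemma transform_zeta F G : forest F -> forest G -> (size F <= n)%N ->
  transform extend (zeta F) G = delta K F G.
Proof.
move=> fF fG sF; rewrite /transform /delta; case: (eqVneq (size G) (size F)) => sG.
  rewrite eq_sym -(@zetaM (size G)) ?sG // ?mem_forests ?fF ?fG ?sG ?eqxx //.
  by apply: eq_bigr => a _; rewrite mulrC extend_small ?sG.
rewrite big1_seq => [|a /andP [_]]; last first.
  rewrite mem_parkings => /andP [_ /eqP sa]; rewrite zeta_size ?mulr0 // sa.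
  by apply/eqP.
by case: eqP => // E; rewrite E eqxx in sG.
Qed.

(** The transpose sends [zeta] to [delta] and respects the half products, so the test elements go to
    the cut numbers [beta], whatever [gamma] is. *)
Lemma transform_mid3 t F : forest F -> (size F <= n.+1)%N -> cut_at extend F ->
  forest t.1 -> forest t.2.1 -> forest t.2.2 ->
  (size t.1 <= n)%N -> (size t.2.1 <= n)%N -> (size t.2.2 <= n)%N ->
  transform extend (mid3 zcutb zeta t) F = beta K t F.
Proof.
move=> fF sF cF f1 f2 f3 s1 s2 s3; rewrite /mid3 /mid (transform_hp extend_graded fF sF cF).
rewrite /beta /mid3 /mid /hp; apply: eq_big_seq => c cc.
have [fc1 fc2 sc] := cutb_forest fF cc.
rewrite [X in _ * X]transform_zeta //; congr (_ * _).
have sc1 : (size c.1 <= size F)%N by rewrite -sc leq_addr.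
(* The inner half product is evaluated at [c.1], which either has degree at most [n] or is [F]
   itself. *)
have cc1 : cut_at extend c.1.
  case: (leqP (size c.1) n) => le; first exact: extend_cut_small.
  suff -> : c.1 = F by [].
  by apply: cutb_full cc _ => //; apply/eqP; rewrite eqn_leq sc1 (leq_trans sF le).
rewrite (transform_hp extend_graded fc1 (leq_trans sc1 sF) cc1).
by apply: eq_big_seq => d /(cutb_forest fc1) [fd1 fd2 _]; rewrite !transform_zeta.
Qed.

Lemma transform_mid3_ntriples t F : forest F -> size F = n.+1 -> cut_at extend F ->
  t \in ntriples n.+1 -> transform extend (mid3 zcutb zeta t) F = beta K t F.
Proof.
move=> fF sF cF; case: t => x [p y]; rewrite mem_ntriples mem_triples /tdeg /= => /andP [nt /and4P [f1 ip f3 /eqP st]].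
have p0 := indec_size ip; apply: transform_mid3 => //=; rewrite ?sF ?indec_forest //; try lia.
by move: nt => /orP [] /size_gt0; lia.
Qed.

Lemma zeta_span k : (k < n.+1)%N -> forall f : seq nat -> K,
  exists c, forall a, is_parking a -> size a = k -> f a = \sum_(F <- forests k) c F * zeta F a.
Proof.
rewrite ltnS => kn f.
have [|c Hc] := span_family (uniq_parkings k) (uniq_forests k) (size_parkings k)
  (B := fun a F => zeta F a) _ f.
  move=> psi H G Gk.
  have : \sum_(a <- parkings k) M G a * (\sum_(F <- forests k) zeta F a * psi F) = 0.
    by rewrite big1_seq // => a /andP [_ ak]; rewrite H ?mulr0.
  under eq_bigr do rewrite mulr_sumr.
  rewrite exchange_big /=.
  under eq_bigr => F _.
    under eq_bigr do rewrite mulrA [M G _ * _]mulrC.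
    rewrite -mulr_suml; over.
  move=> E; rewrite -[RHS]E -[LHS](big_delta psi (uniq_forests k) Gk).
  apply: eq_big_seq => F Fk; rewrite zetaM // mulrC eq_sym.
  by [].
by exists c => a pa sa; apply: Hc; rewrite mem_parkings pa sa eqxx.
Qed.

(** Transported from [delta_mid]: with the same coefficients, the combination of the
    [mid3 zcutb zeta t] has transform [delta K F]. Its coordinates on the [zeta G] are the values of
    that transform, so it is [zeta F]. *)
Lemma zeta_mid k : (0 < k < n.+1)%N -> forall F, F \in forests k ->
  spanned is_parking (mid3 zcutb zeta) (triples k) k (zeta F).
Proof.
move=> /andP [k0 kn] F Fk; have := kn; rewrite ltnS => kn'.
have [psi Hpsi] := @delta_mid K k F k0 Fk.
have [c Hc] := zeta_span kn (fun a => \sum_(t <- triples k) psi t * mid3 zcutb zeta t a).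
exists psi => a pa sa; rewrite (Hc a pa sa).
have cE G : G \in forests k -> c G = (F == G)%:R.
  move=> Gk; have := Gk; rewrite mem_forests => /andP [fG /eqP sG].
  transitivity (\sum_(t <- triples k) psi t * beta K t G); last first.
    by rewrite -(Hpsi G fG sG) /delta eq_sym.
  transitivity (transform extend (fun a => \sum_(t <- triples k) psi t * mid3 zcutb zeta t a) G).
    rewrite /transform sG; transitivity (\sum_(a <- parkings k) \sum_(H <- forests k) c H * (zeta H a * M G a)).
      rewrite exchange_big /= -[LHS](big_delta c (uniq_forests k) Gk).
      by apply: eq_big_seq => H Hk; rewrite -mulr_sumr zetaM // eq_sym.
    apply: eq_big_seq => b; rewrite mem_parkings => /andP [pb /eqP sb].
    rewrite (Hc b pb sb) mulr_sumr extend_small ?sG //.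
    by apply: eq_bigr => H _; rewrite mulrA mulrC.
  rewrite /transform; under eq_bigr do rewrite mulr_sumr.
  rewrite exchange_big /=; apply: eq_big_seq => t; rewrite mem_triples => /and4P [f1 ip f3 /eqP st].
  transitivity (psi t * transform extend (mid3 zcutb zeta t) G).
    by rewrite /transform mulr_sumr; apply: eq_bigr => b _; rewrite mulrCA.
  have le x : (x <= tdeg t)%N -> (x <= n)%N by move=> xt; rewrite (leq_trans xt) // st.
  rewrite transform_mid3 ?(indec_forest ip) ?sG ?(leq_trans kn') //.
  - by apply: extend_cut_small; rewrite ?sG.
  - by apply: le; rewrite /tdeg -addnA leq_addr.
  - by apply: le; rewrite /tdeg addnAC leq_addl.
  by apply: le; rewrite /tdeg leq_addl.
rewrite -[LHS](big_delta (zeta^~ a) (uniq_forests k) Fk).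
by apply: eq_big_seq => G Gk; rewrite cE // mulrC.
Qed.

Lemma zeta_homog F : homog is_parking (size F) (zeta F).
Proof. by move=> a _ sa; apply: zeta_size. Qed.

Lemma spanned_parking_hp b i j (f g : seq nat -> K) : (0 < i)%N -> (0 < j)%N -> (i + j = n.+1)%N ->
  homog is_parking i f -> homog is_parking j g ->
  spanned is_parking (mid3 zcutb zeta) (ntriples n.+1) n.+1 (hp zcutb b f g).
Proof.
apply: spanned_hp.
- exact: zcutb_parking.
- exact: zhp_tt.
- exact: zhp_tf.
- exact: zhp_ff.
- by move=> F _ _; apply: zeta_homog.
- exact: zeta_span.
exact: zeta_mid.
Qed.
End Extension.
End Step.

Lemma last_nseq_same (b : bool) k : (last b (nseq k b)) = b.
Proof. by elim: k. Qed.

(** * Cuts with an empty side *)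

Section TrivialCuts.
Variable K : fieldType.
Local Open Scope ring_scope.

Lemma transform_delta n (M : seq nat -> seq nat -> K) F u : graded M n ->
  forest F -> (size F <= n)%N -> is_parking u -> transform M (delta K u) F = M F u.
Proof.
move=> gr fF sF pu; rewrite /transform /delta.
under eq_bigr do rewrite eq_sym.
case up : (u \in parkings (size F)); first by rewrite big_delta ?uniq_parkings.
rewrite big_delta0 ?up // gr ?parking_word // => E.
by move: up; rewrite mem_parkings pu E eqxx.
Qed.

Variables (n : nat) (M : seq nat -> seq nat -> K).
Hypotheses (gr : graded M n) (M1 : M [::] [::] = 1).
Variable F : seq nat.
Hypotheses (fF : forest F) (F0 : F != [::]) (sF : (size F <= n)%N).

Let M_nil (X : seq nat) : forest X -> (size X <= n)%N -> X != [::] -> M X [::] = 0.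
Proof. by move=> fX sX X0; apply: gr => //= E; case: (X) E X0. Qed.

(** The grading kills every cut except [([::], F)], which exists only for [b] false; on the right
    the only mask is constantly false, hence also requires [b] false. These cases escape
    [spanned_hp], which asks for positive degrees. *)
Lemma cut_nil_left b v : is_parking v -> (size v = size F)%N ->
  \sum_(c <- cutb b F) M c.1 [::] * M c.2 v =
  \sum_(s <- masks (size F) | (count id s == 0%N) && (last false s == b))
     M F (mix s [::] (map (addn 0%N) v)).
Proof.
move=> pv sv; rewrite (big_masks_none (size F) (fun s => last false s == b)) last_nseq_same.
have -> : map (addn 0) v = v by rewrite -[RHS]map_id; apply: eq_map.
rewrite mix_nseq_false //; case: b.
  rewrite big1_seq // => c /andP [_ cF]; have [f1 f2 sc] := cutb_forest fF cF.
  by rewrite M_nil ?mul0r ?(cutt_neq0 cF) //; apply: leq_trans sF; rewrite -sc leq_addr.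
rewrite (bigID (fun c => c.1 == [::])) /= (big_cutf_nil1 fF (fun a b => M a [::] * M b v) F0).
rewrite M1 mul1r big1_seq ?addr0 // => c /andP [c1 cF]; have [f1 f2 sc] := cutb_forest fF cF.
by rewrite M_nil ?mul0r //; apply: leq_trans sF; rewrite -sc leq_addr.
Qed.

Lemma cut_nil_right b u : is_parking u -> (size u = size F)%N ->
  \sum_(c <- cutb b F) M c.1 u * M c.2 [::] =
  \sum_(s <- masks (size F) | (count id s == size F) && (last false s == b))
     M F (mix s u [::]).
Proof.
move=> pu su; rewrite (big_masks_all (size F) (fun s => last false s == b)).
have -> : last false (nseq (size F) true) = true.
  by case: (size F) (size_gt0 F0) => //= k _; rewrite last_nseq_same.
rewrite mix_nseq_true //; case: b.
  rewrite (bigID (fun c => c.2 == [::])) /= (big_cutt_nil2 fF (fun a b => M a u * M b [::]) F0).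
  rewrite M1 mulr1 big1_seq ?addr0 // => c /andP [c1 cF]; have [f1 f2 sc] := cutb_forest fF cF.
  by rewrite [M c.2 _]M_nil ?mulr0 //; apply: leq_trans sF; rewrite -sc leq_addl.
rewrite big1_seq // => c /andP [_ cF]; have [f1 f2 sc] := cutb_forest fF cF.
by rewrite [M c.2 _]M_nil ?mulr0 ?(cutf_neq0 F0 cF) //; apply: leq_trans sF; rewrite -sc leq_addl.
Qed.
End TrivialCuts.

Section Step.
Variable K : fieldType.
Local Open Scope ring_scope.
Hypothesis size_parkings : forall k, size (parkings k) = size (forests k).
Variables (n : nat) (M : seq nat -> seq nat -> K).
Hypothesis gM : good M n.
Variable zeta : seq nat -> seq nat -> K.
Hypothesis zeta_size : forall F a, size a <> size F -> zeta F a = 0.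
Hypothesis zetaM : forall k, (k <= n)%N -> forall F G, F \in forests k -> G \in forests k ->
     \sum_(a <- parkings k) zeta F a * M G a = (F == G)%:R.
Variable gamma : seq nat -> seq nat -> K.
Hypothesis gammaP : forall F t, F \in indecs n.+1 -> t \in ntriples n.+1 ->
  \sum_(a <- parkings n.+1) gamma F a * mid3 zcutb zeta t a = beta K t F.

Let E := extend n M gamma.

Lemma transform_extend F t : F \in forests n.+1 -> t \in ntriples n.+1 ->
  transform E (mid3 zcutb zeta t) F = beta K t F.
Proof.
move=> Fn tn; have := Fn; rewrite mem_forests => /andP [fF /eqP sF].
case dF : (fdec F).
  exact: (transform_mid3_ntriples gM zeta_size zetaM fF sF (extend_cut_dec gM gamma fF sF dF) tn).
rewrite -gammaP // ?mem_indecs ?dF ?fF ?sF ?eqxx //.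
rewrite /transform sF; apply: eq_big_seq => a; rewrite mem_parkings => /andP [pa /eqP sa].
by rewrite /E /extend sF sa ltnn eqxx dF /= park_id.
Qed.

Lemma delta_parking_homog u : homog is_parking (size u) (delta K u).
Proof. by move=> a _ sa; rewrite /delta; case: eqP => // e; rewrite e in sa. Qed.

(** Both members of the identity are values at [F] of combinations of the [beta t]; their
    coefficients are compared on decomposable forests, where the identity is known. *)
Lemma extend_cut_indec F : forest F -> size F = n.+1 -> cut_at E F.
Proof.
move=> fF sF b u v pu pv suv.
have gr : graded E n.+1 := extend_graded gM gamma.
have E1 : E [::] [::] = 1 by rewrite /E extend_small // (good_unit gM).
have F0 : F != [::] by apply: size_neq0; rewrite sF.
have sFn : (size F <= n.+1)%N by rewrite sF.
case: (posnP (size u)) suv => [/size0nil -> /=|u0 suv].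
  by rewrite add0n => sv; apply: (cut_nil_left gr E1 fF F0 sFn).
case: (posnP (size v)) suv => [/size0nil -> /=|v0 suv].
  by rewrite addn0 => su; rewrite su; apply: (cut_nil_right gr E1 fF F0 sFn).
have suvn : (size u + size v = n.+1)%N by rewrite suv.
(* Expansion on the word side: the half product of the indicators of [u] and [v] in terms of the
   test elements. *)
have [psi Hpsi] := spanned_parking_hp size_parkings gM gamma zeta_size zetaM b u0 v0 suvn
  (@delta_parking_homog u) (@delta_parking_homog v).
have hom (w : seq nat) : is_parking w -> (size w <= n.+1)%N -> homog forest (size w) (transform E (delta K w)).
  move=> pw sw X fX sX; rewrite /transform big1_seq // => a /andP [_].
  rewrite mem_parkings => /andP [_ /eqP sa]; rewrite /delta; case: eqP => e; rewrite ?mulr0 //.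
  by case: sX; rewrite -sa e.
have su : (size u <= n.+1)%N by rewrite -suvn leq_addr.
have sv : (size v <= n.+1)%N by rewrite -suvn leq_addl.
(* Expansion on the forest side: the half product of the transforms in terms of the [beta t]. *)
have [psi' Hpsi'] := spanned_forest_hp b u0 v0 suvn (hom u pu su) (hom v pv sv).
have T G : G \in forests n.+1 ->
    transform E (hp zcutb b (delta K u) (delta K v)) G = \sum_(t <- ntriples n.+1) psi t * beta K t G.
  move=> Gn; have := Gn; rewrite mem_forests => /andP [fG /eqP sG].
  transitivity (\sum_(t <- ntriples n.+1) psi t * transform E (mid3 zcutb zeta t) G).
    rewrite /transform sG.
    transitivity (\sum_(a <- parkings n.+1) \sum_(t <- ntriples n.+1) psi t * (E G a * mid3 zcutb zeta t a)).
      apply: eq_big_seq => a; rewrite mem_parkings => /andP [pa /eqP sa].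
      by rewrite Hpsi // mulr_sumr; apply: eq_bigr => t _; rewrite mulrCA.
    by rewrite exchange_big; apply: eq_bigr => t _; rewrite mulr_sumr.
  by apply: eq_big_seq => t tn; rewrite transform_extend.
(* On decomposable forests [transform_hp] equates the two expansions, and the [beta t] are
   independent there. *)
have eqpsi t : t \in ntriples n.+1 -> psi t - psi' t = 0.
  apply: (@ntriples_free_all K n.+1 (fun t => psi t - psi' t)) => G Gn dG.
  have := Gn; rewrite mem_forests => /andP [fG /eqP sG].
  have sG' : (size G <= n.+1)%N by rewrite sG.
  have cG := extend_cut_dec gM gamma fG sG dG.
  have := T G Gn; rewrite (transform_hp gr fG sG' cG) Hpsi' // => /eqP.
  rewrite eq_sym -subr_eq0 -sumrB => /eqP e0; rewrite -[RHS]e0; apply: eq_bigr => t' _.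
  by rewrite -mulrBl mulrC.
have Fn : F \in forests n.+1 by rewrite mem_forests fF sF eqxx.
transitivity (hp cutb b (transform E (delta K u)) (transform E (delta K v)) F).
  apply: eq_big_seq => c cF; have [f1 f2 sc] := cutb_forest fF cF.
  by rewrite !(transform_delta gr) // (leq_trans _ sFn) // -sc ?leq_addr ?leq_addl.
transitivity (transform E (hp zcutb b (delta K u) (delta K v)) F).
  rewrite T // Hpsi' //; apply: eq_big_seq => t /eqpsi /eqP.
  by rewrite subr_eq0 => /eqP ->.
by rewrite /transform -suv; apply: big_parkings_cutb.
Qed.
End Step.

Section GoodStep.
Variable K : fieldType.
Local Open Scope ring_scope.
Hypothesis size_parkings : forall k, size (parkings k) = size (forests k).

Lemma good_step n (M : seq nat -> seq nat -> K) : good M n ->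
  exists M', good M' n.+1 /\ forall F w, (size F <= n)%N -> M' F w = M F w.
Proof.
move=> gM; have [zeta [zs zM]] := dual_basis gM.
have [||||||psi H|gamma [Hg Hf]] := @list_completion K _ _ (decs n.+1) (indecs n.+1) (parkings n.+1)
  (ntriples n.+1) (dec_value M) (fun a t => mid3 zcutb zeta t a) (fun F t => beta K t F).
- exact: uniq_decs.
- exact: uniq_indecs.
- exact: uniq_parkings.
- exact: uniq_ntriples.
- exact: size_ntriples.
- by rewrite size_parkings size_decs_indecs.
(* The product of the forced rows with the test elements is the matrix [beta] on decomposable
   forests, whose kernel is trivial. *)
- apply: (@ntriples_free_all K n.+1) => G Gn dG.
  have := Gn; rewrite mem_forests => /andP [fG /eqP sG].
  rewrite -[RHS](H G) ?mem_decs ?dG ?fG ?sG ?eqxx //.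
  apply: eq_big_seq => t tn; congr (_ * _).
  (* On decomposable forests the extension does not involve [gamma], which is still to be found;
     zero stands in for it. *)
  rewrite -(transform_mid3_ntriples gM (gamma := fun _ _ => 0) zs zM fG sG (extend_cut_dec gM _ fG sG dG) tn).
  rewrite /transform sG; apply: eq_big_seq => a; rewrite mem_parkings => /andP [pa /eqP sa].
  by rewrite /extend sG sa ltnn eqxx dG.
exists (extend n M gamma); split=> [|F w]; last exact: extend_small.
split.
- by rewrite extend_small // (good_unit gM).
- exact: extend_graded.
- exact: extend_park.
- exact: (extend_dot gM).
- exact: (extend_graft gM).
- move=> F fF; rewrite leq_eqVlt => /orP [/eqP sF|]; last by apply: extend_cut_small.
  exact: (extend_cut_indec size_parkings gM zs zM Hg).
move=> k; rewrite leq_eqVlt => /orP [/eqP ->|kn] c Hc F Fk; last first.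
  apply: (good_free gM kn) Fk => a ak; rewrite -[RHS](Hc a ak).
  by apply: eq_big_seq => G; rewrite mem_forests => /andP [_ /eqP sG]; rewrite extend_small ?sG.
have [|cD cU] := Hf c c.
  move=> a ap; have := ap; rewrite mem_parkings => /andP [pa /eqP sa].
  rewrite -[RHS](Hc a ap) (big_filter (forests n.+1) fdec) (big_filter (forests n.+1) (predC fdec)) [RHS](bigID fdec) /=; congr (_ + _).
    rewrite big_seq_cond [RHS]big_seq_cond; apply: eq_bigr => G /andP [].
    rewrite mem_forests => /andP [fG /eqP sG] dG.
    by rewrite /extend sG sa ltnn eqxx dG mulrC.
  rewrite big_seq_cond [RHS]big_seq_cond; apply: eq_bigr => G /andP [].
  rewrite mem_forests => /andP [fG /eqP sG] /negbTE dG.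
  by rewrite /extend sG sa ltnn eqxx dG mulrC park_id.
have := Fk; rewrite mem_forests => /andP [fF sF].
case dF : (fdec F); first by apply: cD; rewrite mem_decs dF fF.
by apply: cU; rewrite mem_indecs dF fF.
Qed.
End GoodStep.

(** * Passage to all degrees *)

Section Limit.
Variable K : fieldType.
Local Open Scope ring_scope.

Lemma good_eq n (M M' : seq nat -> seq nat -> K) : good M n ->
  (forall F w, (size F <= n)%N -> M' F w = M F w) -> good M' n.
Proof.
move=> g e; split.
- by rewrite e ?(good_unit g).
- by move=> F w fF sF ww sw; rewrite e ?(good_graded g).
- by move=> F w fF sF ww; rewrite !e ?(good_park g).
- move=> X Y fX fY s w ww; rewrite !e ?size_dot ?(good_dot g) ?(leq_trans _ s) ?leq_addr ?leq_addl //.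
- move=> X Y fX fY X0 s w ww; rewrite !e ?size_graft ?(good_graft g) ?(leq_trans _ s) ?leq_addr ?leq_addl //.
- move=> F fF sF b u v pu pv suv; under [RHS]eq_bigr do rewrite e //.
  rewrite -(good_cut g fF sF b pu pv suv); apply: eq_big_seq => c /(cutb_forest fF) [_ _ sc].
  by rewrite !e // (leq_trans _ sF) // -sc ?leq_addr ?leq_addl.
move=> k kn c H; apply: (good_free g kn) => a ak; rewrite -[RHS](H a ak); apply: eq_big_seq => F.
by rewrite mem_forests => /andP [_ /eqP sF]; rewrite e ?sF.
Qed.

Lemma good_0 : good (fun F w : seq nat => ((F == [::]) && (w == [::]))%:R : K) 0.
Proof.
split=> //.
- by move=> F w _; rewrite leqn0 size_eq0 => /eqP -> _ /=; case: w.
- move=> F w _; rewrite leqn0 size_eq0 => /eqP -> ww /=.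
  by rewrite -size_eq0 size_park // size_eq0.
- move=> X Y _ _; rewrite leqn0 addn_eq0 !size_eq0 => /andP [/eqP -> /eqP ->] w ww /=.
  by rewrite take0 drop0 mul1r.
- move=> X Y _ _ X0; rewrite leqn0 addn_eq0 !size_eq0 => /andP [/eqP E _].
  by rewrite E in X0.
- move=> F _; rewrite leqn0 size_eq0 => /eqP -> b u v pu pv /= /eqP.
  rewrite addn_eq0 !size_eq0 => /andP [/eqP -> /eqP ->].
  by rewrite /cutb /masks /=; case: b; rewrite unlock /= ?mulr1 ?addr0.
move=> k; rewrite leqn0 => /eqP -> c H F.
rewrite mem_forests => /andP [_]; rewrite size_eq0 => /eqP ->.
have := H [::]; rewrite mem_parkings => /(_ isT).
rewrite (bigD1_seq [::]) ?uniq_forests ?mem_forests //= mul1r big1_seq ?addr0 // => G.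
by rewrite mem_forests size_eq0 => /and3P [/negbTE -> _ /eqP]; rewrite mul0r.
Qed.

Hypothesis size_parkings : forall k, size (parkings k) = size (forests k).

(** Successive extensions are chosen one after another. Each keeps the values in lower degrees, so
    the diagonal [L (size F) F] agrees with [L n] on all forests of size at most [n]. *)
Lemma good_all : exists M : seq nat -> seq nat -> K, forall n, good M n.
Proof.
pose step n (x : {M : seq nat -> seq nat -> K | good M n}) :=
  constructive_indefinite_description _ (good_step size_parkings (svalP x)).
pose S := nat_rect (fun n => {M : seq nat -> seq nat -> K | good M n})
  (exist _ _ good_0) (fun n x => exist _ (sval (step n x)) (svalP (step n x)).1).
pose L n := sval (S n).
have LS n F w : (size F <= n)%N -> L n.+1 F w = L n F w by exact: (svalP (step n (S n))).2.
have LE n F w : (size F <= n)%N -> L n F w = L (size F) F w.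
  elim: n => [|n IH]; first by rewrite leqn0 => /eqP ->.
  by rewrite leq_eqVlt => /orP [/eqP -> //|lt]; rewrite LS ?IH.
exists (fun F => L (size F) F) => n; apply: (good_eq (svalP (S n))) => F w le.
exact: esym (LE n F w le).
Qed.
End Limit.

(** * Ordered forests and parking functions are equinumerous *)

Section PowersetMasks.
Variables (T : finType) (A : {set T}).

Definition mask_of (C : {set T}) : bitseq := [seq x \in C | x <- enum A].

Lemma mask_mask_of (C : {set T}) : C \subset A -> mask (mask_of C) (enum A) = enum C.
Proof.
move=> CA; rewrite -filter_mask /enum_mem -filter_predI.
apply: eq_filter => x; apply/andP/idP => [[]//|xC]; split=> //; exact: (subsetP CA).
Qed.

Lemma count_mask_of (C : {set T}) : C \subset A -> count id (mask_of C) = #|C|.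
Proof.
by move=> CA; rewrite cardE -(mask_mask_of CA) size_mask ?size_map.
Qed.

Lemma perm_masks : perm_eq (masks #|A|) [seq mask_of C | C <- enum (powerset A)].
Proof.
apply: uniq_perm; first exact: uniq_masks.
  rewrite map_inj_in_uniq ?enum_uniq // => C D; rewrite !mem_enum !inE => CA DA E.
  apply/setP => x; case xA : (x \in A); last first.
    by rewrite (contraFF (subsetP CA x) xA) (contraFF (subsetP DA x) xA).
  have : x \in enum A by rewrite mem_enum.
  by move: E => /eq_in_map; apply.
move=> s; rewrite mem_masks; apply/idP/mapP => [/eqP ss|[C _ ->]]; last by rewrite size_map cardE.
exists [set x in mask s (enum A)].
  by rewrite mem_enum inE; apply/subsetP => x; rewrite inE => /mem_mask; rewrite mem_enum.
apply: (@eq_from_nth _ false); first by rewrite size_map ss cardE.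
move=> i; rewrite cardE in ss; rewrite ss => lt; have [x0 _] : exists x0, x0 \in enum A.
  by case: (enum A) lt => // x0 r _; exists x0; rewrite mem_head.
by rewrite (nth_map x0) // inE in_mask ?enum_uniq // index_uniq ?enum_uniq // mem_nth.
Qed.

Lemma big_powerset_masks (R : nmodType) (f : bitseq -> R) :
  (\sum_(C : {set T} | C \subset A) f (mask_of C) = \sum_(s <- masks #|A|) f s)%R.
Proof.
rewrite (perm_big _ perm_masks) big_map big_enum_cond /=.
by apply: eq_bigl => C; rewrite inE andbT.
Qed.
End PowersetMasks.

(** * Forests with prescribed roots *)

Section Rooted.
Variable T : finType.
Implicit Types (p : {ffun T -> T}) (A Q C : {set T}).

Definition reach p Q x := [exists q in Q, fconnect p x q].

Lemma reachP p Q x : reflect (exists k, iter k p x \in Q) (reach p Q x).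
Proof.
apply: (iffP exists_inP) => [[q qQ c]|[k kQ]]; first by exists (findex p x q); rewrite iter_findex.
by exists (iter k p x); rewrite ?fconnect_iter.
Qed.

(* Parent maps of the forests on [A] planted on the roots [Q]. *)
Definition rooted A Q := [set p : {ffun T -> T} | [forall x, if x \in A then reach p Q x else p x == x]].

Lemma rootedP A Q p : reflect ((forall x, x \in A -> exists k, iter k p x \in Q) /\
  (forall x, x \notin A -> p x = x)) (p \in rooted A Q).
Proof.
rewrite inE; apply: (iffP forallP) => [H|[H1 H2] x].
  split=> x xA; have := H x; first by rewrite xA => /reachP.
  by rewrite (negbTE xA) => /eqP.
by case: ifP => [/H1/reachP //|/negbT/H2/eqP].
Qed.

Variables (A Q C : {set T}) (q : T).
Hypotheses (AQ : [disjoint A & Q]) (qQ : q \in Q) (CA : C \subset A).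

Definition attach p := [ffun x => if x \in C then q else p x].

Let qA : q \notin A.
Proof. by apply/negP => /(disjointFr AQ); rewrite qQ. Qed.

Lemma attach_inj : {in rooted (A :\: C) ((Q :\ q) :|: C) &, injective attach}.
Proof.
move=> p1 p2 /rootedP [_ H1] /rootedP [_ H2] /ffunP E; apply/ffunP => x.
case xC : (x \in C); last by have := E x; rewrite !ffunE xC.
by rewrite H1 ?H2 // !inE xC.
Qed.

Lemma attach_rooted p : p \in rooted (A :\: C) ((Q :\ q) :|: C) ->
  (attach p \in rooted A Q) /\ [set a in A | attach p a == q] = C.
Proof.
move=> /rootedP [H1 H2]; split.
  apply/rootedP; split=> x xA; last first.
    by rewrite ffunE (contraNF (subsetP CA x) xA) H2 // inE (negbTE xA) andbF.
  suff key k y : iter k p y \in (Q :\ q) :|: C -> exists k, iter k (attach p) y \in Q.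
    case xC : (x \in C); first by exists 1; rewrite /= ffunE xC.
    have [|k kQ] := H1 x; first by rewrite inE xC.
    exact: key kQ.
  elim: k y => [|k IH] y.
    rewrite /= !inE => /orP [/andP [_ yQ]|yC]; first by exists 0.
    by exists 1; rewrite /= ffunE yC.
  rewrite iterSr; case yC : (y \in C); first by exists 1; rewrite /= ffunE yC.
  by move=> /IH [l]; exists l.+1; rewrite iterSr ffunE yC.
apply/setP => a; rewrite inE ffunE; case aC : (a \in C); first by rewrite (subsetP CA) ?eqxx.
apply/negP => /andP [aA /eqP paq].
(* The vertex [q] lies outside [A], hence is fixed by [p]: a vertex sent to [q] would never reach
   another root. *)
have pq : p q = q by apply: H2; rewrite inE (negbTE qA) andbF.
have itq k : iter k p q = q by elim: k => //= k ->.
have [|[|k]] := H1 a; first by rewrite inE aC aA.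
  by rewrite /= !inE aC orbF (disjointFr AQ aA) andbF.
by rewrite iterSr paq itq !inE eqxx /= => qC; move: qA; rewrite (subsetP CA).
Qed.

Lemma attach_onto p : p \in rooted A Q -> [set a in A | p a == q] = C ->
  exists2 p', p' \in rooted (A :\: C) ((Q :\ q) :|: C) & p = attach p'.
Proof.
move=> /rootedP [H1 H2] EC; exists [ffun x => if x \in C then x else p x]; last first.
  apply/ffunP => x; rewrite !ffunE; case: ifP => [|-> //].
  by rewrite -EC inE => /andP [_ /eqP].
apply/rootedP; split=> x; rewrite inE ?negb_and ?negbK; last first.
  by rewrite ffunE; case: ifP => //= _; apply: H2.
case/andP => xC xA; have [k] := H1 x xA.
have xq : x != q by apply: contraNneq qA => <-.
move: xq {xC xA}; elim: k x => [|k IH] x xq.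
  by rewrite /= => xQ; exists 0; rewrite /= !inE xq xQ.
rewrite iterSr; case xC : (x \in C); first by exists 0; rewrite /= !inE xC orbT.
move=> kQ; have pxq : p x != q.
  apply/negP => /eqP pxq; case xA : (x \in A).
    by move: xC; rewrite -EC inE xA pxq eqxx.
  by case/eqP: xq; rewrite -pxq H2 ?xA.
by have [l] := IH (p x) pxq kQ; exists l.+1; rewrite iterSr ffunE xC.
Qed.

(** Detaching the root [q] turns its set of children [C] into roots, and [attach] is the inverse
    operation. *)
Lemma card_fiber : #|[set p in rooted A Q | [set a in A | p a == q] == C]| =
  #|rooted (A :\: C) ((Q :\ q) :|: C)|.
Proof.
rewrite -(card_in_imset attach_inj); apply: eq_card => p; rewrite inE.
apply/andP/imsetP => [[pr /eqP E]|[p' p'r ->]]; first exact: attach_onto.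
by have [-> ->] := attach_rooted p'r.
Qed.
End Rooted.

(* Parking functions are the words [w] with [slack (size w).+1 w]; the words with
   [slack m w] correspond to the forests planted on [m - size w] roots. *)
Definition slack m (w : seq nat) := [&& is_word w, size w <= m &
  all (fun i => count (fun x => i < x) w + i < m) (iota 0 m)].

(** Recursion on the positions [s] of the letter 1; the other letters, decreased by one, form a word
    for [m']. The test [n <= m'] is the instance [i = 0] of [slack]. *)
Fixpoint slacks m n : seq (seq nat) :=
  if m is m'.+1 then
    if n <= m' then
      [seq mix s (nseq (count id s) 1) (map S w) | s <- masks n, w <- slacks m' (n - count id s)]
    else [::]
  else if n is 0 then [:: [::]] else [::].

Lemma mix_ones_size s w : size w = size s - count id s ->
  size (mix s (nseq (count id s) 1) (map S w)) = size s.
Proof.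
elim: s w => [|[] s IH] w //=; first by rewrite add1n subSS /= => /IH ->.
by rewrite add0n subSn ?count_size //; case: w => // x w /= [/IH ->].
Qed.

Lemma mix_ones_word s w : is_word w -> size w = size s - count id s ->
  is_word (mix s (nseq (count id s) 1) (map S w)).
Proof.
elim: s w => [|[] s IH] w //=; first by move=> w0; rewrite add1n subSS /= => /IH ->.
by rewrite add0n subSn ?count_size //; case: w => // x w /= /andP [_ w0] [sw]; apply: IH.
Qed.

Lemma mix_ones_mask s w : all (fun x => 0 < x) w -> size w = size s - count id s ->
  map (pred1 1) (mix s (nseq (count id s) 1) (map S w)) = s.
Proof.
elim: s w => [|[] s IH] w //=; first by move=> w0; rewrite add1n subSS /= => /IH ->.
rewrite add0n subSn ?count_size //; case: w => // -[|x] w //= w0 [sw]; rewrite IH //.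
Qed.

Lemma mix_ones_rest s w : all (fun x => 0 < x) w -> size w = size s - count id s ->
  [seq x.-1 | x <- mix s (nseq (count id s) 1) (map S w) & 1 < x] = w.
Proof.
elim: s w => [|[] s IH] w /=; first by case: w.
  by move=> w0; rewrite add1n subSS /= => /IH ->.
rewrite add0n subSn ?count_size //; case: w => // -[|x] w //= w0 [sw]; rewrite IH //.
Qed.

Lemma mix_ones w : is_word w ->
  mix (map (pred1 1) w) (nseq (count id (map (pred1 1) w)) 1) (map S [seq x.-1 | x <- w & 1 < x]) = w.
Proof.
by elim: w => // -[|[|x]] w IH //=; rewrite add0n => /IH ->.
Qed.

Lemma size_rest w : is_word w -> size [seq x.-1 | x <- w & 1 < x] = size w - count id (map (pred1 1) w).
Proof.
move=> ww; rewrite size_map size_filter count_map -(count_predC (pred1 1) w) addKn.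
by apply: eq_in_count => x /(allP ww) /=; lia.
Qed.

Lemma slackS m w : is_word w ->
  slack m.+1 w = (size w <= m) && slack m [seq x.-1 | x <- w & 1 < x].
Proof.
move=> ww; rewrite /slack ww /=.
have -> : is_word [seq x.-1 | x <- w & 1 < x].
  by apply/allP => y /mapP [x]; rewrite mem_filter => /andP [x1 _] ->; lia.
have ct i : count (fun x => i < x) [seq x.-1 | x <- w & 1 < x] = count (fun x => i.+1 < x) w.
  by rewrite count_map count_filter; apply: eq_count => x /=; lia.
rewrite addn0; have -> : count (fun x => 0 < x) w = size w by apply/eqP; rewrite -all_count.
rewrite ltnS; case sw : (size w <= m); rewrite ?andbF //= (leq_trans _ (leqnSn m)) //=.
rewrite size_map size_filter (leq_trans (count_size _ _) sw) /=.
rewrite (iotaDl 1 0 m) all_map; apply: eq_all => i /=.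
by rewrite ct add1n addnS ltnS.
Qed.

Lemma mem_slacks m n w : (w \in slacks m n) = slack m w && (size w == n).
Proof.
elim: m n w => [|m IH] n w.
  by case: n => [|n]; rewrite /slack leqn0 ?inE; case: w => //= x w; rewrite ?andbF.
rewrite /= ; case: leqP => nm; last first.
  rewrite in_nil; apply/esym/negP => /andP [sw /eqP sn].
  have ww : is_word w by case/and3P: sw.
  by move: sw; rewrite slackS // sn leqNgt nm.
apply/allpairsPdep/andP => [[s [v [sm]]]|[sw /eqP sn]].
  rewrite IH => /andP [sv /eqP sz] ->; have vw : is_word v by case/and3P: sv.
  move: sm; rewrite mem_masks => /eqP ss; subst n.
  rewrite mix_ones_size // eqxx slackS ?mix_ones_size ?nm ?mix_ones_rest //.
  exact: mix_ones_word.
have ww : is_word w by case/and3P: sw.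
move: sw; rewrite slackS // => /andP [_ sr].
exists (map (pred1 1) w), [seq x.-1 | x <- w & 1 < x].
by rewrite mem_masks size_map sn eqxx IH sr size_rest // sn eqxx mix_ones.
Qed.

Lemma uniq_slacks m n : uniq (slacks m n).
Proof.
elim: m n => [|m IH] n; first by case: n.
rewrite /=; case: ifP => // nm; apply: allpairs_uniq_dep; rewrite ?uniq_masks // => -[s v] [t w].
move=> /allpairsPdep [s' [v' [sm vm [? ?]]]] /allpairsPdep [t' [w' [tm wm [? ?]]]]; subst s' v' t' w' => /= E.
move: sm tm vm wm; rewrite !mem_masks !mem_slacks => /eqP ss /eqP st /andP [/and3P [vw _ _] /eqP sv] /andP [/and3P [ww _ _] /eqP sw].
rewrite -ss in sv; rewrite -st in sw.
have Es : s = t by rewrite -(mix_ones_mask vw sv) -(mix_ones_mask ww sw) E.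
subst t; suff -> : v = w by [].
by rewrite -(mix_ones_rest vw sv) -(mix_ones_rest ww sw) E.
Qed.

Lemma size_slacks_parkings n : size (slacks n.+1 n) = size (parkings n).
Proof.
apply/perm_size/uniq_perm; rewrite ?uniq_slacks ?uniq_parkings // => w.
rewrite mem_slacks mem_parkings is_parkingE /slack; case: eqP => [sw|]; rewrite ?andbF // !andbT.
rewrite sw leqnSn; case: (is_word w) => //.
have ct i : count (fun x => i < x) w + cle w i = n.
  by rewrite /cle -sw -(count_predC (fun x => i < x) w); congr (_ + _); apply: eq_count => x /=; rewrite leqNgt.
apply/allP/parkcondP => H i; last first.
  by rewrite mem_iota0 => le; rewrite ltnS -(ct i) leq_add2l H ?sw.
by rewrite sw => le; have := H i; rewrite mem_iota0 => /(_ le); rewrite ltnS -(ct i) leq_add2l.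
Qed.

Lemma size_slacksS m n : size (slacks m.+1 n) =
  if n <= m then \sum_(s <- masks n) size (slacks m (n - count id s)) else 0.
Proof.
by rewrite /=; case: ifP => // _; rewrite size_allpairs_dep sumnE big_map.
Qed.

(** Induction on the number of vertices. A root [q] is chosen and the maps are sorted by the set [C]
    of its children; detaching them leaves [m] vertices, with [A :\: C] still to be attached. This
    is the recursion of [slacks], [C] playing the part of the positions of the letter 1. *)
Lemma card_rooted (T : finType) m (A Q : {set T}) : [disjoint A & Q] -> #|A| + #|Q| = m ->
  #|rooted A Q| = size (slacks m #|A|).
Proof.
elim: m A Q => [|m IH] A Q dAQ.
  move=> /eqP; rewrite addn_eq0 !cards_eq0 => /andP [/eqP -> /eqP ->]; rewrite cards0 /=.
  apply/eqP/cards1P; exists [ffun x => x]; apply/setP => p; rewrite !inE.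
  apply/forallP/eqP => [H|-> x]; last by rewrite inE ffunE.
  by apply/ffunP => x; have := H x; rewrite inE ffunE => /eqP.
case: (set_0Vmem Q) => [->|[q qQ]] cAQ.
  rewrite cards0 addn0 in cAQ; rewrite cAQ size_slacksS ltnn; apply: eq_card0 => p; apply/negbTE/negP => /rootedP [H _].
  have : 0 < #|A| by rewrite cAQ.
  by case/card_gt0P => x /H [k]; rewrite inE.
have cQ : #|Q :\ q| = #|Q|.-1 by rewrite (cardsD1 q Q) qQ.
have Q0 : 0 < #|Q| by apply/card_gt0P; exists q.
rewrite size_slacksS ifT; last by lia.
rewrite -sum1_card (partition_big (fun p : {ffun T -> T} => [set a in A | p a == q]) (fun C => C \subset A)) /=; last first.
  by move=> p _; apply/subsetP => x; rewrite inE => /andP [].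
etransitivity; last exact: (@big_powerset_masks T A nat (fun s => size (slacks m (#|A| - count id s)))).
apply: eq_bigr => C CA; rewrite count_mask_of // sum1dep_card (card_fiber dAQ qQ CA).
have cA : #|A :\: C| = #|A| - #|C| by rewrite cardsD (setIidPr CA).
have dC : [disjoint Q :\ q & C].
  apply: disjointWl (subD1set Q q) _; rewrite disjoint_sym.
  exact: disjointWl CA dAQ.
have lC := subset_leq_card CA.
rewrite (IH _ _) ?cA //; last first.
  by rewrite cardsU (disjoint_setI0 dC) cards0 subn0 cQ; lia.
rewrite disjoint_sym; apply/pred0P => x /=; rewrite !inE.
case xA : (x \in A); rewrite ?andbF // (disjointFr dAQ xA) andbF /= andbT.
by case: (x \in C).
Qed.

Lemma size_slacks_forests n : size (slacks n.+1 n) = size (forests n).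
Proof.
(* The code 0 of an absent parent becomes a vertex, the common root of all trees. *)
pose A : {set 'I_n.+1} := ~: [set ord0]; pose Q : {set 'I_n.+1} := [set ord0].
have cA : #|A| = n by rewrite cardsC1 card_ord.
have <- : #|rooted A Q| = size (slacks n.+1 n).
  rewrite (@card_rooted _ n.+1) ?cA ?cards1 ?addn1 //.
  by rewrite -setI_eq0 setIC setICr.
pose code (p : {ffun 'I_n.+1 -> 'I_n.+1}) : seq nat := [seq val (p (inord v)) | v <- iota 1 n].
have scode p : size (code p) = n by rewrite size_map size_iota.
have pcode p v : 0 < v -> v <= n -> par (code p) v = p (inord v).
  case: v => // v _ vn; rewrite /par /= (nth_map 0) ?size_iota //.
  by rewrite nth_iota.
rewrite cardE -(size_map code); apply/perm_size/uniq_perm; last 1 first.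
- move=> F; rewrite mem_forests; apply/mapP/andP => [[p]|[/forestP [H N] /eqP sF]].
    rewrite mem_enum => /rootedP [H1 H2] ->; rewrite scode; split=> //.
    have p0 : p ord0 = ord0 by apply: H2; rewrite !inE eqxx.
    have pc (x : 'I_n.+1) : par (code p) x = p x.
      case: (posnP x) => [x0|x0]; last by rewrite pcode ?inord_val // -ltnS.
      by have -> : x = ord0; [apply: val_inj | rewrite p0].
    have ipc k (x : 'I_n.+1) : iter k (par (code p)) x = iter k p x.
      by elim: k => //= k ->; rewrite pc.
    have def v : n < v -> par (code p) v = 0 by move=> nv; rewrite par_default ?scode.
    apply/forestP; rewrite scode; split=> v; case: (leqP v n) => vn; try by rewrite def.
    - by rewrite (pc (Ordinal (n:=n.+1) vn)) -ltnS.
    - have := ipc _ (Ordinal (n:=n.+1) vn) => /= {}ipc.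
      case: (posnP v) => [->|v0]; first by exists 0.
      have [|k] := H1 (Ordinal (n:=n.+1) vn); first by rewrite !inE -val_eqE /= -lt0n.
      by rewrite inE => /eqP E; exists k; rewrite ipc E.
    by exists 1; rewrite /= def.
  rewrite sF in H; pose p := [ffun x : 'I_n.+1 => inord (par F x) : 'I_n.+1].
  have pE (x : 'I_n.+1) : val (p x) = par F x by rewrite ffunE /= inordK ?ltnS.
  exists p; last first.
    apply: (@eq_from_nth _ 0); first by rewrite scode.
    move=> i; rewrite sF => lt; rewrite /code (nth_map 0 0) ?size_iota // nth_iota //.
    by rewrite -[val _]/(nat_of_ord _) pE inordK.
  rewrite mem_enum; apply/rootedP; split=> x; last first.
    by rewrite !inE negbK => /eqP ->; apply: val_inj; rewrite pE.
  move=> _; have [k Ek] := N x; exists k; rewrite inE; apply/eqP/val_inj => /=.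
  by rewrite -Ek; elim: k {Ek} => //= k IH; rewrite -IH -pE.
- rewrite map_inj_in_uniq ?enum_uniq // => p p'; rewrite !mem_enum => /rootedP [_ H] /rootedP [_ H'] E.
  apply/ffunP => x; case: (posnP x) => [x0|x0].
    have -> : x = ord0 by apply: val_inj.
    by rewrite H ?H' // !inE eqxx.
  have xn : x <= n by rewrite -ltnS.
  by apply: val_inj; rewrite -[x]inord_val /= -!pcode ?E.
exact: uniq_forests.
Qed.

Lemma size_parkings_forests n : size (parkings n) = size (forests n).
Proof. by rewrite -size_slacks_parkings size_slacks_forests. Qed.

(** * The isomorphism *)

Section Code.
Variable n : nat.
Implicit Types (p : rawforest n) (i j : 'I_n) (V L : {set 'I_n}).

Definition label (o : option 'I_n) : nat := if o is Some j then j.+1 else 0.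
Definition rawcode p : seq nat := [seq label (p i) | i <- enum 'I_n].

Lemma size_rawcode p : size (rawcode p) = n.
Proof. by rewrite size_map size_enum_ord. Qed.

Lemma nth_rawcode p i : nth 0 (rawcode p) i = label (p i).
Proof. by rewrite (nth_map i) ?size_enum_ord // nth_ord_enum. Qed.

Lemma par_rawcode p i : par (rawcode p) i.+1 = label (p i).
Proof. exact: nth_rawcode. Qed.

Lemma label_le o : label o <= n.
Proof. by case: o => [j|] /=; rewrite ?ltn_ord. Qed.

Lemma iter_par_stable (G : seq nat) k l v : iter k (par G) v = 0 -> k <= l -> iter l (par G) v = 0.
Proof. by move=> E /subnK <-; rewrite iterD E iter_par0. Qed.

Lemma path_par p i s : path (parent_rel p) i s -> iter (size s) (par (rawcode p)) i.+1 = (last i s).+1.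
Proof.
elim: s i => //= j s IH i /andP [/eqP pij /IH <-].
by rewrite -iterS iterSr par_rawcode pij.
Qed.

(** The set of vertices reached from [i] along parents strictly shrinks when [i] is replaced by its
    parent, since [i] itself is lost. *)
Lemma acyclic_ind p (P : 'I_n -> Prop) : acyclic p ->
  (forall i, (forall j, p i = Some j -> P j) -> P i) -> forall i, P i.
Proof.
move=> /forallP ac H i; move: {2}#|connect (parent_rel p) i| (leqnn #|connect (parent_rel p) i|) => k.
elim: k i => [|k IH] i.
  by rewrite leqn0 => /eqP /card0_eq /(_ i); rewrite inE connect0.
move=> ci; apply: H => j pij; apply: IH; rewrite -ltnS; apply: leq_trans ci.
apply/proper_card/properP; split.
  apply/subsetP => x; rewrite !inE => jx; apply: connect_trans jx.
  by apply: connect1; rewrite /parent_rel pij.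
exists i; rewrite !inE ?connect0 //; apply/negP => ji; case/existsP: (ac i).
by exists j; rewrite pij eqxx.
Qed.

(** A cycle would give an orbit of the parent map returning to its nonzero starting point for
    arbitrarily many steps; conversely, induction along parents brings every vertex to 0. *)
Lemma acyclic_forest p : acyclic p = forest (rawcode p).
Proof.
apply/idP/forestP => [ac|[_ N]].
  have def v : n < v -> par (rawcode p) v = 0 by move=> nv; rewrite par_default ?size_rawcode.
  rewrite size_rawcode; split=> -[|v]; rewrite ?par0 //; first 1 last.
  - by exists 0.
  - case: (ltnP v n) => vn; last by exists 1; rewrite /= def.
    rewrite -[v]/(nat_of_ord (Ordinal vn)); move: (Ordinal vn).
    apply: (acyclic_ind ac) => i IH; case pi : (p i) => [j|].
      by have [k Ek] := IH j pi; exists k.+1; rewrite iterSr par_rawcode pi.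
    by exists 1; rewrite /= par_rawcode pi.
  case: (ltnP v n) => vn; last by rewrite def.
  by rewrite (par_rawcode p (Ordinal vn)) label_le.
apply/forallP => v; apply/existsP => -[u /andP [/eqP pvu /connectP [s ps Ev]]].
have cyc : iter (size s).+1 (par (rawcode p)) v.+1 = v.+1.
  by rewrite iterSr par_rawcode pvu /= (path_par ps) -Ev.
have [k Ek] := N v.+1.
have cyck l : iter (l * (size s).+1) (par (rawcode p)) v.+1 = v.+1.
  by elim: l => // l IH; rewrite mulSn iterD IH cyc.
by have := cyck k; rewrite (iter_par_stable Ek) // leq_pmulr.
Qed.

Lemma rawcode_inj : injective rawcode.
Proof.
move=> p q E; apply/ffunP => i; have := congr1 (fun G => nth 0 G i) E; rewrite !nth_rawcode.
by case: (p i) (q i) => [j|] [k|] //= [/val_inj ->].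
Qed.

Lemma rawcode_onto G : G \in forests n -> exists p, rawcode p = G.
Proof.
rewrite mem_forests => /andP [/forestP [H _] /eqP sG]; rewrite sG in H.
exists [ffun i : 'I_n => if nth 0 G i is y.+1 then insub y else None].
apply: (@eq_from_nth _ 0) => [|i]; rewrite size_rawcode ?sG // => ni.
rewrite -[i]/(nat_of_ord (Ordinal ni)) nth_rawcode ffunE /=.
have := H i.+1; rewrite /par /=; case: (nth 0 G i) => // y yn.
by rewrite insubT.
Qed.
End Code.

Definition code n (F : oforest n) := rawcode (val F).

Section OrderedForests.
Variable n : nat.
Implicit Types (F : oforest n) (i j : 'I_n) (V L : {set 'I_n}).

Lemma size_code F : size (code F) = n. Proof. exact: size_rawcode. Qed.
Lemma forest_code F : forest (code F). Proof. by rewrite -acyclic_forest; apply: valP. Qed.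
Lemma code_inj : injective (@code n). Proof. by move=> F G /rawcode_inj /val_inj. Qed.
Lemma mem_code F : code F \in forests n.
Proof. by rewrite mem_forests forest_code size_code eqxx. Qed.

Lemma perm_forests : perm_eq (forests n) [seq code F | F <- enum {: oforest n}].
Proof.
apply: uniq_perm; first exact: uniq_forests.
  by rewrite map_inj_uniq; [apply: enum_uniq | apply: code_inj].
move=> G; apply/idP/mapP => [Gn|[F _ ->]]; last exact: mem_code.
have [p Ep] := rawcode_onto Gn; have ap : acyclic p.
  by rewrite acyclic_forest Ep; move: Gn; rewrite mem_forests => /andP [].
by exists (exist _ p ap : oforest n); rewrite ?mem_enum.
Qed.

Definition labels L : seq nat := [seq (nat_of_ord i).+1 | i <- enum L].

Lemma mem_labels L i : (i.+1 \in labels L) = (i \in L).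
Proof. by rewrite mem_map ?mem_enum // => j k [/val_inj]. Qed.

Lemma uniq_labels L : uniq (labels L).
Proof. by rewrite map_inj_uniq ?enum_uniq // => j k [/val_inj]. Qed.

Lemma labels0 L : 0 \notin labels L.
Proof. by apply/mapP => -[]. Qed.

Lemma rawcode_restrict F L : rawcode (restrict_raw (val F) L) = restr (code F) (labels L).
Proof.
apply: (@eq_from_nth _ 0) => [|i]; rewrite size_rawcode; first by rewrite size_restr size_map -cardE.
move=> iL'; have iL : i < size (enum L) by rewrite -cardE.
have [x0 _] : exists x0, x0 \in L by apply/card_gt0P; apply: leq_ltn_trans iL'.
pose o := Ordinal iL'; rewrite -[i in LHS]/(nat_of_ord o) nth_rawcode ffunE.
rewrite (nth_map 0) ?size_map // (nth_map x0) //.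
have -> : nth x0 (enum L) i = enum_val o by rewrite /enum_val; apply: set_nth_default.
rewrite par_rawcode; case: (val F (enum_val o)) => [u|] /=; last by rewrite /reindex_in (negbTE (labels0 L)).
rewrite /reindex_in mem_labels index_map; last by move=> j k [/val_inj].
case: ifP => uL; last by rewrite insubN // cardE index_mem mem_enum uL.
by rewrite insubT ?cardE ?index_mem ?mem_enum.
Qed.

Lemma code_restrict F L : code (restrict F L) = restr (code F) (labels L).
Proof.
rewrite /code /restrict insubdK ?rawcode_restrict //.
by rewrite -topredE /= acyclic_forest rawcode_restrict forest_restr ?forest_code ?uniq_labels ?labels0.
Qed.
End OrderedForests.

Lemma code_fconcat n m (F : oforest n) (G : oforest m) : code (fconcat F G) = dot (code F) (code G).
Proof.
have E : rawcode (concat_raw (val F) (val G)) = dot (code F) (code G).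
  apply: (@eq_from_nth _ 0) => [|i]; rewrite size_rawcode ?size_dot ?size_code // => lt.
  pose o := Ordinal lt; rewrite -[i]/(nat_of_ord o) nth_rawcode ffunE /dot nth_cat size_code.
  case: splitP => j Ej; rewrite Ej.
    by rewrite nth_rawcode; case: (val F j).
  rewrite addKn (nth_map 0) ?size_code // nth_rawcode.
  by case: (val G j) => //= k; rewrite addnS.
rewrite /code /fconcat insubdK ?E //.
by rewrite -topredE /= acyclic_forest E forest_dot ?forest_code.
Qed.

(** * Admissible cuts as sets closed under descendants *)

Section AdmissibleCuts.
Variables (n : nat) (F : oforest n).
Implicit Types (i j : 'I_n) (V L : {set 'I_n}).
Let p := val F.

Definition down_closed L := [forall x, if p x is Some y then (y \in L) ==> (x \in L) else true].
Definition tops L := [set v in L | if p v is Some y then y \notin L else true].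

Lemma down_closedP L : reflect (forall x y, p x = Some y -> y \in L -> x \in L) (down_closed L).
Proof.
apply: (iffP forallP) => [H x y pxy yL|H x]; first by have := H x; rewrite pxy yL.
by case pxy : (p x) => [y|] //; apply/implyP/H.
Qed.

Lemma desc_parent x y v : p x = Some y -> connect (parent_rel p) y v -> desc F x v.
Proof. by move=> pxy c; apply/existsP; exists y; rewrite -/p pxy eqxx. Qed.

Lemma descP x v : desc F x v -> exists2 y, p x = Some y & connect (parent_rel p) y v.
Proof. by case/existsP => y /andP [/eqP pxy c]; exists y. Qed.

Lemma desc_irr v : ~~ desc F v v.
Proof. by have /forallP := valP F; apply. Qed.

Lemma connect_desc y v : connect (parent_rel p) y v -> y = v \/ desc F y v.
Proof.
case/connectP => -[|z s] /=; first by move=> _ ->; left.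
case/andP => /eqP pyz ps ->; right; apply: (desc_parent pyz); apply/connectP.
by exists s.
Qed.

Lemma desc_connect y v : desc F y v -> connect (parent_rel p) y v.
Proof.
by move=> /descP [z pyz c]; apply: connect_trans c; apply: connect1; rewrite /parent_rel pyz.
Qed.

Lemma connect_LV y v V : connect (parent_rel p) y v -> v \in V -> y \in LV F V.
Proof.
move=> /connect_desc [->|d] vV; rewrite inE ?vV //.
by apply/orP; right; apply/exists_inP; exists v.
Qed.

Lemma LV_connect y V : y \in LV F V -> exists2 v, v \in V & connect (parent_rel p) y v.
Proof.
rewrite inE => /orP [yV|/exists_inP [v vV /desc_connect]]; first by exists y.
by exists v.
Qed.

Lemma LV_closed V : down_closed (LV F V).
Proof.
apply/down_closedP => x y pxy /LV_connect [v vV c]; apply: connect_LV vV.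
by apply: connect_trans c; apply: connect1; rewrite /parent_rel pxy.
Qed.

Lemma LV_tops L : down_closed L -> LV F (tops L) = L.
Proof.
move=> /down_closedP dL; apply/setP => w; apply/idP/idP => [/LV_connect [v]|].
  rewrite inE => /andP [vL _] /connectP [s ps Ev]; move: vL; rewrite {}Ev.
  elim: s w ps => //= z s IH w /andP [/eqP pwz /IH {}IH] lL.
  exact: dL pwz (IH lL).
move: w; apply: (acyclic_ind (valP F)) => w IH wL.
case top : (w \in tops L); first by rewrite inE top.
move: top; rewrite inE wL -/p /=; case pwy : (p w) => [y|] //= /negbFE yL.
by have /down_closedP := LV_closed (tops L); apply; [exact: pwy | apply: IH].
Qed.

(** Two comparable elements of [V] are exactly what prevents the lower one from being a top of
    [LV F V]. With [LV_tops], this makes [LV] and [tops] inverse bijections between admissible cuts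
    and closed sets. *)
Lemma tops_LV V : (tops (LV F V) == V) = admissible F V.
Proof.
apply/eqP/forall_inP => [E u uV|adm].
  apply/forall_inP => v vV; apply/implyP => _; apply/negP => /descP [y puy c].
  by move: uV; rewrite -{1}E inE puy (connect_LV c vV) andbF.
apply/setP => v; rewrite inE; apply/andP/idP => [[vL]|vV].
  have [w wV /connect_desc [->|/descP [y pvy c]]] := LV_connect vL; first by [].
  by rewrite pvy (connect_LV c wV).
split; first by rewrite inE vV.
case pvy : (p v) => [y|] //; apply/negP => /LV_connect [w wV c].
have d := desc_parent pvy c; have /forall_inP /(_ w wV) := adm v vV.
case: eqP => [E|_] /=; last by rewrite d.
by have := desc_irr v; rewrite {2}E d.
Qed.

Lemma big_admissible (R : nmodType) (f : {set 'I_n} -> R) :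
  (\sum_(V : {set 'I_n} | admissible F V) f (LV F V) = \sum_(L : {set 'I_n} | down_closed L) f L)%R.
Proof.
rewrite [RHS](reindex_onto (LV F) tops) => [|L]; last exact: LV_tops.
by apply: eq_bigl => V; rewrite LV_closed tops_LV.
Qed.

Lemma down_closed_uncut L : down_closed L = uncut (code F) (labels (~: L)) (labels L).
Proof.
apply/down_closedP/allP => [dL _ /mapP [x xL ->]|H x y pxy yL].
  rewrite mem_enum inE in xL; rewrite par_rawcode -/p; case pxy : (p x) => [y|] /=; last exact: labels0.
  by rewrite mem_labels; apply: contra xL; apply: dL pxy.
apply/negPn/negP => xL; have := H x.+1; rewrite mem_labels inE xL => /(_ isT).
by rewrite par_rawcode -/p pxy /= mem_labels yL.
Qed.
End AdmissibleCuts.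

Section Splits.
Variable R : nmodType.
Local Open Scope ring_scope.

Lemma big_splits_masks (I : seq nat) (f : seq nat -> seq nat -> R) :
  \sum_(s <- splits I) f s.1 s.2 = \sum_(m <- masks (size I)) f (mask m I) (mask (map negb m) I).
Proof.
elim: I f => [|x I IH] f; first by rewrite /= !big_seq1.
rewrite /= !big_cat /= !big_map /= (IH (fun a b => f (x :: a) b)) (IH (fun a b => f a (x :: b))).
by [].
Qed.

Lemma labels_setT n : labels [set: 'I_n] = iota 1 n.
Proof. by rewrite /labels enum_setT -enumT (map_comp succn) val_enum_ord -(iotaDl 1 0 n). Qed.

Lemma mask_labels n (L : {set 'I_n}) : mask (mask_of [set: 'I_n] L) (iota 1 n) = labels L.
Proof. by rewrite -labels_setT -map_mask mask_mask_of ?subsetT. Qed.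

Lemma mask_of_setC n (L : {set 'I_n}) : map negb (mask_of [set: 'I_n] L) = mask_of [set: 'I_n] (~: L).
Proof. by rewrite -map_comp; apply: eq_map => i /=; rewrite inE. Qed.

Lemma big_splits_sets n (f : seq nat -> seq nat -> R) :
  \sum_(s <- splits (iota 1 n)) f s.1 s.2 = \sum_(L : {set 'I_n}) f (labels (~: L)) (labels L).
Proof.
rewrite big_splits_masks size_iota.
have := @big_powerset_masks _ [set: 'I_n] R (fun m => f (mask m (iota 1 n)) (mask (map negb m) (iota 1 n))).
rewrite cardsT card_ord => <-; rewrite (reindex_inj (inv_inj (@setCK _))) /=.
by apply: eq_big => [L|L _]; rewrite ?subsetT // mask_of_setC !mask_labels setCK.
Qed.

Lemma big_admissible_cuts n (F : oforest n) (f : seq nat -> seq nat -> R) :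
  \sum_(V : {set 'I_n} | admissible F V) f (code (Roo F V)) (code (Lea F V)) =
  \sum_(c <- cuts (code F)) f c.1 c.2.
Proof.
under eq_bigr do rewrite !code_restrict.
rewrite (big_admissible F (fun L => f (restr (code F) (labels (~: L))) (restr (code F) (labels L)))).
under eq_bigl do rewrite down_closed_uncut.
rewrite big_mkcond -(big_splits_sets n (fun a b => if uncut (code F) a b then f (restr (code F) a) (restr (code F) b) else 0)).
rewrite -(big_mkcond (fun s => uncut (code F) s.1 s.2) (fun s => f (restr (code F) s.1) (restr (code F) s.2))).
rewrite -{1}[n](size_code F) (bigID (fun s => size (code F) \in s.1)) /cuts big_cat /=; congr (_ + _).
  by rewrite big_cutb; apply: eq_bigl => s; rewrite eqb_id.
by rewrite big_cutb; apply: eq_bigl => s; rewrite eqbF_neg.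
Qed.
End Splits.

Lemma size_pword n (a : pfun n) : size (pword a) = n.
Proof. by rewrite size_map size_tuple. Qed.

Lemma pword_parking n (a : pfun n) : is_parking (pword a).
Proof. exact: valP a. Qed.

Lemma pword_inj n : injective (@pword n).
Proof. by move=> a b /(inj_map val_inj) /val_inj /val_inj. Qed.

Lemma perm_parkings n : perm_eq (parkings n) [seq pword a | a <- enum {: pfun n}].
Proof.
apply: uniq_perm; first exact: uniq_parkings.
  by rewrite map_inj_uniq; [apply: enum_uniq | apply: pword_inj].
move=> w; apply/idP/mapP => [|[a _ ->]]; last by rewrite mem_parkings pword_parking size_pword eqxx.
rewrite mem_filter => /andP [pw /mapP [t _ E]]; rewrite E in pw.
by exists (exist _ t pw : pfun n); rewrite ?mem_enum.
Qed.

Section ShuffleWords.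

Lemma mix_index (T : eqType) (r : seq T) (P : pred T) u v : uniq r ->
  [seq if P x then nth 0 u (index x (filter P r)) else nth 0 v (index x (filter (predC P) r)) | x <- r] =
  mix (map P r) u v.
Proof.
elim: r u v => //= x r IH u v /andP [xr ur].
have neq y : y \in r -> (x == y) = false by move=> yr; apply: contraNF xr => /eqP ->.
case Px : (P x) => /=; rewrite eqxx nth0 -IH //; congr cons; apply/eq_in_map => y yr.
  by rewrite neq // nth_behead.
by rewrite neq // nth_behead.
Qed.

Lemma shuffle_wordE (u v : seq nat) (S : {set 'I_(size u + size v)}) : #|S| = size u ->
  shuffle_word S = mix (mask_of [set: _] S) u (map (addn (foldr maxn 0 u + size u + size v)) v).
Proof.
move=> cS; rewrite /mask_of enum_setT -enumT -mix_index ?enum_uniq // /shuffle_word.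
have -> : filter (mem S) (enum 'I_(size u + size v)) = enum S.
  by rewrite [in RHS]/enum_mem enumT.
have -> : filter (predC (mem S)) (enum 'I_(size u + size v)) = enum (~: S).
  by rewrite [in RHS]/enum_mem enumT; apply: eq_filter => x; rewrite !inE.
apply: eq_map => i /=; case: ifP => // iS; rewrite (nth_map 0) //.
have sv : size (enum (~: S)) = size v by rewrite -cardE cardsCs setCK card_ord cS addKn.
by rewrite -[X in (_ < X)%N]sv index_mem mem_enum inE iS.
Qed.
End ShuffleWords.

(** This is the shift used in [shuffle_word], so the words there stand for words over the ordinal
    sum of the two alphabets. *)
Lemma far_foldr_maxn (u : seq nat) k : far u (foldr maxn 0 u + size u + k).
Proof.
apply/allP => x xu; apply: leq_trans (leq_addr _ _); rewrite leq_add2r.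
elim: u xu => //= y u IH.
by rewrite inE => /orP [/eqP ->|/IH H]; rewrite leq_max ?leqnn ?H ?orbT.
Qed.

(** * The morphism attached to a pairing *)

Section Isomorphism.
Variable K : fieldType.
Local Open Scope ring_scope.
Variable M : seq nat -> seq nat -> K.
Hypothesis gM : forall n, good M n.

Definition hopf_map n (F : oforest n) : {ffun pfun n -> K} := [ffun a => M (code F) (pword a)].

Lemma sum_pfun n (f : seq nat -> K) : \sum_(a : pfun n) f (pword a) = \sum_(a <- parkings n) f a.
Proof. by rewrite (perm_big _ (perm_parkings n)) big_map big_enum. Qed.

Lemma sum_oforest n (f : seq nat -> K) : \sum_(F : oforest n) f (code F) = \sum_(F <- forests n) f F.
Proof. by rewrite (perm_big _ (perm_forests n)) big_map big_enum. Qed.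

(** Invariance under parkization gives the coefficient at every word, and not only at parking
    functions; the grading covers the words of other lengths. *)
Lemma ser_hopf_map n (F : oforest n) w : ser (hopf_map F) w = (is_word w)%:R * M (code F) w.
Proof.
transitivity (\sum_(a <- parkings n) M (code F) a * (is_word w && (park w == a))%:R).
  by rewrite -sum_pfun; apply: eq_bigr => a _; rewrite ffunE.
case ww : (is_word w); last by rewrite big1 ?mul0r // => a _; rewrite mulr0.
rewrite mul1r /=; case: (eqVneq (size w) n) => [sw|/eqP sw].
  rewrite (big_delta (M (code F))) ?uniq_parkings ?mem_parkings ?park_parking ?size_park ?sw ?eqxx //.
  by rewrite (good_park (gM n)) ?forest_code ?size_code.
rewrite (big_delta0 (M (code F))); last by rewrite mem_parkings size_park // negb_and orbC; move/eqP: sw => ->.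
by rewrite (good_graded (gM n)) ?forest_code ?size_code.
Qed.

Lemma hopf_map_unit (F : oforest 0) : ser (hopf_map F) =1 sunit K.
Proof.
move=> w; rewrite ser_hopf_map /sunit.
have -> : code F = [::] by apply/size0nil/size_code.
case: (eqVneq w [::]) => [->|w0]; first by rewrite (good_unit (gM 0)) mulr1.
case ww : (is_word w); rewrite ?mul0r // (good_graded (gM 0)) ?mulr0 //.
by case: w w0 {ww}.
Qed.

(** Among the deconcatenations of [w], the grading leaves only the one after [n] letters, and
    [good_dot] evaluates it. *)
Lemma hopf_map_prod n m (F : oforest n) (G : oforest m) :
  ser (hopf_map (fconcat F G)) =1 sprod (ser (hopf_map F)) (ser (hopf_map G)).
Proof.
move=> w; rewrite ser_hopf_map code_fconcat /sprod.
under eq_bigr do rewrite !ser_hopf_map.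
case ww : (is_word w); last first.
  rewrite mul0r big1 // => i _; move: ww; rewrite -{1}(cat_take_drop i w) /is_word all_cat.
  by move=> /negbT; rewrite negb_and => /orP [] /negbTE ->; rewrite !mul0r ?mulr0.
have dotFG : dot_at M (code F) (code G).
  by apply: (good_dot (gM (n + m))); rewrite ?forest_code // !size_code.
rewrite mul1r dotFG // size_code.
have wt i : is_word (take i w) by apply: take_word.
have wd i : is_word (drop i w) by apply: drop_word.
have gr i : (i <= size w)%N -> i <> n -> M (code F) (take i w) = 0.
  move=> iw ni; apply: (good_graded (gM n)); rewrite ?forest_code ?size_code //.
  by rewrite size_take_min (minn_idPl iw).
case: (leqP n (size w)) => nw; last first.
  rewrite (good_graded (gM n)) ?forest_code ?size_code ?mul0r ?take_word //; last first.
    by rewrite take_oversize ?(ltnW nw) // => E; rewrite E ltnn in nw.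
  rewrite big1 // => i _; rewrite gr ?mulr0 ?mul0r //; first by rewrite -ltnS.
  by move=> E; have := ltn_ord i; rewrite E ltnS leqNgt nw.
rewrite (bigD1 (Ordinal (nw : n < (size w).+1)%N)) //= wt wd !mul1r big1 ?addr0 // => i ni.
rewrite gr ?mulr0 ?mul0r //; first by rewrite -ltnS.
by move=> E; case/eqP: ni; apply: val_inj.
Qed.

Lemma DeltaS_hopf_map n (F : oforest n) u v : is_word u -> is_word v ->
  DeltaS (hopf_map F) u v =
  \sum_(s <- masks (size u + size v) | count id s == size u)
    M (code F) (mix s u (map (addn (foldr maxn 0 u + size u + size v)%N) v)).
Proof.
move=> uw vw; set N := (foldr maxn 0 u + size u + size v)%N.
transitivity (\sum_(S : {set 'I_(size u + size v)} | #|S| == size u) ser (hopf_map F) (shuffle_word S)).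
  rewrite /DeltaS /DeltaG; under eq_bigr do rewrite mulr_sumr.
  by rewrite exchange_big.
have E := @big_powerset_masks _ [set: 'I_(size u + size v)] K
  (fun s => if count id s == size u then M (code F) (mix s u (map (addn N) v)) else 0).
rewrite cardsT card_ord in E; rewrite [RHS]big_mkcond -[RHS]E big_mkcond; apply: eq_big => [S|S _]; first by rewrite subsetT.
rewrite count_mask_of ?subsetT //; case: eqP => // cS.
rewrite ser_hopf_map shuffle_wordE // mix_word ?mul1r //; last exact/far_le/far_foldr_maxn.
apply: mixable_masks => //; first by rewrite size_map -cardE cardsT card_ord.
by rewrite count_mask_of ?subsetT.
Qed.

(** In degree [n] this is [good_cut], summed over the two sides and extended to words by the gap in
    [shuffle_word]; in other degrees both members vanish by the grading. *)
Lemma hopf_map_coprod n (F : oforest n) u v : is_word u -> is_word v ->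
  \sum_(V : {set 'I_n} | admissible F V)
    ser (hopf_map (Roo F V)) u * ser (hopf_map (Lea F V)) v = DeltaS (hopf_map F) u v.
Proof.
move=> uw vw; rewrite DeltaS_hopf_map //.
under eq_bigr do rewrite !ser_hopf_map uw vw !mul1r.
rewrite (big_admissible_cuts F (fun a b => M a u * M b v)).
have fF := forest_code F; have sF := size_code F.
case: (eqVneq (size u + size v)%N n) => [suv|/eqP nsuv].
  have cF : cut_at M (code F) by apply: (good_cut (gM n)); rewrite ?sF.
  have cw b := @cut_at_words K M n (code F) (good_park (gM n)) fF (eq_leq sF) cF b _ u v uw vw _ (far_foldr_maxn u (size v)).
  rewrite /cuts big_cat /= !cw ?sF // suv [RHS](bigID (fun s => last false s)) /=; congr (_ + _); apply: eq_bigl => s.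
    by rewrite eqb_id.
  by rewrite eqbF_neg.
transitivity (0 : K).
  rewrite big1_seq // => c /andP [_ /(cuts_forest fF) [f1 f2 sc]].
  rewrite sF in sc; case: (eqVneq (size u) (size c.1)) => [su|/eqP su]; last first.
    by rewrite (good_graded (gM (size c.1))) ?mul0r.
  rewrite [M c.2 v](good_graded (gM (size c.2))) ?mulr0 // => sv.
  by case: nsuv; rewrite su sv.
rewrite big1_seq // => s /andP [/eqP cs]; rewrite mem_masks => /eqP ss.
rewrite (good_graded (gM n)) ?sF ?mix_word ?size_mix ?ss //; last exact/far_le/far_foldr_maxn.
exact: mixable_masks.
Qed.

(** Injectivity is [good_free]; surjectivity follows since ordered forests and parking functions of
    length [n] are equally many. *)
Lemma linext_hopf_map_bijective n : bijective (linext (@hopf_map n)).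
Proof.
pose B (a : pfun n) (F : oforest n) := M (code F) (pword a).
have inj (psi : oforest n -> K) : (forall a, \sum_(F : oforest n) B a F * psi F = 0) -> forall F, psi F = 0.
  move=> H F.
  pose c G := \sum_(F : oforest n) psi F * (G == code F)%:R.
  have cE G : c (code G) = psi G.
    rewrite /c (bigD1 G) //= eqxx mulr1 big1 ?addr0 // => G' G'G.
    by rewrite (inj_eq (@code_inj n)) eq_sym (negbTE G'G) mulr0.
  rewrite -cE; apply: (good_free (gM n) (leqnn n)) (mem_code F) => a.
  rewrite (perm_mem (perm_parkings n)) => /mapP [b _ ->].
  rewrite -(sum_oforest n (fun G => M G (pword b) * c G)) -[RHS](H b).
  by apply: eq_bigr => G _; rewrite cE.
have onto (y : {ffun pfun n -> K}) : exists x, linext (@hopf_map n) x = y.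
  have sz : size (enum {: pfun n}) = size (enum {: oforest n}).
    rewrite -(size_map (@pword n)) -(perm_size (perm_parkings n)) size_parkings_forests.
    by rewrite (perm_size (perm_forests n)) size_map.
  have [|psi Hpsi] := @span_family K _ _ _ _ B (enum_uniq _) (enum_uniq _) sz _ y.
    move=> psi H F _; apply: inj => a; rewrite -[RHS](H a) ?mem_enum //.
    by rewrite big_enum.
  exists [ffun F => psi F]; apply/ffunP => a; rewrite ffunE (Hpsi a) ?mem_enum // big_enum.
  by apply: eq_bigr => F _; rewrite !ffunE.
have [g gK] := functional_choice _ onto.
have linj : injective (linext (@hopf_map n)).
  move=> x x' E; apply/ffunP => F; apply/eqP; rewrite -subr_eq0; apply/eqP.
  apply: (inj (fun F => x F - x' F)) => a.
  have /eqP := congr1 (fun f : {ffun _ -> _} => f a) E; rewrite !ffunE -subr_eq0 -sumrB => /eqP e.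
  by rewrite -[RHS]e; apply: eq_bigr => G _; rewrite ffunE -mulrBl mulrC.
by exists g => // x; apply: linj.
Qed.
End Isomorphism.

Local Open Scope ring_scope.

Theorem mainTheorem1 (K : fieldType) (charK : [pchar K] =i pred0) :
  exists phi : forall n : nat, oforest n -> {ffun pfun n -> K},
  [/\ forall n : nat, bijective (linext (phi n)),
      forall F0 : oforest 0, ser (phi 0%N F0) =1 sunit K,
      forall (n m : nat) (F : oforest n) (G : oforest m),
        ser (phi (n + m)%N (fconcat F G)) =1 sprod (ser (phi n F)) (ser (phi m G))
    & forall (n : nat) (F : oforest n) (u v : seq nat), is_word u -> is_word v ->
        \sum_(V : {set 'I_n} | admissible F V)
            ser (phi _ (Roo F V)) u * ser (phi _ (Lea F V)) v
        = DeltaS (phi n F) u v].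
Proof.
have [M gM] := good_all K size_parkings_forests.
exists (fun n => @hopf_map K M n); split.
- exact: linext_hopf_map_bijective.
- exact: hopf_map_unit.
- exact: hopf_map_prod.
exact: hopf_map_coprod.
Qed.
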